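(* Let $\theta>0$, let $q\ge1$ be an integer, let $\mathcal{L}$ be a probability measure on $\mathbb{C}^*$, and let $(M_N)_{N\ge1}$ be a sequence of random matrices such that $M_N$ follows the distribution $\mathbb{P}(N,\theta,\mathcal{L})$. Suppose that if $Z$ follows the distribution $\mathcal{L}$, then $\log|Z|$ is integrable, and let $R:=\exp(\mathbb{E}[\log|Z|])$. Then the probability measure $\frac{1}{N(N-1)\cdots(N-q+1)}\tilde\mu_N^{[q]}$ (for $N \geq q$) converges weakly, as $N\to\infty$, to the $q$-th (product) power of the uniform distribution on the circle $\{|z|=R\}$. Moreover, if $\log|Z|$ is in $\mathcal{U}^{q+1}$, then for all $0<R_1<R<R_2$, the restriction of $\tilde\mu_N^{[q]}$ to the set $\{(z_1,\dots,z_q)\in\mathbb{C}^q:\ \forall r\le q,\ |z_r|\notin(R_1,R_2)\}$ converges weakly to the corresponding restriction of $\tilde\mu_\infty^{[q]}$.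
   Context: $\Sigma_N$ is the group of permutations of $\{1,\dots,N\}$. For $\sigma\in\Sigma_N$ and $z_1,\dots,z_N\in\mathbb{C}^*$, $M(\sigma,z_1,\dots,z_N)$ is the $N\times N$ matrix $M$ with entries $M_{jk}=z_j\mathbf{1}_{j=\sigma(k)}$. $\mathbb{P}(N,\theta,\mathcal{L})$ is the law of $M(\sigma,z_1,\dots,z_N)$ where $\sigma$ follows the Ewens measure of parameter $\theta$ on $\Sigma_N$ (each permutation has probability proportional to $\theta^n$, $n$ its number of cycles), $z_1,\dots,z_N$ have law $\mathcal{L}$, and $\sigma,z_1,\dots,z_N$ are independent. For a point measure $\sum_j\delta_{\omega_j}$ on $\mathbb{C}$ (points listed with multiplicity), consider the measure $\sum_{j_1\ne\dots\ne j_q}\delta_{(\omega_{j_1},\dots,\omega_{j_q})}$ on $\mathbb{C}^q$, the sum being over $q$-tuples of pairwise distinct indices. $\tilde\mu_N^{[q]}$ is the expectation of this measure when $(\omega_j)_{1\le j\le N}$ are the eigenvalues of $M_N$ with multiplicity; $\tilde\mu_\infty^{[q]}$ is its expectation when $\sum_j\delta_{\omega_j}$ is the random point measure $$\mu_\infty=\sum_{k=1}^\infty\sum_{p=1}^{a_k}\sum_{\omega^k=T_{k,p}}\delta_\omega,$$ where all the variables $(a_k)_{k\ge1}$, $(T_{k,p})_{k,p\ge1}$ are independent, $a_k$ is a Poisson variable with $\mathbb{E}[a_k]=\theta/k$, and $T_{k,p}$ is distributed as the product of $k$ independent random variables of law $\mathcal{L}$. For $s>0$, a real integrable random variable $X$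 is said to be in $\mathcal{U}^s$ if, for $(X_k)_{k\ge1}$ i.i.d. with the distribution of $X$ and for all $\epsilon>0$, there exists $C>0$ such that for all $n\ge1$, $\mathbb{P}\left[\left|\left(\frac1n\sum_{k=1}^nX_k\right)-\mathbb{E}[X]\right|\ge\epsilon\right]\le C/n^s$. *)

(* Defs.v *)
From HB Require Import structures.
From mathcomp Require Import all_boot all_order all_algebra all_fingroup.
From mathcomp Require Import complex.
From mathcomp Require Import all_classical all_reals all_analysis.

Set Implicit Arguments.
Unset Strict Implicit.
Unset Printing Implicit Defensive.

Import Order.TTheory GRing.Theory Num.Theory.
Import numFieldNormedType.Exports.

Local Open Scope classical_set_scope.
Local Open Scope ring_scope.

(* [R[i]] receives the topology of its modulus, as any [numFieldType] does. *)
HB.instance Definition _ (R : realType) := PseudoPointedMetric.copy R[i] R[i]^o.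
HB.instance Definition _ (R : realType) := NormedModule.copy R[i] R[i]^o.

Notation borel T := (g_sigma_algebraType (@open T)).

Section measures.
Context (R : realType).

(* The measures of the statement are defined as plain set functions, so that
   being a finite measure (on Borel sets) is part of what weak convergence
   asserts. *)
Definition is_finite_measure d (T : measurableType d) (mu : set T -> \bar R) :=
  [/\ mu set0 = 0%E, (forall A, (0 <= mu A)%E), semi_sigma_additive mu &
      (mu setT < +oo)%E].

Definition weakly_converges (T : ptopologicalType)
    (mu_ : nat -> set (borel T) -> \bar R) (mu : set (borel T) -> \bar R) :=
  [/\ \forall n \near \oo, is_finite_measure (mu_ n),
      is_finite_measure mu &
      forall f : T -> R, continuous f -> (exists c : R, forall x, `|f x| <= c) ->
        (fun n => \int[mu_ n]_x (f x)%:E)%E @ \oo --> (\int[mu]_x (f x)%:E)%E].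

Definition restriction T (mu : set T -> \bar R) (F : set T) : set T -> \bar R :=
  fun A => mu (A `&` F).

(* Iterated integrals, as for the library's binary product [\x]. *)
Fixpoint product_power (mu : set (borel R[i]) -> \bar R) (q : nat) :
    set (borel 'rV[R[i]]_q) -> \bar R :=
  match q with
  | 0 => fun A => \d_((0 : 'rV[R[i]]_0) : borel 'rV[R[i]]_0) A
  | q'.+1 => fun A =>
      (\int[mu]_x product_power mu
         [set v : 'rV[R[i]]_q' | A (row_mx (x%:M : 'M[R[i]]_1) v)])%E
  end.

Let pi2_gt0 : (0 : R) < 2 * pi.
Proof. by rewrite mulr_gt0// pi_gt0. Qed.

Definition uniform_circle (r : R) : set (borel R[i]) -> \bar R :=
  fun A => uniform_prob pi2_gt0
    [set t : R | A ((r * cos t) +i* (r * sin t))%C].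

End measures.

Section random_variables.
Context (R : realType).

Definition has_law d (Om : measurableType d) (P : probability Om R)
    d' (T : measurableType d') (X : Om -> T) (mu : set T -> \bar R) :=
  measurable_fun setT X /\
  forall A, measurable A -> P (X @^-1` A) = mu A.

Definition sigma_of (Om : Type) d' (T : measurableType d') (X : Om -> T) :
    set (set Om) :=
  preimage_set_system setT X measurable.

(* Mutual independence of the sigma-algebras [F i], [i] in [J]; this form
   covers families of random variables with values in different spaces. *)
Definition mutually_independent d (Om : measurableType d)
    (P : probability Om R) (I : choiceType) (J : set I)
    (F : I -> set (set Om)) :=
  forall (s : seq I) (A : I -> set Om), uniq s ->
    (forall i, i \in s -> J i /\ F i (A i)) ->
    P (\bigcap_(i in [set` s]) A i) = (\prod_(i <- s) P (A i))%E.

Definition iid d (Om : measurableType d) (P : probability Om R)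
    (I : choiceType) d' (T : measurableType d') (X : I -> Om -> T)
    (mu : set T -> \bar R) :=
  (forall i, has_law P (X i) mu) /\
  mutually_independent P setT (fun i => sigma_of (X i)).

(* The class U^s; the i.i.d. copies are indexed from 0. *)
Definition in_U d (Om : measurableType d) (P : probability Om R)
    (X : Om -> R) (s : R) :=
  P.-integrable setT (EFin \o X) /\
  forall d' (Om' : measurableType d') (P' : probability Om' R)
    (Y : nat -> Om' -> R),
    iid P' Y (fun A => P (X @^-1` A)) ->
    forall eps : R, 0 < eps -> exists2 C : R, 0 < C &
      forall n, (0 < n)%N ->
        (P' [set w | (eps <= `| n%:R^-1 * (\sum_(k < n) Y k w)
                               - fine 'E_P[X] |)%R]
         <= (C / (n%:R `^ s))%:E)%E.

Definition has_product_law (L : probability (borel R[i]) R) (k : nat)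
    d (Om : measurableType d) (P : probability Om R)
    (X : Om -> borel R[i]) :=
  exists d' (Om' : measurableType d') (P' : probability Om' R)
    (Y : 'I_k -> Om' -> borel R[i]),
    iid P' Y L /\
    has_law P X (fun A => P' [set w | A (\prod_(i < k) (Y i w : R[i]))%R]).

Definition log_modulus (z : R[i]) : R := ln (Normc.normc z).

End random_variables.

Section permutation_matrices.
Context (R : realType).

Definition ewens (N : nat) (theta : R) (s : 'S_N) : R :=
  theta ^+ #|porbits s| / \sum_(t : 'S_N) theta ^+ #|porbits t|.

Definition perm_matrix (N : nat) (s : 'S_N) (z : 'I_N -> R[i]) : 'M[R[i]]_N :=
  \matrix_(j, k) (z j *+ (j == s k)).

(* [M] follows the distribution P(N, theta, L). *)
Definition follows_ewens_matrix (N : nat) (theta : R)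
    (L : probability (borel R[i]) R)
    d (Om : measurableType d) (P : probability Om R)
    (M : Om -> borel 'M[R[i]]_N) :=
  exists d' (Om' : measurableType d') (P' : probability Om' R)
    (s : Om' -> 'S_N) (z : 'I_N -> Om' -> borel R[i]),
  [/\ forall t, measurable (s @^-1` [set t]) /\
                P' (s @^-1` [set t]) = (ewens theta t)%:E,
      forall j, has_law P' (z j) L,
      mutually_independent P' setT
        (fun i : option 'I_N =>
           if i is Some j then sigma_of (z j) else [set s @^-1` B | B in setT]) &
      has_law P M
        (fun A => P' [set w | A (perm_matrix (s w) (fun j => z j w))])].

Definition eigenvalues (N : nat) (M : 'M[R[i]]_N) : seq R[i] :=
  sval (closed_field_poly_normal (char_poly M)).

(* For the points [om i], [i] in [J], listed with multiplicity: the sum of the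
   Dirac masses at [(om (j 1), ..., om (j q))] over the [q]-tuples [j] of
   pairwise distinct elements of [J]. *)
Definition distinct_tuples_measure (q : nat) (I : choiceType) (J : set I)
    (om : I -> R[i]) : set (borel 'rV[R[i]]_q) -> \bar R :=
  fun A => (\esum_(j in [set j : {ffun 'I_q -> I} |
                          injective j /\ forall r, J (j r)])
             \d_((\row_r om (j r)) : borel 'rV[R[i]]_q) A)%E.

Definition mu_tilde (q N : nat) d (Om : measurableType d)
    (P : probability Om R) (M : Om -> 'M[R[i]]_N) :
    set (borel 'rV[R[i]]_q) -> \bar R :=
  fun A => (\int[P]_w distinct_tuples_measure [set: 'I_N]
              (fun i => nth 0%R (eigenvalues (M w)) i) A)%E.

(* The variables [a k] and [T k p] are only constrained for k, p >= 1.
   The last argument of [poisson_prob] is ignored by its definition. *)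
Definition limit_variables (theta : R) (L : probability (borel R[i]) R)
    d (Om : measurableType d) (P : probability Om R)
    (a : nat -> Om -> nat) (T : nat -> nat -> Om -> borel R[i]) :=
  [/\ forall k, (0 < k)%N -> has_law P (a k) (poisson_prob (theta / k%:R) 0),
      forall k p, (0 < k)%N -> (0 < p)%N -> has_product_law L k P (T k p) &
      mutually_independent P
        [set i : nat + nat * nat | match i with
                                   | inl k => (0 < k)%N
                                   | inr (k, p) => (0 < k)%N && (0 < p)%N
                                   end]
        (fun i => match i with
                  | inl k => sigma_of (a k)
                  | inr (k, p) => sigma_of (T k p)
                  end)].

(* A point of mu_infinity is listed as a triple (k, p, omega) with
   1 <= p <= a_k and omega ^ k = T_{k,p}. *)
Definition mu_tilde_infty (q : nat) d (Om : measurableType d)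
    (P : probability Om R) (a : nat -> Om -> nat)
    (T : nat -> nat -> Om -> R[i]) : set (borel 'rV[R[i]]_q) -> \bar R :=
  fun A => (\int[P]_w distinct_tuples_measure
              [set i : nat * nat * R[i] |
                [/\ (0 < i.1.1)%N, (0 < i.1.2 <= a i.1.1 w)%N &
                    (i.2 ^+ i.1.1)%R = T i.1.1 i.1.2 w]]
              (fun i => i.2) A)%E.

Definition outside_annulus (q : nat) (R1 R2 : R) : set 'rV[R[i]]_q :=
  [set v | forall r, ~ (R1 < Normc.normc (v 0 r) < R2)].

End permutation_matrices.

(* Main.v *)
Require Import Defs.
From HB Require Import structures.
From mathcomp Require Import all_boot all_order all_algebra all_fingroup.
From mathcomp Require Import complex ring lra zify.

Set Implicit Arguments.
Unset Strict Implicit.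
Unset Printing Implicit Defensive.

Import Order.TTheory GRing.Theory Num.Theory.

Local Open Scope ring_scope.

(** For nonzero weights, the eigenvalues of a weighted permutation matrix are, for
    each cycle of length [k], the [k] roots of order [k] of the product of the
    weights along the cycle ([eigenvalues_perm_matrix], by a discrete Fourier
    transform along each cycle). Both convergences are read on this description.

    For the normalized measures, a uniform index lies on a long cycle with
    probability close to 1: under the Ewens law the expected number of indices on
    cycles shorter than [A] stays bounded by [2 * theta * A]
    ([short_cycles_mean]). On a long cycle the law of large numbers ([weak_law])
    puts the common modulus of the points near [rho], and their arguments are
    regularly spaced, so that averages over the cycle are Riemann sums
    ([roots_mean]). The points on such cycles are therefore equidistributed on the
    circle, and so are the tuples of them, one coordinate at a time
    ([equidistributed_tuples]). Tuples with a coordinate on a bad cycle, or with a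
    repeated index, are negligible after division by [N ^_ q]
    ([normalized_convergence]).

    Off the annulus, no normalization is made and the two measures are compared
    term by term. The pattern of a tuple of points records which of its points lie
    on the same cycle, the lengths of the cycles and the numbers of the roots.
    Given its pattern, a tuple has the same law in the model and in the limit,
    since products of weights over disjoint cycles are independent; so both
    expected measures are mixtures of the same laws over the countable set of
    patterns, with different masses. In the limit the mass of a pattern whose
    cycles have lengths [k_1, ..., k_m] is the product of the [theta / k_i], by the
    factorial moments of Poisson variables ([mu_tilde_infty_mixture]). In the model
    it is the same product times a ratio that depends on the sum of the lengths
    only and tends to 1 ([ewens_tuples], [mu_tilde_mixture], [mass_ratio_cvg]).

    It remains to exchange the limit and the sum. A cycle of length [k] has its
    points off the annulus only if the mean of [k] log-moduli deviates from its
    expectation, which the class U^(q+1) bounds by [C / k ^ (q + 1)]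
    ([root_outside_annulus]). There are at most [k ^ q] choices of root numbers on
    such a cycle, so after summing over them each cycle contributes at most a
    multiple of [1 / k ^ 2], which is summable ([base_product_summable]). The
    ratio is at most 2 on the patterns of total length at most [N / 2], where
    dominated convergence applies. The other patterns contain a cycle longer than
    [N / (2 * q)], which leaves a sum of order [1 / N]
    ([long_base_product_sum]), while the ratio is [o(N)]: it is bounded through
    the total Ewens mass, and the divergence of the harmonic series bounds that
    mass from below ([mass_bound_cvg]). *)

(** * Cycle counts of Ewens permutations *)

Section orbits.
Variable T : finType.
Implicit Types (s r t : {perm T}) (C X : {set T}).

Definition cycles_in (X : {set T}) (s : {perm T}) : {set {set T}} := porbit s @: X.

Lemma porbit_restrict (C : {set T}) s s' : {in C, s =1 s'} -> {in C, forall x, s x \in C} ->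
  {in C, porbit s =1 porbit s'}.
Proof.
move=> ss' sC x xC; apply/setP => y.
have h i : (s ^+ i)%g x = (s' ^+ i)%g x /\ (s ^+ i)%g x \in C.
  elim: i => [|i [IH1 IH2]]; first by rewrite !perm1.
  by rewrite !expgSr !permM -IH1 -ss' // sC.
by apply/porbitP/porbitP => -[i ->]; exists i; have [-> _] := h i.
Qed.

Lemma porbit_stable s x C : porbit s x = C -> {in C, forall y, s y \in C}.
Proof.
move=> <- y; rewrite -!eq_porbit_mem => /eqP <-.
by have := porbit_perm s 1 y; rewrite expg1 => ->.
Qed.

Lemma stable_imset s C : {in C, forall y, s y \in C} -> s @: C = C.
Proof.
move=> h; apply/eqP; rewrite eqEcard card_imset ?leqnn ?andbT; last exact: perm_inj.
by apply/subsetP => _ /imsetP[y yC ->]; exact: h.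
Qed.

Lemma stable_restr s C : {in C, forall y, s y \in C} -> s \in 'N(C | 'P)%g.
Proof.
move=> h; apply/astabsP => x; apply/idP/idP; last exact: h.
change ('P%act x s) with (s x).
by rewrite -{1}(stable_imset h) mem_imset //; exact: perm_inj.
Qed.

Section split.
Variables (C X : {set T}).
Hypothesis CX : C \subset X.

Lemma split_permE r t : perm_on C r -> perm_on (X :\: C) t ->
  {in C, (r * t)%g =1 r} /\ {in X :\: C, (r * t)%g =1 t}.
Proof.
move=> rC tX; split=> x xC; rewrite permM.
  by rewrite (out_perm tX) // inE perm_closed // xC.
by rewrite (out_perm rC) //; move: xC; rewrite inE => /andP[].
Qed.

Lemma split_perm_on r t : perm_on C r -> perm_on (X :\: C) t -> perm_on X (r * t)%g.
Proof.
move=> rC tX; apply: perm_onM; apply/subsetP => x.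
  by move/(subsetP rC); exact: (subsetP CX).
by move/(subsetP tX); rewrite inE => /andP[].
Qed.

Lemma cycles_in_split r t : perm_on C r -> perm_on (X :\: C) t ->
  cycles_in X (r * t)%g = cycles_in C r :|: cycles_in (X :\: C) t.
Proof.
move=> rC tX; have [h1 h2] := split_permE rC tX.
rewrite /cycles_in -{1}(setID X C) imsetU (setIidPr CX); congr (_ :|: _).
  by apply: eq_in_imset; apply: porbit_restrict => // x xC; rewrite h1// perm_closed.
apply: eq_in_imset; apply: porbit_restrict => // x xC; rewrite h2//.
by rewrite perm_closed.
Qed.

Lemma notin_cycles_in t : perm_on (X :\: C) t -> C \notin cycles_in (X :\: C) t.
Proof.
move=> tX; apply/imsetP => -[x xX Cx].
by move: xX; rewrite inE Cx porbit_id.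
Qed.

(** A permutation of [X] one of whose cycles is [C] is a cyclic permutation of
    [C] times a permutation of the complement. *)
Lemma sum_split_perm (V : Type) (idx : V) (op : Monoid.com_law idx)
    (F : {perm T} -> V) :
  \big[op/idx]_(s | perm_on X s && (C \in cycles_in X s)) F s =
  \big[op/idx]_(r | perm_on C r && (C \in cycles_in C r))
    \big[op/idx]_(t | perm_on (X :\: C) t) F (r * t)%g.
Proof.
rewrite pair_big /=.
(* The inverse of [(r, t) |-> r * t] is the pair of restrictions. *)
rewrite (reindex_onto (fun p : {perm T} * {perm T} => (p.1 * p.2)%g)
  (fun s => (restr_perm C s, restr_perm (X :\: C) s))) /=.
  apply: eq_bigl => -[r t] /=.
  have [rC|rC] /= := boolP (perm_on C r); last first.
    by apply/negP => /andP[_ /eqP[er _]]; move: rC; rewrite -er restr_perm_on.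
  have [tX|tX] := boolP (perm_on (X :\: C) t); last first.
    rewrite andbF; apply/negP => /andP[_ /eqP[_ et]].
    by move: tX; rewrite -et restr_perm_on.
  have [h1 h2] := split_permE rC tX.
  have s1 : {in C, forall y, (r * t)%g y \in C} by move=> y yC; rewrite h1// perm_closed.
  have s2 : {in X :\: C, forall y, (r * t)%g y \in X :\: C}.
    by move=> y yC; rewrite h2// perm_closed.
  rewrite split_perm_on // cycles_in_split // inE (negbTE (notin_cycles_in tX)) orbF /= andbT.
  have -> : restr_perm C (r * t)%g = r.
    apply/permP => x; case: (boolP (x \in C)) => xC.
      by rewrite restr_permE ?h1 ?stable_restr.
    by rewrite (out_perm (restr_perm_on _ _)) ?(out_perm rC).
  have -> : restr_perm (X :\: C) (r * t)%g = t.
    apply/permP => x; case: (boolP (x \in X :\: C)) => xC.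
      by rewrite restr_permE ?h2 ?stable_restr.
    by rewrite (out_perm (restr_perm_on _ _)) ?(out_perm tX).
  by rewrite eqxx andbT.
move=> s /andP[sX /imsetP[x xX Cx]].
have sC := porbit_stable (esym Cx).
have sXC : {in X :\: C, forall y, s y \in X :\: C}.
  move=> y; rewrite !inE (perm_closed _ sX) => /andP[yC ->]; rewrite andbT.
  apply: contra yC; rewrite -{1}(stable_imset sC) mem_imset //; exact: perm_inj.
apply/permP => y; rewrite permM.
have [yC|yC] := boolP (y \in C).
  have -> : restr_perm C s y = s y by rewrite restr_permE ?stable_restr.
  by rewrite (out_perm (restr_perm_on (X :\: C) s)) // inE sC.
rewrite (out_perm (restr_perm_on C _)) //.
have [yX|yX] := boolP (y \in X); last first.
  rewrite (out_perm (restr_perm_on _ _)) ?inE ?(negbTE yX) ?andbF //.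
  by rewrite (out_perm sX).
by rewrite restr_permE ?stable_restr // inE yC.
Qed.

End split.

(** The number of cyclic permutations of [C]. *)
Definition full_cycles (C : {set T}) : nat :=
  #|[set r | perm_on C r && (C \in cycles_in C r)]|.

Lemma cycles_in_full C r : C \in cycles_in C r -> cycles_in C r = [set C].
Proof.
move=> /imsetP[x xC Cx]; apply/setP => D; rewrite inE; apply/imsetP/eqP.
  by move=> [y yC ->]; rewrite [RHS]Cx; apply/eqP; rewrite eq_porbit_mem -Cx.
by move=> ->; exists x.
Qed.

(** The set [C] is obtained by adding to [x] any [#|C|.-1] of the other points. *)
Lemma sum_subsets_containing (V : nmodType) (F : nat -> V) X x : x \in X ->
  \sum_(C : {set T} | (x \in C) && (C \subset X)) F #|C| =
  \sum_(k < #|X|) F k.+1 *+ 'C(#|X|.-1, k).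
Proof.
move=> xX; have cX : #|X :\ x| = #|X|.-1 by rewrite [#|X|](cardsD1 x) xX.
rewrite (reindex_onto (fun D : {set T} => x |: D) (fun C => C :\ x)) /=; last first.
  by move=> C /andP[xC _]; exact: setD1K.
have -> : \sum_(D : {set T} | (x \in x |: D) && (x |: D \subset X) && ((x |: D) :\ x == D)) F #|x |: D| =
    \sum_(D : {set T} | D \subset X :\ x) F #|D|.+1.
  apply: eq_big => [D|D /andP[_ /eqP DD]]; last first.
    rewrite cardsU1 (_ : x \in D = false) //; apply/negP => xD.
    by move: xD; rewrite -DD !inE eqxx.
  rewrite setU11 /= subUset sub1set xX /= subsetD1; case: (D \subset X) => //=.
  have [xD|xD] := boolP (x \in D); last by rewrite setU1K ?eqxx.
  by apply/negbTE/eqP => DD; move: xD; rewrite -DD !inE eqxx.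
have cardlt (D : {set T}) : D \subset X :\ x -> (#|D| < #|X|)%N.
  by move=> DX; rewrite [#|X|](cardsD1 x) xX ltnS subset_leq_card.
rewrite (partition_big (fun D : {set T} => inord #|D| : 'I_#|X|.-1.+1) predT) //=.
have X0 : #|X|.-1.+1 = #|X| by rewrite [#|X|](cardsD1 x) xX.
rewrite -[in RHS]X0; apply: eq_bigr => k _.
rewrite (eq_bigr (fun=> F k.+1)); last first.
  move=> D /andP[DX /eqP <-]; rewrite inordK // X0; exact: cardlt.
rewrite sumr_const; congr (_ *+ _).
rewrite [X0 in 'C(X0, _)](_ : _ = #|X :\ x|) // -cards_draws; apply: eq_card => D; rewrite !inE /in_mem /=.
case: (boolP (D \subset X :\ x)) => //= DX.
by rewrite -val_eqE /= inordK // X0 cardlt.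
Qed.

(** Sorting all permutations of [C] by the cycle of a fixed point gives
    [n! = sum_k 'C(n - 1, k - 1) * f(k) * (n - k)!] for the number [f(k)] of
    cyclic permutations of [k] points. The values [(k - 1)!] solve the same
    recursion, and the term of index [n] is determined by the others. *)
Lemma full_cyclesE C : C != set0 -> full_cycles C = (#|C|.-1)`!.
Proof.
have [n] := ubnP #|C|; elim: n C => // n IH C.
rewrite ltnS => Cn /set0Pn[x xC].
have C0 : (0 < #|C|)%N by apply/card_gt0P; exists x.
have tot : (#|C|`! = \sum_(D : {set T} | (x \in D) && (D \subset C))
    full_cycles D * (#|C| - #|D|)`!)%N.
  rewrite -(card_perm C) -[LHS]sum1_card.
  rewrite (partition_big (fun s => porbit s x) (fun D => (x \in D) && (D \subset C))) /=; last first.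
    move=> s sC; rewrite porbit_id /=; apply/subsetP => y /porbitP[i ->].
    by elim: i => [|i IHi]; rewrite ?perm1 // expgSr permM perm_closed.
  apply: eq_bigr => D /andP[xD DC].
  rewrite -(cardsDS DC) -card_perm /full_cycles -!sum1_card big_distrl /=.
  under [RHS]eq_bigr do rewrite mul1n.
  rewrite (eq_bigl (fun s => perm_on C s && (D \in cycles_in C s))).
    rewrite sum_split_perm //; apply: eq_bigl => r; by rewrite inE.
  move=> s; rewrite /in_mem /=; case: (perm_on C s) => //=.
  apply/eqP/imsetP => [<-|[y yC Dy]]; first by exists x.
  by apply/eqP; rewrite Dy eq_porbit_mem -Dy.
have X1 : (#|C|`! = \sum_(D : {set T} | (x \in D) && (D \subset C))
    (#|D|.-1)`! * (#|C| - #|D|)`!)%N.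
  have := @sum_subsets_containing nat (fun k => (k.-1)`! * (#|C| - k)`!)%N C x xC.
  move=> /= ->; rewrite (eq_bigr (fun=> (#|C|.-1)`!)); last first.
    move=> k _; have -> : (#|C| - k.+1 = #|C|.-1 - k)%N by rewrite -subn1 -subnDA add1n.
    rewrite -mulr_natl; change (_%:R * _) with ('C(#|C|.-1, k)%:R * (k`! * (#|C|.-1 - k)`!))%N; rewrite natn; apply: bin_fact.
    by rewrite -ltnS prednK.
  by rewrite sum_nat_const card_ord -{1 2}(prednK C0) factS.
move: tot; rewrite {1}X1 (bigD1 C) ?xC ?subxx //= [in RHS](bigD1 C) ?xC ?subxx //=.
rewrite subnn muln1 muln1 (eq_bigr (fun D : {set T} => full_cycles D * (#|C| - #|D|)`!)%N).
  by move/addIn.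
move=> D /andP[/andP[xD DC] neD]; rewrite IH //; last by apply/set0Pn; exists x.
by apply: leq_trans Cn; apply: proper_card; rewrite properEneq neD.
Qed.

End orbits.

Section tuples_count.
Variables (U : finType) (len : U -> nat).

(** Ordered selections of distinct members of [O] with prescribed lengths; for
    the cycles of a permutation these are the joint factorial moments of the
    cycle counts, as [tuples_count_ffact] shows. *)
Fixpoint tuples_count (O : {set U}) (ks : seq nat) : nat :=
  if ks is k :: ks' then \sum_(C in O | len C == k) tuples_count (O :\ C) ks' else 1.

Lemma tuples_count_ffact (O : {set U}) (ks : seq nat) (m : nat) :
  all (fun k => k < m)%N ks ->
  tuples_count O ks =
  (\prod_(k < m) #|[set C in O | len C == k]| ^_ (count_mem (k : nat) ks))%N.
Proof.
elim: ks O => [|k ks IH] O /=; first by rewrite big1.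
move=> /andP[km ksm]; pose k0 := Ordinal km.
pose rest := (\prod_(i < m | i != k0) #|[set C in O | len C == i]| ^_ (count_mem (i : nat) ks))%N.
rewrite (bigD1 k0) //= eqxx add1n.
rewrite (eq_bigr (fun i : 'I_m => #|[set C in O | len C == i]| ^_ (count_mem (i : nat) ks))%N); last first.
  by move=> i /negbTE; rewrite -val_eqE /= eq_sym => ->.
rewrite -/rest ffactnS -mulnA -[X in (X * (X.-1 ^_ _ * _))%N]sum1_card big_distrl /=.
under [RHS]eq_bigl do rewrite inE.
apply: eq_bigr => C /andP[CO Ck]; rewrite mul1n IH // (bigD1 k0) //=; congr (_ * _)%N.
  congr (_ ^_ _); rewrite sum1_card (cardsD1 C [set C0 in O | len C0 == k]) inE CO Ck /=.
  by apply: eq_card => D; rewrite !inE andbA.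
apply: eq_bigr => i ik; congr (_ ^_ _); apply: eq_card => D; rewrite !inE.
case: eqVneq => [->|] //=; rewrite CO (eqP Ck) /=; apply/esym/negbTE.
by move: ik; rewrite -val_eqE eq_sym.
Qed.

(** The functions are supported on [bs], so as to be lists of values without
    leaving the type of functions; [u0] is the value off the support. *)
Lemma supported_count (I : finType) (k : I -> nat) (u0 : U) (O : {set U}) (bs : seq I) :
  uniq bs ->
  #|[set c : {ffun I -> U} | [&& all (fun b => (c b \in O) && (len (c b) == k b)) bs,
       uniq (map c bs) & [forall r, (r \notin bs) ==> (c r == u0)]]]| =
  tuples_count O (map k bs).
Proof.
elim: bs O => [|b bs IH] O /=.
  move=> _; rewrite (_ : [set c | _] = [set [ffun=> u0]]) ?cards1 //.
  apply/setP => c; rewrite !inE; apply/forallP/eqP => [h|-> r].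
    by apply/ffunP => r; rewrite ffunE; apply/eqP; have := h r.
  by rewrite ffunE eqxx.
move=> /andP[bbs ubs].
rewrite -sum1_card (partition_big (fun c : {ffun I -> U} => c b)
  (fun C => (C \in O) && (len C == k b))) /=; last first.
  by move=> c; rewrite inE => /andP[/andP[]].
apply: eq_bigr => C /andP[CO Ck]; rewrite -IH // -sum1_card.
rewrite (reindex_onto (fun c : {ffun I -> U} => [ffun r => if r == b then C else c r])
  (fun c => [ffun r => if r == b then u0 else c r])) /=; last first.
  move=> c /andP[_ /eqP cb]; apply/ffunP => r; rewrite !ffunE.
  by case: eqVneq => // ->.
apply: eq_bigl => c; rewrite !inE.
have nb r : r \in bs -> (r == b) = false by move=> rb; apply/negbTE; apply: contraNneq bbs => <-.
have eall (O' : {set U}) : all (fun b1 => ([ffun r => if r == b then C else c r] b1 \in O') &&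
    (len ([ffun r => if r == b then C else c r] b1) == k b1)) bs =
    all (fun b1 => (c b1 \in O') && (len (c b1) == k b1)) bs.
  by apply: eq_in_all => r rb; rewrite ffunE nb.
have emap : [seq [ffun r => if r == b then C else c r] i | i <- bs] = map c bs.
  by apply/eq_in_map => r rb; rewrite ffunE nb.
rewrite eall emap ffunE eqxx CO Ck eqxx /= andbT.
have -> : all (fun b1 => (c b1 \in O :\ C) && (len (c b1) == k b1)) bs =
    all (fun b1 => (c b1 \in O) && (len (c b1) == k b1)) bs && (C \notin map c bs).
  elim: bs {IH bbs ubs nb eall emap} => //= r bs ->.
  rewrite !inE negb_or eq_sym; case: (C != c r) => //=; last by rewrite andbF.
  by rewrite andbA.
rewrite -!andbA; do 3 (congr (_ && _)).
apply/andP/forallP => [[/forallP h1 /eqP /ffunP h2] r|h].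
  apply/implyP => rbs; case: (eqVneq r b) => [->|rb].
    by rewrite -(h2 b) !ffunE eqxx.
  by have := h1 r; rewrite inE negb_or rb rbs ffunE (negbTE rb).
split.
  apply/forallP => r; rewrite inE negb_or; apply/implyP => /andP[rb rbs].
  by rewrite ffunE (negbTE rb); have := h r; rewrite rbs.
apply/eqP/ffunP => r; rewrite !ffunE; case: eqVneq => // ->.
by have := h b; rewrite bbs => /eqP ->.
Qed.

(** Functions with prescribed coincidences amount to lists of distinct values
    at the representatives of the coincidence classes. *)
Lemma pattern_count (I : finType) (f : I -> I) (k : I -> nat) (u0 : U) (O : {set U}) :
  (forall r, f (f r) = f r) -> (forall r, k (f r) = k r) ->
  #|[set c : {ffun I -> U} | [forall r, (c r \in O) && (len (c r) == k r)] &&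
       [forall r, forall r', (c r == c r') == (f r == f r')]]| =
  tuples_count O [seq k b | b <- enum I & f b == b].
Proof.
move=> ff kf; set bs := [seq b <- enum I | f b == b].
have mbs b : (b \in bs) = (f b == b) by rewrite mem_filter mem_enum andbT.
have ubs : uniq bs by rewrite filter_uniq ?enum_uniq.
rewrite -(@supported_count I k u0 O bs) //.
rewrite -!sum1_card.
rewrite (reindex_onto (fun c : {ffun I -> U} => [ffun r => c (f r)])
  (fun c => [ffun r => if r \in bs then c r else u0])) /=; last first.
  move=> c; rewrite inE => /andP[_ /forallP h]; apply/ffunP => r.
  rewrite !ffunE mbs ff eqxx; apply/eqP.
  by have /forallP /(_ r) /eqP -> := h (f r); rewrite ff.
apply: eq_bigl => c; rewrite !inE.
apply/andP/and3P => [[/andP[/forallP h1 /forallP h2] /eqP /ffunP h3]|[/allP h1 h2 /forallP h3]].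
  have cb b : b \in bs -> c b = [ffun r => c (f r)] b.
    by rewrite mbs ffunE => /eqP ->.
  split.
  - by apply/allP => b bb; rewrite cb // h1.
  - rewrite map_inj_in_uniq // => b b' bb bb'.
    rewrite (cb b) // (cb b') // => e; have /forallP /(_ b') := h2 b.
    by move: bb bb'; rewrite e eqxx !mbs => /eqP -> /eqP -> /eqP /esym /eqP.
  - apply/forallP => r; apply/implyP => rb.
    by rewrite -h3 ffunE (negbTE rb).
have fb r : f r \in bs by rewrite mbs ff.
split; first (apply/andP; split).
- by apply/forallP => r; rewrite ffunE -(kf r) h1.
- apply/forallP => r; apply/forallP => r'; rewrite !ffunE; apply/eqP.
  apply/eqP/eqP => [e|->//].
  have ii : {in bs &, injective c}.
    move=> x y xb yb cxy; apply/eqP; case: (eqVneq x y) => // xy; move: h2.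
    rewrite (perm_uniq (perm_map c (perm_to_rem xb))) /= => /andP[/negP nx _]; case: nx.
    by rewrite cxy; apply: map_f; rewrite mem_rem_uniq // !inE eq_sym xy yb.
  exact: ii.
- apply/eqP/ffunP => r; rewrite !ffunE; case: ifP => rb.
    by move: rb; rewrite mbs => /eqP ->.
  by apply/esym/eqP; have := h3 r; rewrite rb.
Qed.

End tuples_count.

Section ewens_weights.
Variables (R : numFieldType) (theta : R).

(** The total Ewens weight of the permutations of [n] points, over [n!]. *)
Definition ewens_mass n : R := \prod_(i < n) ((theta + i%:R) / i.+1%:R).

Lemma ewens_massS n : n.+1%:R * ewens_mass n.+1 = (theta + n%:R) * ewens_mass n.
Proof.
by rewrite /ewens_mass big_ord_recr /= mulrC -mulrA mulfVK ?pnatr_eq0 // mulrC.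
Qed.

Lemma ewens_mass_sum n : n%:R * ewens_mass n = theta * \sum_(j < n) ewens_mass j.
Proof.
elim: n => [|n IH]; first by rewrite big_ord0 mul0r mulr0.
by rewrite ewens_massS mulrDl IH big_ord_recr /= mulrDr addrC.
Qed.

Variable T : finType.
Implicit Types (s r t : {perm T}) (C X : {set T}) (O : {set {set T}}).

Definition weighted_sum X (g : {set {set T}} -> R) : R :=
  \sum_(s | perm_on X s) theta ^+ #|cycles_in X s| * g (cycles_in X s).

(** Removing a cycle costs a factor [theta] and its [(#|C|.-1)!] cyclic orders,
    and leaves an arbitrary permutation of the other points. *)
Lemma weighted_sum_split X C g : C != set0 -> C \subset X ->
  \sum_(s | perm_on X s && (C \in cycles_in X s))
     theta ^+ #|cycles_in X s| * g (cycles_in X s :\ C) =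
  (#|C|.-1)`!%:R * theta * weighted_sum (X :\: C) g.
Proof.
move=> C0 CX; rewrite sum_split_perm //.
rewrite (eq_bigr (fun=> theta * weighted_sum (X :\: C) g)); last first.
  move=> r /andP[rC Cr]; rewrite /weighted_sum mulr_sumr; apply: eq_bigr => t tX.
  rewrite (cycles_in_split CX rC tX) (cycles_in_full Cr) setU1K ?notin_cycles_in //.
  by rewrite cardsU1 notin_cycles_in // exprS mulrA.
rewrite sumr_const -[LHS]mulr_natl mulrA -full_cyclesE //; congr (_%:R * _ * _).
by apply: eq_card => r; rewrite !inE.
Qed.

(** Split off the cycle of a fixed point; the resulting recursion is
    [ewens_mass_sum]. *)
Lemma weighted_sum1 X : weighted_sum X (fun=> 1) = #|X|`!%:R * ewens_mass #|X|.
Proof.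
have [n] := ubnP #|X|; elim: n X => // n IH X; rewrite ltnS => Xn.
have [->|/set0Pn[x xX]] := eqVneq X set0.
  rewrite cards0 /ewens_mass big_ord0 mulr1 /weighted_sum (eq_bigl (pred1 1%g)).
    by rewrite big_pred1_eq /cycles_in imset0 cards0 expr0 mulr1.
  move=> s /=; apply/idP/eqP => [s0|->]; last exact: perm_on1.
  by apply: (perm_on_id s0); rewrite cards0.
have X0 : (0 < #|X|)%N by apply/card_gt0P; exists x.
rewrite /weighted_sum (partition_big (fun s => porbit s x)
   (fun C => (x \in C) && (C \subset X))) /=; last first.
  move=> s sX; rewrite porbit_id /=; apply/subsetP => y /porbitP[i ->].
  by elim: i => [|i IHi]; rewrite ?perm1 // expgSr permM perm_closed.
pose F k := (k.-1)`!%:R * theta * ((#|X| - k)`!%:R * ewens_mass (#|X| - k)) : R.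
rewrite (eq_bigr (fun C : {set T} => F #|C|)).
  rewrite sum_subsets_containing // (eq_bigr (fun k : 'I_#|X| =>
     (#|X|.-1)`!%:R * theta * ewens_mass (#|X|.-1 - k))); last first.
    move=> k _; rewrite /F /=.
    have -> : (#|X| - k.+1 = #|X|.-1 - k)%N by rewrite -subn1 -subnDA add1n.
    have /bin_fact <- : (k <= #|X|.-1)%N by rewrite -ltnS prednK.
    rewrite -mulr_natl !natrM; ring.
  rewrite -mulr_sumr (reindex_inj rev_ord_inj) /=.
  rewrite (eq_bigr (fun k : 'I_#|X| => ewens_mass k)); last first.
    move=> k _; congr ewens_mass; have := ltn_ord k; lia.
  have -> : (#|X|`! = #|X| * (#|X|.-1)`!)%N by rewrite -{1}(prednK X0) factS prednK.
  by rewrite -mulrA -ewens_mass_sum mulrA natrM [in RHS]mulrC -!mulrA; ring.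
move=> C /andP[xC CX].
have C0 : C != set0 by apply/set0Pn; exists x.
rewrite /F -(cardsDS CX) -IH; last first.
  apply: leq_trans Xn; rewrite cardsDS //.
  have : (0 < #|C|)%N by apply/card_gt0P; exists x.
  move: X0; lia.
rewrite -weighted_sum_split //; apply: eq_bigl => s; case: (perm_on X s) => //=.
apply/eqP/imsetP => [<-|[y yX Cy]]; first by exists x.
by apply/eqP; rewrite Cy eq_porbit_mem -Cy.
Qed.


(** The correction of the finite model: by [ewens_tuples], the expected number
    of lists of distinct cycles with lengths [ks] is this ratio, at
    [K = sumn ks], times [Poisson_moment ks]. *)
Definition mass_ratio n K : R :=
  if (K <= n)%N then ewens_mass (n - K) / ewens_mass n else 0.

(** The factorial moment of independent Poisson variables of means [theta / k]. *)
Definition Poisson_moment (ks : seq nat) : R := \prod_(k <- ks) (theta / k%:R).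

(** Split off the cycles of the list one after the other; no cycle is left to
    choose when their lengths exceed the number of points. *)
Lemma weighted_sum_tuples X (ks : seq nat) : all (fun k => 0 < k)%N ks ->
  weighted_sum X (fun O => (tuples_count (fun C : {set T} => #|C|) O ks)%:R) =
  if (sumn ks <= #|X|)%N then
    #|X|`!%:R * Poisson_moment ks * ewens_mass (#|X| - sumn ks) else 0.
Proof.
elim: ks X => [|k ks IH] X /=.
  by rewrite weighted_sum1 subn0 /Poisson_moment big_nil mulr1.
move=> /andP[k0 ks0].
transitivity (\sum_(C : {set T} | (C \subset X) && (#|C| == k))
  (k.-1)`!%:R * theta * weighted_sum (X :\: C)
     (fun O => (tuples_count (fun C : {set T} => #|C|) O ks)%:R)).
  rewrite [LHS]/weighted_sum.
  rewrite (eq_bigr (fun s => \sum_(C : {set T} | (C \subset X) && (#|C| == k))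
     if C \in cycles_in X s then theta ^+ #|cycles_in X s| *
       (tuples_count (fun C : {set T} => #|C|) (cycles_in X s :\ C) ks)%:R else 0)).
    rewrite exchange_big /=; apply: eq_bigr => C /andP[CX /eqP Ck].
    rewrite -big_mkcondr /= -Ck -(@weighted_sum_split X C (fun O => (tuples_count (fun C : {set T} => #|C|) O ks)%:R)) //.
    by apply/set0Pn; apply/card_gt0P; rewrite Ck.
  move=> s sX; rewrite natr_sum mulr_sumr -big_mkcondr /=.
  apply: eq_bigl => C; rewrite andbC -andbA andbCA; case: (boolP (C \in _)) => //.
    move=> /imsetP[x xX ->]; rewrite !andbT; apply/esym/andb_idr => _.
    apply/subsetP => y /porbitP[i ->].
    by elim: i => [|i IHi]; rewrite ?perm1 // expgSr permM perm_closed.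
  by rewrite !andbF.
rewrite (eq_bigr (fun=> (k.-1)`!%:R * theta * (if (sumn ks <= #|X| - k)%N then
    (#|X| - k)`!%:R * Poisson_moment ks * ewens_mass (#|X| - k - sumn ks) else 0))); last first.
  by move=> C /andP[CX /eqP Ck]; rewrite IH // cardsDS // Ck.
(* There are ['C(#|X|, k)] supports of size [k], whatever the rest. *)
rewrite sumr_const -[X in _ *+ X]cardsE cards_draws.
have [kX|Xk] := leqP k #|X|; last first.
  rewrite bin_small // mulr0n ifF //; apply/negbTE; rewrite -ltnNge.
  exact: (leq_trans Xk (leq_addr _ _)).
rewrite leq_subRL //; case: ifP => h; last by rewrite mulr0 mul0rn.
rewrite -(bin_fact kX) subnDA /Poisson_moment big_cons -[LHS]mulr_natl !natrM.
rewrite -[in RHS](prednK k0) factS natrM prednK //.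
have : k%:R != 0 :> R by rewrite pnatr_eq0 -lt0n.
by move=> kn0; field.
Qed.

End ewens_weights.

(** * Eigenvalues of weighted permutation matrices *)

Section cycle_positions.
Variables (T : finType) (s : {perm T}).
Implicit Types i j : T.

(** A reference point on the cycle of [i], depending on that cycle only. *)
Definition cycle_base i := odflt i [pick j in porbit s i].

Definition cycle_pos i := index i (traject s (cycle_base i) #|porbit s i|).

Lemma cycle_base_in i : cycle_base i \in porbit s i.
Proof. by rewrite /cycle_base; case: pickP => //= /(_ i); rewrite porbit_id. Qed.

Lemma porbit_cycle_base i : porbit s (cycle_base i) = porbit s i.
Proof. by apply/eqP; rewrite eq_porbit_mem cycle_base_in. Qed.

Lemma eq_cycle_base i j : porbit s i = porbit s j -> cycle_base i = cycle_base j.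
Proof.
move=> e; rewrite /cycle_base e; case: pickP => //= /(_ j).
by rewrite porbit_id.
Qed.

Lemma mem_cycle_traject i : i \in traject s (cycle_base i) #|porbit s i|.
Proof.
have : i \in traject s (cycle_base i) #|porbit s (cycle_base i)|.
  by rewrite -porbit_traject porbit_cycle_base porbit_id.
by rewrite porbit_cycle_base.
Qed.

Lemma cycle_pos_lt i : (cycle_pos i < #|porbit s i|)%N.
Proof.
by rewrite -[X in (_ < X)%N](size_traject s (cycle_base i)) index_mem mem_cycle_traject.
Qed.

Lemma cycle_posK i : iter (cycle_pos i) s (cycle_base i) = i.
Proof. by rewrite -(nth_traject _ (cycle_pos_lt i)) nth_index ?mem_cycle_traject. Qed.

Lemma cycle_pos_inj i j : porbit s i = porbit s j -> cycle_pos i = cycle_pos j -> i = j.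
Proof. by move=> e p; rewrite -(cycle_posK i) -(cycle_posK j) p (eq_cycle_base e). Qed.

Lemma cycle_pos_iter i p : (p < #|porbit s i|)%N ->
  cycle_pos (iter p s (cycle_base i)) = p.
Proof.
move=> pk; set j := iter p s _.
have e : porbit s j = porbit s i.
  by rewrite /j -permX porbit_perm porbit_cycle_base.
rewrite /cycle_pos (eq_cycle_base e) e /j -(nth_traject s pk (cycle_base i)).
rewrite index_uniq ?size_traject //.
by rewrite -(porbit_cycle_base i) uniq_traject_porbit.
Qed.

(** Positions number the points of a cycle bijectively. *)
Lemma big_cycle_pos (R : Type) (idx : R) (op : Monoid.com_law idx) i (F : nat -> R) :
  \big[op/idx]_(j in porbit s i) F (cycle_pos j) =
  \big[op/idx]_(p < #|porbit s i|) F p.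
Proof.
rewrite (reindex_onto (fun p : 'I_#|porbit s i| => iter p s (cycle_base i))
   (fun j => insubd (Ordinal (cycle_pos_lt i)) (cycle_pos j))) /=.
  apply: eq_big => [p|p _]; last by rewrite cycle_pos_iter.
  rewrite cycle_pos_iter // -permX -eq_porbit_mem porbit_perm porbit_cycle_base eqxx /=.
  by apply/eqP/val_inj; rewrite val_insubd ltn_ord.
move=> j; rewrite -eq_porbit_mem => /eqP e.
have lt_j : (cycle_pos j < #|porbit s i|)%N by rewrite -e cycle_pos_lt.
by rewrite val_insubd lt_j -(eq_cycle_base e) cycle_posK.
Qed.

Lemma cycle_pos_next i :
  cycle_pos (s i) = if (cycle_pos i).+1 == #|porbit s i| then 0%N else (cycle_pos i).+1.
Proof.
rewrite -{1}(cycle_posK i) -iterS; case: eqVneq => [e|ne].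
  rewrite e -[in X in iter X](porbit_cycle_base i) iter_porbit.
  have := @cycle_pos_iter i 0; rewrite /=; apply.
  by rewrite -e.
by rewrite cycle_pos_iter // ltn_neqAle ne cycle_pos_lt.
Qed.

Lemma porbit_next i : porbit s (s i) = porbit s i.
Proof. by have := porbit_perm s 1 i; rewrite expg1. Qed.

End cycle_positions.

Section weighted_permutation.
Variables (F : numFieldType) (N : nat) (s : 'S_N) (z om : 'I_N -> F).
Hypothesis z0 : forall j, z j != 0.
Hypothesis om_root : forall i, om i ^+ #|porbit s i| = \prod_(j in porbit s i) z j.
Hypothesis om_inj : forall i j, porbit s i = porbit s j -> om i = om j -> i = j.

Let M : 'M[F]_N := \matrix_(j, k) (z j *+ (j == s k)).
Let K i := #|porbit s i|.

(* Product of the weights from the base point of the cycle, excluded, to [j]. *)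
Let g p b := \prod_(t < p) z (iter t.+1 s b).
Let gj j := g (cycle_pos s j) (cycle_base s j).

Let V := \matrix_(j, i) (if porbit s j == porbit s i then gj j / om i ^+ cycle_pos s j else 0).
Let W := \matrix_(i, j) (if porbit s j == porbit s i then
   (K i)%:R^-1 * (om i ^+ cycle_pos s j / gj j) else 0).

Let K0 i : (0 < K i)%N.
Proof. by rewrite lt0n card_porbit_neq0. Qed.

Let om0 i : om i != 0.
Proof.
have : om i ^+ K i != 0.
  by rewrite om_root prodf_seq_neq0; apply/allP => j _; rewrite z0 implybT.
by rewrite expf_eq0 K0.
Qed.

Let g0 p b : g p b != 0.
Proof. by rewrite prodf_seq_neq0; apply/allP => j _; rewrite z0. Qed.

Let gK i : g (K i) (cycle_base s i) = \prod_(j in porbit s i) z j.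
Proof.
rewrite (reindex_inj (@perm_inj _ s)) /=.
rewrite (eq_bigl (fun j => j \in porbit s i)); last first.
  by move=> j; rewrite -!eq_porbit_mem porbit_next.
rewrite [RHS](eq_bigr (fun j => (fun p => z (iter p.+1 s (cycle_base s i))) (cycle_pos s j))).
  by rewrite (big_cycle_pos s _ i (fun p => z (iter p.+1 s (cycle_base s i)))).
move=> j; rewrite -eq_porbit_mem => /eqP e /=.
by rewrite -(eq_cycle_base e) cycle_posK.
Qed.

Let WV : W *m V = 1%:M.
Proof.
apply/matrixP => i i'; rewrite !mxE.
under eq_bigr do rewrite !mxE.
have [ii'|ii'] := eqVneq (porbit s i) (porbit s i'); last first.
  rewrite big1 => [|j _].
    by case: eqVneq => // e; move: ii'; rewrite e eqxx.
  by case: eqVneq => [->|_]; rewrite ?mul0r // (negbTE ii') mulr0.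
have -> : \sum_j (if porbit s j == porbit s i then (K i)%:R^-1 * (om i ^+ cycle_pos s j / gj j) else 0) *
    (if porbit s j == porbit s i' then gj j / om i' ^+ cycle_pos s j else 0) =
  (K i)%:R^-1 * \sum_(p < K i) (om i / om i') ^+ p.
  rewrite -big_cycle_pos mulr_sumr [RHS]big_mkcond /=; apply: eq_bigr => j _.
  rewrite -eq_porbit_mem -ii'; case: eqVneq => // _; last by rewrite mul0r.
  rewrite -mulrA; congr (_ * _); rewrite expr_div_n.
  by field; rewrite g0 expf_neq0.
have Kn0 : (K i)%:R != 0 :> F by rewrite pnatr_eq0 -lt0n K0.
case: eqVneq => [<-|ne].
  rewrite divff // (eq_bigr (fun=> 1)) => [|p _]; last by rewrite expr1n.
  by rewrite sumr_const card_ord mulVf.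
have u1 : om i / om i' - 1 != 0.
  rewrite subr_eq0; apply: contra ne => /eqP h; apply/eqP; apply: om_inj => //.
  by apply: (mulIf (invr_neq0 (om0 i'))); rewrite h divff.
have h : (om i / om i' - 1) * (\sum_(p < K i) (om i / om i') ^+ p) = 0.
  rewrite -subrX1 expr_div_n om_root /K ii' om_root divff ?subrr //.
  by rewrite -om_root expf_neq0.
by move/eqP: h; rewrite mulf_eq0 (negbTE u1) /= => /eqP ->; rewrite mulr0.
Qed.

Let MV : M *m V = V *m diag_mx (\row_i om i).
Proof.
apply/matrixP => j0 i; rewrite mul_mx_diag !mxE.
under eq_bigr do rewrite !mxE.
rewrite -(permKV s j0); set k := (s^-1)%g j0.
rewrite (bigD1 k) //= eqxx mulr1n big1 ?addr0; last first.
  by move=> l lk; rewrite (inj_eq perm_inj) eq_sym (negbTE lk) mulr0n mul0r.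
rewrite porbit_next; case: eqVneq => [e|_]; last by rewrite mulr0 mul0r.
have eb : cycle_base s (s k) = cycle_base s k by apply: eq_cycle_base; exact: porbit_next.
have gS : g (cycle_pos s k).+1 (cycle_base s k) = gj k * z (s k).
  by rewrite /g big_ord_recr /= cycle_posK.
rewrite {2}/gj eb cycle_pos_next; case: eqVneq => [h|h].
  rewrite /g big_ord0 expr0 divr1 mul1r mulrA (mulrC (z _)) -gS h.
  rewrite [g _ _]gK e -om_root -e -h exprS; field.
  by rewrite expf_neq0.
rewrite gS exprS; field; by rewrite om0 expf_neq0.
Qed.

(** The matrix is diagonalised by the discrete Fourier transform along each
    cycle, after rescaling the coordinates by partial products of the weights. *)
Lemma char_poly_weighted_perm : char_poly M = \prod_i ('X - (om i)%:P).
Proof.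
have VW : V *m W = 1%:M by apply: mulmx1C; exact: WV.
have -> : M = V *m diag_mx (\row_i om i) *m W by rewrite -MV -mulmxA VW mulmx1.
rewrite /char_poly /char_poly_mx !map_mxM /=.
pose Vp := map_mx (@polyC F) V; pose Wp := map_mx (@polyC F) W.
have VWp : Vp *m Wp = 1%:M by rewrite -map_mxM VW map_mx1.
rewrite -/Vp -/Wp.
have -> : 'X%:M = Vp *m 'X%:M *m Wp :> 'M[{poly F}]_N.
  by rewrite mul_mx_scalar -scalemxAl VWp scalemx1.
rewrite -mulmxBl -mulmxBr !det_mulmx mulrAC -det_mulmx VWp det1 mul1r.
have := @char_poly_trig F N (diag_mx (\row_i om i)).
rewrite /char_poly => ->; last first.
  by apply/is_trig_mxP => a b ab; rewrite !mxE; case: eqVneq ab => [->|]; rewrite ?ltnn.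
by apply: eq_bigr => i _; rewrite !mxE eqxx mulr1n.
Qed.

End weighted_permutation.

Section ewens_expectations.
Variables (R : realFieldType) (theta : R).
Hypothesis theta0 : 0 < theta.

Lemma ewens_mass_gt0 n : 0 < ewens_mass theta n.
Proof.
apply: prodr_gt0 => i _; apply: divr_gt0; last by rewrite ltr0n.
by rewrite ltr_pwDl.
Qed.

Lemma ewens_expectation N (g : {set {set 'I_N}} -> R) :
  \sum_(t : 'S_N) theta ^+ #|porbits t| / (\sum_(u : 'S_N) theta ^+ #|porbits u|) * g (porbits t) =
  weighted_sum theta [set: 'I_N] g / (N`!%:R * ewens_mass theta N).
Proof.
have E h : weighted_sum theta [set: 'I_N] h =
    \sum_(t : 'S_N) theta ^+ #|porbits t| * h (porbits t).
  apply: eq_big => [s|s _]; first by apply/subsetP => i; rewrite inE.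
  by rewrite (_ : cycles_in _ s = porbits s)//; apply/setP => C; apply/imsetP/imsetP => -[i _ ->]; exists i; rewrite ?inE.
have -> : \sum_(u : 'S_N) theta ^+ #|porbits u| = N`!%:R * ewens_mass theta N.
  have := weighted_sum1 theta [set: 'I_N]; rewrite E cardsT card_ord => <-.
  by apply: eq_bigr => s _; rewrite mulr1.
by rewrite E mulr_suml; apply: eq_bigr => t _; rewrite mulrAC.
Qed.

Lemma ewens_tuples N (ks : seq nat) : all (fun k => 0 < k)%N ks ->
  \sum_(t : 'S_N) theta ^+ #|porbits t| / (\sum_(u : 'S_N) theta ^+ #|porbits u|) *
     (tuples_count (fun C : {set 'I_N} => #|C|) (porbits t) ks)%:R =
  Poisson_moment theta ks * mass_ratio theta N (sumn ks).
Proof.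
move=> ks0.
rewrite (ewens_expectation (fun O => (tuples_count (fun C : {set 'I_N} => #|C|) O ks)%:R)).
rewrite weighted_sum_tuples// /mass_ratio cardsT card_ord.
case: ifP => _; last by rewrite mul0r mulr0.
have := ewens_mass_gt0 N; have : N`!%:R != 0 :> R by rewrite pnatr_eq0 -lt0n fact_gt0.
by move=> h1 h2; field; rewrite h1 gt_eqF.
Qed.

Lemma mass_ratio_ge0 N K : 0 <= mass_ratio theta N K.
Proof. by rewrite /mass_ratio; case: ifP => // _; rewrite divr_ge0// ltW// ewens_mass_gt0. Qed.

(** The masses are the increments of [n * ewens_mass n / theta], and nonnegative. *)
Lemma mass_ratio_le N K : (K <= N)%N -> (N - K)%:R * mass_ratio theta N K <= N%:R.
Proof.
move=> KN; rewrite /mass_ratio KN mulrA ler_pdivrMr ?ewens_mass_gt0//.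
rewrite !ewens_mass_sum ler_pM2l//.
rewrite -!(big_mkord xpredT (ewens_mass theta)) (big_cat_nat (leq0n _) (leq_subr K N)) /=.
by rewrite lerDl; apply: sumr_ge0 => i _; rewrite ltW// ewens_mass_gt0.
Qed.

Lemma mass_ratio_half N K : (K.*2 <= N)%N -> mass_ratio theta N K <= 2.
Proof.
case: N => [|N] KN.
  have -> : K = 0%N by lia.
  by rewrite /mass_ratio /= subn0 divff ?ler1n// gt_eqF// ewens_mass_gt0.
have h : (0 : R) < (N.+1 - K)%:R by rewrite ltr0n; lia.
have := @mass_ratio_le N.+1 K; rewrite -ler_pdivlMl// => /(_ _)/le_trans; apply; first by lia.
rewrite ler_pdivrMl// -natrM ler_nat; lia.
Qed.

(** The masses are monotone, from the value 1: the numerator is at most the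
    denominator if [theta >= 1], and at most 1 otherwise. *)
Lemma mass_ratio_le_mass N K : mass_ratio theta N K <= 1 + (ewens_mass theta N)^-1.
Proof.
rewrite /mass_ratio; case: leqP => KN; last first.
  by rewrite addr_ge0// invr_ge0 ltW// ewens_mass_gt0.
have S n : ewens_mass theta n.+1 = ewens_mass theta n * ((theta + n%:R) / n.+1%:R).
  by rewrite /ewens_mass big_ord_recr.
have m0 := ewens_mass_gt0.
rewrite ler_pdivrMr// mulrDl mul1r mulVf ?gt_eqF//.
have [t1|t1] := leP 1 theta.
  suff h n p : ewens_mass theta n <= ewens_mass theta (n + p).
    by rewrite -{2}(subnK KN); apply: (le_trans (h _ K)); rewrite lerDl.
  elim: p => [|p IH]; first by rewrite addn0.
  rewrite addnS S; apply: (le_trans IH); rewrite ler_peMr ?(ltW (m0 _))//.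
  by rewrite ler_pdivlMr ?ltr0n// mul1r -natr1; lra.
have h n : ewens_mass theta n <= 1.
  elim: n => [|n IH]; first by rewrite /ewens_mass big_ord0.
  rewrite S mulr_ile1 ?(ltW (m0 _))//.
    by rewrite divr_ge0// addr_ge0// ltW.
  by rewrite ler_pdivrMr ?ltr0n// mul1r -natr1; lra.
by apply: (le_trans (h _)); rewrite lerDr ltW.
Qed.

Lemma ewens_mass_lower n : theta / n.+1%:R <= ewens_mass theta n.+1.
Proof.
rewrite ler_pdivrMr ?ltr0n// mulrC ewens_mass_sum big_ord_recl.
rewrite {1}/ewens_mass big_ord0 mulrDr mulr1 lerDl mulr_ge0 ?(ltW theta0)//.
by apply: sumr_ge0 => i _; rewrite ltW// ewens_mass_gt0.
Qed.

(** Sum [ewens_mass_lower] in [ewens_mass_sum]. The logarithmic growth is what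
    makes [(ewens_mass N)^-1] negligible with respect to [N]. *)
Lemma ewens_mass_harmonic n :
  theta ^+ 2 * (\sum_(i < n) (i.+1%:R)^-1) <= n.+1%:R * ewens_mass theta n.+1.
Proof.
rewrite ewens_mass_sum big_ord_recl mulrDr expr2 -mulrA; apply: ler_wpDl.
  by rewrite mulr_ge0 ?(ltW theta0)// ltW// ewens_mass_gt0.
rewrite ler_pM2l// mulr_sumr; apply: ler_sum => i _; exact: ewens_mass_lower.
Qed.

End ewens_expectations.

(** A cycle of length [k] carries [k] points. *)
Lemma short_cycles_card (T : finType) (s : {perm T}) (A : nat) :
  #|[pred i | #|porbit s i| < A]|%N =
  (\sum_(k < A) k * tuples_count (fun C : {set T} => #|C|) (porbits s) [:: k : nat])%N.
Proof.
rewrite -sum1_card.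
rewrite (partition_big (porbit s) (fun C => (C \in porbits s) && (#|C| < A)%N)) /=; last first.
  by move=> i; rewrite inE => -> ; rewrite andbT; apply/imsetP; exists i.
under [RHS]eq_bigr do rewrite big_distrr /= muln1.
rewrite (exchange_big_dep (fun C => (C \in porbits s) && (#|C| < A)%N)) /=; last first.
  by move=> k C _ /andP[-> /eqP ->]; rewrite ltn_ord.
apply: eq_bigr => C /andP[CO CA].
rewrite (big_pred1 (Ordinal CA)) /=; last first.
  by move=> k; rewrite CO /=; apply/eqP/eqP => [e|->//]; apply: val_inj.
rewrite sum1_card; case/imsetP: CO CA => i0 _ -> CA.
apply: eq_card => i; rewrite -eq_porbit_mem [LHS]unfold_in; apply: andb_idl => /eqP e.
by rewrite inE e.
Qed.

(** * Coincidence patterns of tuples of cycles *)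

Section kernels.
Variable q : nat.

(** The canonical idempotent map with the same fibres as [c]. *)
Definition kernel (U : eqType) (c : 'I_q -> U) : {ffun 'I_q -> 'I_q} :=
  [ffun r => odflt r [pick r' | c r' == c r]].

Variables (U : eqType) (c : 'I_q -> U).

Lemma kernelP r : c (kernel c r) = c r.
Proof.
by rewrite ffunE; case: pickP => [r' /eqP|] //= /(_ r); rewrite eqxx.
Qed.

Lemma kernel_eq r r' : (kernel c r == kernel c r') = (c r == c r').
Proof.
apply/eqP/eqP => [e|e]; first by rewrite -(kernelP r) e kernelP.
rewrite !ffunE; under eq_pick do rewrite e.
by case: pickP => // /(_ r'); rewrite eqxx.
Qed.

Lemma kernel_idem r : kernel c (kernel c r) = kernel c r.
Proof. by apply/eqP; rewrite kernel_eq kernelP. Qed.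

End kernels.

Lemma eq_kernel q (U V : eqType) (c : 'I_q -> U) (c' : 'I_q -> V) :
  (forall r r', (c r == c r') = (c' r == c' r')) -> kernel c = kernel c'.
Proof.
by move=> e; apply/ffunP => r; rewrite !ffunE; under eq_pick do rewrite e.
Qed.

Lemma kernelK q (U : eqType) (c : 'I_q -> U) : kernel (kernel c) = kernel c.
Proof. by apply: eq_kernel => r r'; rewrite kernel_eq. Qed.

Section patterns.
Variable q : nat.

(** The pattern of a tuple of points on cycles: which points share a cycle, given
    by a representative for each, the lengths of the cycles, and the numbers of
    the points on them. The lengths are set to 0 off the representatives, so that
    a tuple has one pattern only. *)
Definition pattern : Type :=
  ({ffun 'I_q -> 'I_q} * {ffun 'I_q -> nat} * {ffun 'I_q -> nat})%type.

HB.instance Definition _ := Countable.on pattern.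

Implicit Types y : pattern.

Definition pat_ker y := y.1.1.
Definition pat_len y r := y.1.2 (y.1.1 r).
Definition pat_pos y := y.2.

(** The second condition is the convention on lengths; the last one says that
    the points are distinct. *)
Definition valid_pattern y :=
  [&& kernel (pat_ker y) == pat_ker y,
      [forall r, (0 < y.1.2 r)%N == (pat_ker y r == r)],
      [forall r, pat_pos y r < pat_len y r]%N &
      [forall r, forall r', (pat_ker y r == pat_ker y r') && (pat_pos y r == pat_pos y r')
         ==> (r == r')]].

(** One entry for each cycle, not for each point. *)
Definition pat_lengths y := [seq pat_len y b | b <- enum 'I_q & pat_ker y b == b].

Definition pattern_of (U : eqType) (len : U -> nat) (c : 'I_q -> U) (pos : 'I_q -> nat) : pattern :=
  (kernel c, [ffun r => if kernel c r == r then len (c r) else 0%N], [ffun r => pos r]).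

Section pattern_of.
Variables (U : eqType) (len : U -> nat) (c : 'I_q -> U) (pos : 'I_q -> nat).

Lemma pattern_of_len r : pat_len (pattern_of len c pos) r = len (c r).
Proof. by rewrite /pat_len /= ffunE kernel_idem eqxx kernelP. Qed.

Lemma valid_pattern_of : (forall r, 0 < len (c r))%N -> (forall r, pos r < len (c r))%N ->
  valid_pattern (pattern_of len c pos) =
  [forall r, forall r', (c r == c r') && (pos r == pos r') ==> (r == r')].
Proof.
move=> len0 pos_lt; rewrite /valid_pattern /= /pat_ker /= kernelK eqxx /=.
have -> : [forall r, pat_pos (pattern_of len c pos) r < pat_len (pattern_of len c pos) r]%N.
  by apply/forallP => r; rewrite pattern_of_len ffunE.
have -> : [forall r, (0 < [ffun r => if kernel c r == r then len (c r) else 0] r)%N ==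
    (kernel c r == r)].
  by apply/forallP => r; rewrite ffunE; case: ifP; rewrite ?len0.
rewrite /=; apply: eq_forallb => r; apply: eq_forallb => r'.
by rewrite kernel_eq !ffunE.
Qed.

Lemma pattern_ofP y : valid_pattern y ->
  pattern_of len c pos = y <->
  [/\ forall r r', (c r == c r') = (pat_ker y r == pat_ker y r'),
      forall r, len (c r) = pat_len y r & forall r, pos r = pat_pos y r].
Proof.
case: y => [[pi k] l] /and4P[/eqP /= piK /forallP kpi _ _]; split.
  move=> e; split => [r r'|r|r].
  - by rewrite -e /pat_ker /= kernel_eq.
  - by rewrite -e pattern_of_len.
  - by case: e => _ _ <-; rewrite ffunE.
rewrite /pat_ker /pat_len /pat_pos /= => -[cpi lenk posl].
have e : kernel c = pi by rewrite -[RHS]piK; exact: eq_kernel.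
congr (_, _, _); first exact: e.
  apply/ffunP => r; rewrite ffunE e; have := kpi r; rewrite /pat_ker /=.
  case: (pi r =P r) => [pr _|_ /eqP]; first by rewrite lenk pr.
  by case: (k r).
by apply/ffunP => r; rewrite ffunE.
Qed.

End pattern_of.

Section valid.
Variables (y : pattern) (vy : valid_pattern y).

Lemma pat_ker_idem r : pat_ker y (pat_ker y r) = pat_ker y r.
Proof. by case/and4P: vy => /eqP <- _ _ _; exact: kernel_idem. Qed.

Lemma pat_len_ker r : pat_len y (pat_ker y r) = pat_len y r.
Proof. by rewrite /pat_len -/(pat_ker y) pat_ker_idem. Qed.

Lemma pat_pos_lt r : (pat_pos y r < pat_len y r)%N.
Proof. by case/and4P: vy => _ _ /forallP/(_ r). Qed.

Lemma pat_len_gt0 r : (0 < pat_len y r)%N.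
Proof. exact: leq_ltn_trans (pat_pos_lt r). Qed.

Lemma pat_inj r r' : pat_ker y r = pat_ker y r' -> pat_pos y r = pat_pos y r' -> r = r'.
Proof.
case/and4P: vy => _ _ _ /forallP/(_ r)/forallP/(_ r')/implyP h e1 e2.
by apply/eqP/h; rewrite e1 e2 !eqxx.
Qed.

End valid.

Lemma pat_lengths_gt0 y : valid_pattern y -> all (fun k => 0 < k)%N (pat_lengths y).
Proof. by move=> vy; apply/allP => _ /mapP[r _ ->]; exact: pat_len_gt0. Qed.

End patterns.

Section permutation_patterns.
Variables (T : finType) (t : {perm T}) (q : nat).

Definition perm_pattern (j : {ffun 'I_q -> T}) : pattern q :=
  pattern_of (fun C : {set T} => #|C|) (fun r => porbit t (j r)) (fun r => cycle_pos t (j r)).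

Lemma perm_pattern_valid j : valid_pattern (perm_pattern j) = injectiveb j.
Proof.
rewrite valid_pattern_of; first last.
- by move=> r; exact: cycle_pos_lt.
- by move=> r; apply: leq_ltn_trans (cycle_pos_lt t (j r)).
apply/idP/injectiveP => [/forallP h r r' e|ji].
  by have /forallP/(_ r')/implyP := h r; rewrite e !eqxx => /(_ isT)/eqP.
apply/forallP => r; apply/forallP => r'; apply/implyP => /andP[/eqP e1 /eqP e2].
by apply/eqP/ji; exact: cycle_pos_inj e1 e2.
Qed.

(** A tuple of points with pattern [y] is a tuple of cycles with the prescribed
    coincidences and lengths, since the positions on the cycles are given. *)
Lemma perm_pattern_count y : valid_pattern y ->
  #|[set j | perm_pattern j == y]| =
  tuples_count (fun C : {set T} => #|C|) (porbits t) (pat_lengths y).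
Proof.
move=> vy.
rewrite -(pattern_count _ set0 _ (pat_ker_idem vy) (pat_len_ker vy)).
pose f (j : {ffun 'I_q -> T}) : {ffun 'I_q -> {set T}} := [ffun r => porbit t (j r)].
have P j := @pattern_ofP q _ (fun C : {set T} => #|C|) (fun r => porbit t (j r))
  (fun r => cycle_pos t (j r)) y vy.
rewrite -(@card_in_imset _ _ f); last first.
  move=> j j'; rewrite !inE => /eqP/P[_ _ h1] /eqP/P[_ _ h2] e.
  apply/ffunP => r; apply: (@cycle_pos_inj _ t); last by rewrite h1 h2.
  by have := congr1 (fun g : {ffun 'I_q -> {set T}} => g r) e; rewrite !ffunE.
apply: eq_card => c; rewrite [RHS]inE; apply/imsetP/andP.
  move=> [j]; rewrite inE => /eqP/P[h1 h2 _] ->; split; apply/forallP => r.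
    rewrite ffunE h2 eqxx andbT; exact: imset_f.
  by apply/forallP => r'; rewrite !ffunE h1.
move=> [/forallP h1 /forallP h2].
have /fin_all_exists[x xE] r : exists x, c r = porbit t x.
  by have /andP[/imsetP[x _ ->] _] := h1 r; exists x.
have len_c r : #|c r| = pat_len y r by have /andP[_ /eqP] := h1 r.
pose j : {ffun 'I_q -> T} := [ffun r => iter (pat_pos y r) t (cycle_base t (x r))].
have lt_pos r : (pat_pos y r < #|porbit t (x r)|)%N by rewrite -xE len_c pat_pos_lt.
have jx r : porbit t (j r) = c r.
  by rewrite ffunE xE -permX porbit_perm porbit_cycle_base.
exists j; last by apply/ffunP => r; rewrite ffunE jx.
rewrite inE; apply/eqP/P; split => [r r'|r|r].
- by rewrite !jx; have /forallP/(_ r')/eqP := h2 r.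
- by rewrite jx.
- by rewrite ffunE cycle_pos_iter.
Qed.

End permutation_patterns.

Section labels.
Variables (q : nat) (y : pattern q).
Hypothesis vy : valid_pattern y.

(** The points of the limit are indexed by a cycle length, the number [p] of a
    product with that length and a root: labels [p] realize the pattern when
    (length, label) pairs coincide as its cycles do. *)
Definition compatible (L : eqType) (p : 'I_q -> L) :=
  [forall r, forall r', ((pat_len y r, p r) == (pat_len y r', p r')) == (pat_ker y r == pat_ker y r')].

(** The pairs (length, label) play the role of the cycles of a permutation, with
    [n k] cycles of each length [k]. *)
Lemma labels_count (n : nat -> nat) (m M : nat) :
  (forall r, pat_len y r <= m)%N -> (forall r, n (pat_len y r) <= M)%N ->
  #|[set p : {ffun 'I_q -> 'I_M.+1} |
      [forall r, 0 < p r <= n (pat_len y r)]%N && compatible p]| =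
  (\prod_(k < m) n k.+1 ^_ (count_mem k.+1 (pat_lengths y)))%N.
Proof.
move=> len_m n_M.
pose U : finType := ('I_m.+1 * 'I_M.+1)%type.
pose len (C : U) : nat := C.1.
pose O := [set C : U | 0 < C.2 <= n C.1]%N.
have mlen r : (inord (pat_len y r) : 'I_m.+1) = pat_len y r :> nat by rewrite inordK// ltnS.
transitivity (tuples_count len O (pat_lengths y)).
  rewrite -(pattern_count (f := pat_ker y) len (ord0, ord0) O (pat_ker_idem vy) (pat_len_ker vy)).
  pose f (p : {ffun 'I_q -> 'I_M.+1}) : {ffun 'I_q -> U} := [ffun r => (inord (pat_len y r), p r)].
  rewrite -(@card_in_imset _ _ f); last first.
    move=> p p' _ _ e; apply/ffunP => r.
    by have := congr1 (fun g : {ffun 'I_q -> U} => (g r).2) e; rewrite !ffunE.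
  have feq (p : {ffun 'I_q -> 'I_M.+1}) r r' : (f p r == f p r') = ((pat_len y r, p r) == (pat_len y r', p r')).
    rewrite !ffunE !xpair_eqE; congr (_ && _).
    by rewrite -val_eqE /= !mlen.
  apply: eq_card => c; rewrite [RHS]inE; apply/imsetP/andP.
    move=> [p]; rewrite inE => /andP[/forallP h1 /forallP h2] ->; split; apply/forallP => r.
      by rewrite ffunE inE /len /= mlen eqxx h1.
    by apply/forallP => r'; rewrite feq; have /forallP := h2 r.
  move=> [/forallP h1 /forallP h2].
  have c1 r : (c r).1 = inord (pat_len y r).
    by have /andP[_ /eqP e] := h1 r; apply: val_inj; rewrite /= mlen.
  have cE : c = f [ffun r => (c r).2].
    by apply/ffunP => r; rewrite !ffunE -c1 -surjective_pairing.
  exists [ffun r => (c r).2] => //; rewrite inE; apply/andP; split; apply/forallP => r.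
    have /andP[] := h1 r; rewrite inE c1 mlen => h _; by rewrite ffunE.
  by apply/forallP => r'; rewrite -feq -cE; have /forallP := h2 r.
rewrite (@tuples_count_ffact _ len O (pat_lengths y) m.+1); last first.
  by apply/allP => _ /mapP[r _ ->]; rewrite ltnS.
rewrite big_ord_recl /=.
have -> : count_mem 0%N (pat_lengths y) = 0%N.
  apply/count_memPn; apply/negP => /(allP (pat_lengths_gt0 vy)); by rewrite ltnn.
rewrite ffactn0 mul1n; apply: eq_bigr => k _; rewrite /bump leq0n add1n.
have [h|h] := boolP (k.+1 \in pat_lengths y); last first.
  by move/count_memPn: h => ->; rewrite !ffactn0.
congr (_ ^_ _)%N; have nM : (n k.+1 <= M)%N by case/mapP: h => r _ ->.
have km : (k.+1 < m.+1)%N by rewrite ltnS.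
pose g (i : 'I_(n k.+1)) : U := (Ordinal km, inord i.+1).
have gi (i : 'I_(n k.+1)) : (inord i.+1 : 'I_M.+1) = i.+1 :> nat by rewrite inordK// ltnS (leq_trans _ nM).
rewrite -[RHS]card_ord -(@card_imset _ _ g); last first.
  by move=> i j [] /(congr1 val); rewrite /= !gi => -[] /val_inj.
apply: eq_card => C; rewrite !inE; apply/andP/imsetP.
  case: C => C1 C2; rewrite /len /= => -[/andP[h0 h1] /eqP e]; rewrite e in h1.
  have C2n : (C2.-1 < n k.+1)%N by rewrite prednK.
  exists (Ordinal C2n) => //; congr (_, _); apply: val_inj; first by rewrite /= -e.
  by rewrite /= (gi (Ordinal C2n)) /= prednK.
by case=> i _ ->; rewrite /= gi ltn_ord !eqxx.
Qed.

End labels.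

From mathcomp Require Import all_classical all_reals all_analysis.
From mathcomp Require Import measurable_realfun.

Import Order.TTheory GRing.Theory Num.Theory.
Import numFieldNormedType.Exports.

Local Open Scope classical_set_scope.
Local Open Scope ring_scope.

(** * Topology and Borel sets of complex vectors *)

Section complex_topology.
Context (R : realType).
Implicit Types z w : R[i].

Lemma nbhs_rect z (A : set R[i]) : nbhs z A <->
  exists2 e : R, 0 < e & forall w, `|complex.Re z - complex.Re w| < e ->
    `|complex.Im z - complex.Im w| < e -> A w.
Proof.
split.
  move=> /nbhs_ballP[e /= e0 eA].
  have [er er0 e0r] : exists2 er : R, 0 < er & e = (er%:C)%C.
    by case: e e0 {eA} => a b /=; rewrite ltcE /= => /andP[/eqP-> a0]; exists a.
  exists (er / 2) => [|w hr hi]; first by rewrite divr_gt0.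
  apply: eA; rewrite -ball_normE /= e0r.
  case: z w hr hi => [a b] [c d] /= hr hi.
  have -> : `|(a +i* b)%C - (c +i* d)%C| = ((Num.sqrt ((a - c) ^+ 2 + (b - d) ^+ 2))%:C)%C by [].
  rewrite ltcR -(ltr_pXn2r (ltn0Sn 1)) ?nnegrE ?sqrtr_ge0// ?(ltW er0)//.
  rewrite sqr_sqrtr ?addr_ge0 ?sqr_ge0//.
  have sq (u : R) : `|u| < er / 2 -> u ^+ 2 < (er / 2) ^+ 2.
    by rewrite -(real_normK (num_real u)) => h; rewrite ltr_pXn2r ?nnegrE ?divr_ge0// ltW.
  have := sq _ hr; have := sq _ hi; nra.
move=> [e e0 eA]; apply/nbhs_ballP; exists (e%:C)%C; first by rewrite /= ltcR.
move=> w; rewrite -ball_normE /=; case: z eA => a b eA; case: w => c d.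
have -> : `|(a +i* b)%C - (c +i* d)%C| = ((Num.sqrt ((a - c) ^+ 2 + (b - d) ^+ 2))%:C)%C by [].
rewrite ltcR => h; apply: eA => /=; apply: le_lt_trans h;
  rewrite -sqrtr_sqr ler_wsqrtr// ?lerDl ?lerDr sqr_ge0//.
Qed.

Lemma Re_continuous : continuous (@complex.Re R : R[i] -> R).
Proof.
move=> z A /nbhs_ballP[e /= e0 eA]; apply/nbhs_rect; exists e => // w h _.
by apply: eA; rewrite -ball_normE.
Qed.

Lemma Im_continuous : continuous (@complex.Im R : R[i] -> R).
Proof.
move=> z A /nbhs_ballP[e /= e0 eA]; apply/nbhs_rect; exists e => // w _ h.
by apply: eA; rewrite -ball_normE.
Qed.

Lemma Complex_cvg (T : topologicalType) (f g : T -> R) (x : T) :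
  {for x, continuous f} -> {for x, continuous g} ->
  {for x, continuous (fun t => (f t +i* g t)%C : R[i])}.
Proof.
move=> fc gc A /nbhs_rect[e e0 eA].
have /fc h1 : nbhs (f x) (ball (f x) e) by exact: nbhsx_ballx.
have /gc h2 : nbhs (g x) (ball (g x) e) by exact: nbhsx_ballx.
move: h1 h2; rewrite -!ball_normE /= => h1 h2.
near=> t; apply: eA => /=; near: t; [exact: h1|exact: h2].
Unshelve. all: by end_near. Qed.

End complex_topology.

Definition countable_base (T : topologicalType) (I : countType) (B : I -> set T) :=
  (forall i, open (B i)) /\
  forall x A, nbhs x A -> exists i, B i x /\ B i `<=` A.

Section bases.
Context (R : realType).

Definition rational_rectangle (p : rat * rat * rat * rat) : set R[i] :=
  [set z | (ratr p.1.1.1 < complex.Re z < ratr p.1.1.2) /\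
           (ratr p.1.2 < complex.Im z < ratr p.2)].

Lemma rational_bracket (x e : R) : 0 < e ->
  exists p q : rat, ratr p < x < ratr q /\
    forall y, ratr p < y < ratr q -> `|x - y| < e.
Proof.
move=> e0; have [|p] := @rat_in_itvoo R (x - e) x; first by lra.
have [|q] := @rat_in_itvoo R x (x + e); first by lra.
rewrite !in_itv /= => /andP[q1 q2] /andP[p1 p2]; exists p, q; split; first lra.
by move=> y /andP[h1 h2]; rewrite ltr_norml; lra.
Qed.

Lemma rational_rectangle_base : countable_base rational_rectangle.
Proof.
split=> [[[[a b] c] d]|z A /nbhs_rect[e e0 eA]].
  rewrite [rational_rectangle _](_ : _ =
    (@complex.Re R @^-1` `]ratr a, ratr b[) `&` (@complex.Im R @^-1` `]ratr c, ratr d[)).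
    apply: openI; apply: open_comp; try exact: interval_open.
    - by move=> ? _; exact: Re_continuous.
    - by move=> ? _; exact: Im_continuous.
  by apply/seteqP; split=> z /=; rewrite !in_itv.
have [a [b [h1 h2]]] := rational_bracket (complex.Re z) e0.
have [c [d [h3 h4]]] := rational_bracket (complex.Im z) e0.
by exists (a, b, c, d); split => // w [/= /h2 hr /h4 hi]; exact: eA.
Qed.

Lemma matrix_base (T : topologicalType) (I : countType) (B : I -> set T) m n :
  countable_base B ->
  countable_base (fun p : {ffun 'I_m * 'I_n -> I} =>
    [set M : 'M[T]_(m, n) | forall i j, B (p (i, j)) (M i j)]).
Proof.
move=> [oB bB]; split=> [p|M A [P MP PA]].
  rewrite openE => M /= MB; exists (fun i j => B (p (i, j))) => // i j.
  exact: open_nbhs_nbhs.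
have h i j : {k | B k (M i j) /\ B k `<=` P i j} by apply/cid/bB/MP.
exists [ffun ij => projT1 (h ij.1 ij.2)]; split=> [i j|N hN].
  by rewrite ffunE; case: (h _ _) => k [].
apply: PA => i j; have := hN i j; rewrite ffunE /=.
by case: (h i j) => k /= [_]; exact.
Qed.

Lemma open_base_bigcup (T : topologicalType) (I : countType) (B : I -> set T) U :
  countable_base B -> open U -> U = \bigcup_(i in [set i | B i `<=` U]) B i.
Proof.
move=> [oB bB] oU; apply/seteqP; split=> x.
  by move=> Ux; have [i [Bx BU]] := bB x U (open_nbhs_nbhs (conj oU Ux)); exists i.
by move=> [i /= BU /BU].
Qed.

End bases.

Section borel.
Context (R : realType).

Lemma open_measurable_borel (T : ptopologicalType) (U : set (borel T)) :
  open (U : set T) -> measurable U.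
Proof. exact: sub_sigma_algebra. Qed.

Lemma borel_continuous_measurable (T U : ptopologicalType) (f : T -> U) :
  continuous f -> measurable_fun setT (f : borel T -> borel U).
Proof.
move=> cf; apply: (measurability (@open U : set (set (borel U)))) => //.
move=> _ [B oB <-]; rewrite setTI; apply: open_measurable_borel.
by apply: open_comp => // x _; exact: cf.
Qed.

Lemma continuous_borel_measurable (T : ptopologicalType) (f : T -> R) :
  continuous f -> measurable_fun setT (f : borel T -> R).
Proof.
move=> cf; apply: (measurability _ (RGenOpens.measurableE R)).
move=> _ [_ [a [b ->]] <-]; rewrite setTI; apply: open_measurable_borel.
by apply: open_comp => [x _|]; [exact: cf|exact: interval_open].
Qed.

(** Open sets are countable unions of members of the base. *)
Lemma measurable_borel_base d (Om : measurableType d) (T : ptopologicalType)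
    (I : countType) (B : I -> set T) (f : Om -> borel T) :
  countable_base B -> (forall i, measurable (f @^-1` B i)) ->
  measurable_fun setT f.
Proof.
move=> bB mB; apply: (measurability (@open T : set (set (borel T)))) => //.
move=> _ [U oU <-]; rewrite setTI (open_base_bigcup bB oU) preimage_bigcup.
rewrite bigcup_mkcond; apply: countable_bigcupT_measurable => [|i].
  exact: countableP.
by case: ifPn.
Qed.

Lemma measurable_matrix d (Om : measurableType d) m n
    (f : Om -> 'M[R[i]]_(m, n)) :
  (forall i j, measurable_fun setT ((fun w => f w i j) : Om -> borel R[i])) ->
  measurable_fun setT (f : Om -> borel 'M[R[i]]_(m, n)).
Proof.
move=> mf; have bR := rational_rectangle_base R.
apply: (measurable_borel_base (matrix_base m n bR)) => p.
rewrite [X in measurable X](_ : _ = \big[setI/setT]_(ij : 'I_m * 'I_n)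
   ((fun w => f w ij.1 ij.2) @^-1` rational_rectangle (p ij))).
  apply: bigsetI_measurable => ij _; rewrite -[X in measurable X]setTI.
  apply: mf => //; apply: open_measurable_borel; exact: bR.1.
rewrite -bigcap_seq; apply/seteqP; split=> w /=.
  by move=> h [i j] _; exact: h.
by move=> h i j; apply: (h (i, j)); rewrite /= mem_index_enum.
Qed.

Lemma coord_measurable m n i j :
  measurable_fun setT
    ((fun M : 'M[R[i]]_(m, n) => M i j) : borel 'M[R[i]]_(m, n) -> borel R[i]).
Proof. by apply: borel_continuous_measurable; exact: coord_continuous. Qed.

Lemma measurable_Complex d (Om : measurableType d) (f g : Om -> R) :
  measurable_fun setT f -> measurable_fun setT g ->
  measurable_fun setT ((fun w => (f w +i* g w)%C) : Om -> borel R[i]).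
Proof.
move=> mf mg; apply: (measurable_borel_base (rational_rectangle_base R)).
move=> [[[a b] c] e]; rewrite [X in measurable X](_ : _ =
    (f @^-1` `]ratr a, ratr b[) `&` (g @^-1` `]ratr c, ratr e[)).
  by apply: measurableI; rewrite -[X in measurable X]setTI; [apply: mf|apply: mg].
by apply/seteqP; split=> z /=; rewrite !in_itv.
Qed.

Lemma Re_measurable : measurable_fun setT (@complex.Re R : borel R[i] -> R).
Proof. by apply: continuous_borel_measurable; exact: Re_continuous. Qed.

Lemma Im_measurable : measurable_fun setT (@complex.Im R : borel R[i] -> R).
Proof. by apply: continuous_borel_measurable; exact: Im_continuous. Qed.

Lemma measurable_mulC d (Om : measurableType d) (f g : Om -> R[i]) :
  measurable_fun setT (f : Om -> borel R[i]) ->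
  measurable_fun setT (g : Om -> borel R[i]) ->
  measurable_fun setT ((fun w => f w * g w) : Om -> borel R[i]).
Proof.
move=> mf mg.
have mRf := measurableT_comp Re_measurable mf.
have mRg := measurableT_comp Re_measurable mg.
have mIf := measurableT_comp Im_measurable mf.
have mIg := measurableT_comp Im_measurable mg.
rewrite [X in measurable_fun _ X](_ : _ = fun w =>
   ((complex.Re (f w) * complex.Re (g w) - complex.Im (f w) * complex.Im (g w)) +i*
   (complex.Re (f w) * complex.Im (g w) + complex.Im (f w) * complex.Re (g w)))%C).
  apply: measurable_Complex.
    by apply: measurable_funB; apply: measurable_funM.
  by apply: measurable_funD; apply: measurable_funM.
by apply/funext => w; case: (f w) (g w) => a b [c e].
Qed.

Lemma measurable_prodC d (Om : measurableType d) (I : Type) (s : seq I)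
    (p : pred I) (f : I -> Om -> R[i]) :
  (forall i, measurable_fun setT (f i : Om -> borel R[i])) ->
  measurable_fun setT ((fun w => \prod_(i <- s | p i) f i w) : Om -> borel R[i]).
Proof.
move=> mf; elim: s => [|i s IH].
  by under eq_fun do rewrite big_nil; exact: measurable_cst.
under eq_fun do rewrite big_cons; case: (p i) => //; exact: measurable_mulC.
Qed.

Lemma normc_measurable : measurable_fun setT (@Normc.normc R : borel R[i] -> R).
Proof.
rewrite [X in measurable_fun _ X](_ : _ = fun z : R[i] =>
   Num.sqrt (complex.Re z ^+ 2 + complex.Im z ^+ 2)); last by apply/funext => -[].
apply: measurableT_comp => //.
  by apply: continuous_measurable_fun; exact: sqrt_continuous.
by apply: measurable_funD; apply: measurable_funX;
  [exact: Re_measurable|exact: Im_measurable].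
Qed.

Lemma log_modulus_measurable : measurable_fun setT (@log_modulus R : borel R[i] -> R).
Proof. by apply: (measurableT_comp (@measurable_ln R)); exact: normc_measurable. Qed.

Lemma measurable_set1C (z : R[i]) : measurable ([set z] : set (borel R[i])).
Proof.
rewrite [X in measurable X](_ : _ = (@complex.Re R @^-1` [set complex.Re z]) `&`
  (@complex.Im R @^-1` [set complex.Im z])).
  apply: measurableI; rewrite -[X in measurable X]setTI.
    exact: Re_measurable.
  exact: Im_measurable.
by apply/seteqP; split=> [_ -> //|]; case: z => a b [c e] /= [-> ->].
Qed.

(** Boxes form a pi-system, and they generate the Borel sets because rational
    rectangles are a countable base. *)
Lemma box_measure_unique n (m1 m2 : {finite_measure set (borel 'rV[R[i]]_n) -> \bar R}) :
  (forall A : 'I_n -> set (borel R[i]), (forall i, measurable (A i)) ->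
     m1 [set v | forall i, A i (v 0 i)] = m2 [set v | forall i, A i (v 0 i)]) ->
  forall A, measurable A -> m1 A = m2 A.
Proof.
move=> m12.
pose box (A : 'I_n -> set (borel R[i])) : set (borel 'rV[R[i]]_n) :=
  [set v | forall i, A i (v 0 i)].
pose G := [set box A | A in [set A | forall i, measurable (A i)]].
have mbox A : (forall i, measurable (A i)) -> measurable (box A).
  move=> mA; rewrite [box A](_ : _ = \big[setI/setT]_(i < n)
     ((fun v : borel 'rV_n => (v : 'rV[R[i]]_n) 0 i) @^-1` A i)).
    apply: bigsetI_measurable => i _; rewrite -[X in measurable X]setTI.
    exact: coord_measurable.
  rewrite -bigcap_seq; apply/seteqP; split=> w /=.
    by move=> h i _; exact: h.
  by move=> h i; apply: h; rewrite /= mem_index_enum.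
apply: (measure_unique G (fun=> setT)).
- apply/seteqP; split; last first.
    apply: smallest_sub; first exact: sigma_algebra_measurable.
    by move=> _ [A mA <-]; exact: mbox.
  apply: smallest_sub; first exact: smallest_sigma_algebra.
  move=> U oU; have bR := matrix_base 1 n (rational_rectangle_base R).
  rewrite (open_base_bigcup bR oU).
  set Bf := (X in countable_base X) in bR *.
  have mB J : @measurable _ (g_sigma_algebraType G) (\bigcup_(p in J) Bf p).
    rewrite bigcup_mkcond; apply: countable_bigcupT_measurable => [|p].
      exact: countableP.
    case: ifPn => // _; apply: sub_sigma_algebra.
    exists (fun i => rational_rectangle (p (0, i))) => /=.
      by move=> i; apply: open_measurable_borel; exact: (rational_rectangle_base R).1.
    apply/seteqP; split=> v /= h; first by move=> a b; rewrite ord1.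
    by move=> i; exact: h.
  exact: mB.
- move=> _ _ [A mA <-] [A' mA' <-]; exists (fun i => A i `&` A' i).
    by move=> i; apply: measurableI.
  apply/seteqP; split=> v /=; first by move=> h; split=> i; have [] := h i.
  by move=> [h h'] i; split.
- by move=> _; exists (fun=> setT) => //; apply/seteqP; split.
- by apply/seteqP; split => // v _; exists 0%N.
- by move=> _ [A mA <-]; exact: m12.
- by move=> _; rewrite ltey_eq fin_num_measure.
Qed.

End borel.

(** * Laws and independence *)

Section finite_measures.
Context d (T : measurableType d) (R : realType).

Section pack.
Variables (mu : set T -> \bar R) (mu_fin : is_finite_measure mu).

(** A set function that satisfies the axioms of a finite measure, as an
    element of the type of finite measures. *)
Definition pack_measure := let: And4 _ _ _ _ := mu_fin in mu.

Lemma pack_measureE : pack_measure = mu.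
Proof. by rewrite /pack_measure; case: mu_fin. Qed.

Let pack0 : pack_measure set0 = 0%E.
Proof. by rewrite pack_measureE; case: mu_fin. Qed.
Let pack_ge0 A : (0 <= pack_measure A)%E.
Proof. by rewrite pack_measureE; case: mu_fin. Qed.
Let pack_sigma : semi_sigma_additive pack_measure.
Proof. by rewrite pack_measureE; case: mu_fin. Qed.
HB.instance Definition _ :=
  isMeasure.Build _ _ _ pack_measure pack0 pack_ge0 pack_sigma.
Let pack_finite : fin_num_fun pack_measure.
Proof.
apply: lty_fin_num_fun; change (pack_measure setT < +oo)%E.
by rewrite pack_measureE; case: mu_fin.
Qed.
HB.instance Definition _ := @Measure_isFinite.Build _ T _ pack_measure pack_finite.

End pack.

Lemma measure_is_finite (mu : {measure set T -> \bar R}) :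
  (mu setT < +oo)%E -> is_finite_measure mu.
Proof.
by move=> h; split => //; exact: measure_semi_sigma_additive.
Qed.

Lemma eq_is_finite_measure (m1 m2 : set T -> \bar R) :
  is_finite_measure m1 -> (forall A, (0 <= m2 A)%E) ->
  (forall A, measurable A -> m1 A = m2 A) -> is_finite_measure m2.
Proof.
move=> [h0 hge hs hfin] m2ge m12; split => //.
- by rewrite -m12.
- move=> F mF tF mUF; rewrite -m12//.
  rewrite (_ : (fun n => (\sum_(0 <= i < n) m2 (F i))%E) =
               (fun n => (\sum_(0 <= i < n) m1 (F i))%E)); first exact: hs.
  by apply/funext => n; apply: eq_bigr => i _; rewrite m12.
- by rewrite -m12.
Qed.

End finite_measures.

Section laws.
Context (R : realType).

Lemma preimageT_measurable d d' (T : measurableType d) (U : measurableType d')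
    (f : T -> U) A :
  measurable_fun setT f -> measurable A -> measurable (f @^-1` A).
Proof. by move=> mf mA; rewrite -[X in measurable X]setTI; exact: mf. Qed.

Lemma law_finite_measure d (Om : measurableType d) d' (T : measurableType d')
    (P : probability Om R) (E : set Om) (X : Om -> T) (c : R) :
  measurable E -> measurable_fun setT X -> 0 <= c ->
  is_finite_measure (fun A => c%:E * P (E `&` X @^-1` A))%E.
Proof.
move=> mE mX c0; split.
- by rewrite preimage_set0 setI0 measure0 mule0.
- by move=> A; rewrite mule_ge0.
- move=> F mF tF mUF.
  have := @measure_semi_sigma_additive _ _ _
    (mscale (NngNum c0) (mrestr P mE)) (fun n => X @^-1` F n).
  rewrite /mscale /= /mrestr -preimage_bigcup setIC.
  rewrite (_ : (fun n => (\sum_(0 <= i < n) c%:E * P (E `&` X @^-1` F i))%E) =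
    (fun n => (\sum_(0 <= i < n) c%:E * P (X @^-1` F i `&` E))%E)); last first.
    by apply/funext => n; apply: eq_bigr => i _; rewrite setIC.
  apply.
  + by move=> i; exact: preimageT_measurable.
  + by move=> i j _ _ [x [h1 h2]]; apply: tF => //; exists (X x).
  + by rewrite preimage_bigcup; apply: bigcup_measurable => i _; exact: preimageT_measurable.
- by rewrite ltey_eq fin_numM// fin_num_measure//; apply: measurableI => //; exact: preimageT_measurable.
Qed.

Lemma box_unique n (m1 m2 : set (borel 'rV[R[i]]_n) -> \bar R) :
  is_finite_measure m1 -> is_finite_measure m2 ->
  (forall A : 'I_n -> set (borel R[i]), (forall i, measurable (A i)) ->
     m1 [set v | forall i, A i (v 0 i)] = m2 [set v | forall i, A i (v 0 i)]) ->
  forall A, measurable A -> m1 A = m2 A.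
Proof.
move=> f1 f2 m12 A mA.
rewrite -(pack_measureE f1) -(pack_measureE f2).
apply: box_measure_unique => // B mB; rewrite /= !pack_measureE; exact: m12.
Qed.

(** Used with an event [E] that is independent of the vector: restricting to it
    only rescales the law. *)
Lemma law_on_boxes n d (Om : measurableType d) (P : probability Om R)
    (E : set Om) (X : 'I_n -> Om -> borel R[i])
    d' (Om' : measurableType d') (P' : probability Om' R)
    (X' : 'I_n -> Om' -> borel R[i]) (c : R) :
  measurable E -> (forall i, measurable_fun setT (X i)) ->
  (forall i, measurable_fun setT (X' i)) -> 0 <= c ->
  (forall A : 'I_n -> set (borel R[i]), (forall i, measurable (A i)) ->
     P (E `&` [set w | forall i, A i (X i w)]) =
     (c%:E * P' [set w | forall i, A i (X' i w)])%E) ->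
  forall A : set (borel 'rV[R[i]]_n), measurable A ->
  P (E `&` [set w | A (\row_i X i w)]) = (c%:E * P' [set w | A (\row_i X' i w)])%E.
Proof.
move=> mE mX mX' c0 h A mA.
have mrow d1 (Om1 : measurableType d1) (Y : 'I_n -> Om1 -> borel R[i]) :
    (forall i, measurable_fun setT (Y i)) ->
    measurable_fun setT ((fun w => \row_i Y i w) : Om1 -> borel 'rV[R[i]]_n).
  by move=> mY; apply: measurable_matrix => i j; under eq_fun do rewrite mxE; exact: mY.
have /= := @box_unique n _ _ (law_finite_measure P mE (mrow _ _ _ mX) (@ler01 R))
  (law_finite_measure P' measurableT (mrow _ _ _ mX') c0) _ A mA.
rewrite mul1e setTI; apply => B mB; rewrite mul1e setTI.
have eqB d1 (Om1 : measurableType d1) (Y : 'I_n -> Om1 -> borel R[i]) :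
   (fun w => \row_i Y i w) @^-1` [set v : 'rV[R[i]]_n | forall i, B i (v 0 i)] =
   [set w | forall i, B i (Y i w)].
  by apply/seteqP; split=> w /= hw i; have := hw i; rewrite mxE.
by rewrite !eqB; exact: h.
Qed.

Lemma row_measurable n d (Om : measurableType d) (X : 'I_n -> Om -> borel R[i]) :
  (forall i, measurable_fun setT (X i)) ->
  measurable_fun setT ((fun w => \row_i X i w) : Om -> borel 'rV[R[i]]_n).
Proof.
by move=> mX; apply: measurable_matrix => i j; under eq_fun do rewrite mxE; exact: mX.
Qed.

End laws.

Section independence.
Context (R : realType) d (Om : measurableType d) (P : probability Om R).

Lemma mutually_independent_fin (I : choiceType) (J : set I)
    (F : I -> set (set Om)) (K : finType) (f : K -> I) (A : K -> set Om) :
  mutually_independent P J F -> injective f ->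
  (forall k, J (f k) /\ F (f k) (A k)) ->
  P [set w | forall k, A k w] = (\prod_k P (A k))%E.
Proof.
move=> indep inj_f hA.
pose B i := if [pick k | f k == i] is Some k then A k else set0.
have BE k : B (f k) = A k.
  by rewrite /B; case: pickP => [k' /eqP/inj_f ->//|/(_ k)]; rewrite eqxx.
have := indep (map f (index_enum K)) B.
rewrite map_inj_uniq// index_enum_uniq => /(_ isT).
rewrite big_map (eq_bigr (fun k => P (A k))) => [<-|k _]; last by rewrite BE.
  congr (P _); apply/seteqP; split=> w /=.
    by move=> h i /= /mapP[k _ ->]; rewrite BE.
  by move=> h k; rewrite -BE; apply: h; rewrite /= map_f// mem_index_enum.
by move=> i /mapP[k _ ->]; rewrite BE.
Qed.

Lemma iid_sub (I I' : choiceType) d' (T : measurableType d') (X : I -> Om -> T)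
    (f : I' -> I) (mu : set T -> \bar R) :
  iid P X mu -> injective f -> iid P (X \o f) mu.
Proof.
move=> [lawX indep] inj_f; split=> [i|s A us hA]; first exact: lawX.
pose B i := \bigcap_(j in [set j | j \in s /\ f j = i]) A j.
have BE j : j \in s -> B (f j) = A j.
  move=> js; apply/seteqP; split=> w /=; first by move=> /(_ j); exact.
  by move=> Aw j' [js' /inj_f ->].
have := indep (map f s) B; rewrite map_inj_uniq// => /(_ us).
rewrite big_map big_seq_cond (eq_bigr (fun j => P (A j))); last first.
  by move=> j; rewrite andbT => /BE ->.
rewrite -big_seq_cond => <-; last first.
  move=> i /mapP[j js ->]; split => //; rewrite BE//; exact: (hA j js).2.
congr (P _); apply/seteqP; split=> w /=.
  by move=> h i /= /mapP[j js ->]; rewrite BE//; exact: h.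
by move=> h j js; rewrite -BE//; apply: h; rewrite /= map_f.
Qed.

Lemma iid_box (K : finType) d' (T : measurableType d') (X : K -> Om -> T)
    (mu : set T -> \bar R) (A : K -> set T) :
  iid P X mu -> (forall k, measurable (A k)) ->
  P [set w | forall k, A k (X k w)] = (\prod_k mu (A k))%E.
Proof.
move=> [lawX indep] mA.
rewrite (mutually_independent_fin (A := fun k => X k @^-1` A k) indep (@inj_id K)).
  by apply: eq_bigr => k _; exact: (lawX k).2.
by move=> k; split => //; exists (A k) => //; rewrite setTI.
Qed.

End independence.

Lemma iid_row_law (R : realType) n (L : set (borel R[i]) -> \bar R)
    d (Om : measurableType d) (P : probability Om R) (X : 'I_n -> Om -> borel R[i])
    d' (Om' : measurableType d') (P' : probability Om' R) (X' : 'I_n -> Om' -> borel R[i]) :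
  iid P X L -> iid P' X' L ->
  forall A : set (borel 'rV[R[i]]_n), measurable A ->
  P [set w | A (\row_i X i w)] = P' [set w | A (\row_i X' i w)].
Proof.
move=> iX iX' A mA.
have := @law_on_boxes _ n _ _ P setT X _ _ P' X' 1 _ _ _ _ _ A mA.
rewrite setTI mul1e; apply => //.
- by move=> i; exact: (iX.1 i).1.
- by move=> i; exact: (iX'.1 i).1.
- by move=> B mB; rewrite setTI mul1e (iid_box iX)// (iid_box iX').
Qed.

(** Only the number of factors matters. *)
Lemma iid_prod_law (R : realType) (L : set (borel R[i]) -> \bar R) (K K' : finType)
    d (Om : measurableType d) (P : probability Om R) (X : K -> Om -> borel R[i])
    d' (Om' : measurableType d') (P' : probability Om' R) (X' : K' -> Om' -> borel R[i])
    (S : {set K}) (S' : {set K'}) :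
  iid P X L -> iid P' X' L -> #|S| = #|S'| ->
  forall A : set (borel R[i]), measurable A ->
  P [set w | A (\prod_(j in S) (X j w : R[i]))] =
  P' [set w | A (\prod_(j in S') (X' j w : R[i]))].
Proof.
move=> iX iX' SS' A mA.
have := iid_row_law (iid_sub iX (@enum_val_inj _ (mem S)))
  (iid_sub iX' (inj_comp (@enum_val_inj _ (mem S')) (@cast_ord_inj _ _ SS'))).
pose pr (v : 'rV[R[i]]_#|S|) : borel R[i] := \prod_i v 0 i.
have mpr : measurable_fun setT (pr : borel 'rV[R[i]]_#|S| -> borel R[i]).
  by apply: measurable_prodC => i; exact: coord_measurable.
have e1 w : pr (\row_i (X \o enum_val) i w) = \prod_(j in S) (X j w : R[i]).
  by rewrite [RHS]big_enum_val; apply: eq_bigr => i _; rewrite mxE.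
have e2 w : pr (\row_i (X' \o (enum_val \o cast_ord SS')) i w) =
    \prod_(j in S') (X' j w : R[i]).
  rewrite [RHS]big_enum_val (reindex (cast_ord SS')) /=.
    by apply: eq_bigr => i _; rewrite mxE.
  by exists (cast_ord (esym SS')) => i _; rewrite ?cast_ordK ?cast_ordKV.
move=> /(_ _ (preimageT_measurable mpr mA)).
by congr (_ = _); [congr (P _)|congr (P' _)]; apply/seteqP; split=> w /=;
  rewrite ?e1 ?e2.
Qed.

Section blocks.
Context (R : realType) d (Om : measurableType d) (P : probability Om R).
Context (N : nat) (L : probability (borel R[i]) R) (z : 'I_N -> Om -> borel R[i]).
Hypothesis z_iid : iid P z L.
Context (E0 : set Om).
Hypothesis mE0 : measurable E0.
Hypothesis E0_indep : forall A : 'I_N -> set (borel R[i]),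
  (forall j, measurable (A j)) ->
  P (E0 `&` [set w | forall j, A j (z j w)]) = (P E0 * \prod_j L (A j))%E.

Let mz j : measurable_fun setT (z j). Proof. exact: (z_iid.1 j).1. Qed.

Definition block_product (c : {set 'I_N}) (w : Om) : R[i] := \prod_(j in c) (z j w : R[i]).

Lemma block_product_measurable c :
  measurable_fun setT (block_product c : Om -> borel R[i]).
Proof. exact: measurable_prodC. Qed.

Definition outside (s : seq {set 'I_N}) j := ~~ has (fun c : {set 'I_N} => j \in c) s.

Definition blocks_event (s : seq {set 'I_N}) (B : {set 'I_N} -> set (borel R[i]))
    (A : 'I_N -> set (borel R[i])) :=
  [set w | (forall c, c \in s -> B c (block_product c w)) /\
           (forall j, outside s j -> A j (z j w))].

Lemma blocks_event_measurable s B A : (forall c, measurable (B c)) ->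
  (forall j, measurable (A j)) -> measurable (blocks_event s B A).
Proof.
move=> mB mA.
rewrite [X in measurable X](_ : _ =
   (\bigcap_(c in [set` s]) (block_product c @^-1` B c)) `&`
   (\bigcap_(j in [set` [seq j <- enum 'I_N | outside s j]]) (z j @^-1` A j))).
  apply: measurableI; rewrite bigcap_seq; apply: bigsetI_measurable => c _.
    exact: (preimageT_measurable (block_product_measurable c) (mB c)).
  exact: (preimageT_measurable (mz c) (mA c)).
apply/seteqP; split=> w /= [h1 h2]; split=> // j.
  by rewrite /= mem_filter => /andP[/h2].
by move=> oj; apply: h2; rewrite /= mem_filter oj mem_enum.
Qed.

(** Products over disjoint blocks of coordinates are independent of each other
    and of the remaining coordinates; the blocks are split off one at a time. *)
Lemma blocks_independent (s : seq {set 'I_N}) (B : {set 'I_N} -> set (borel R[i]))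
    (A : 'I_N -> set (borel R[i])) : uniq s ->
  (forall c c' j, c \in s -> c' \in s -> j \in c -> j \in c' -> c = c') ->
  (forall c, measurable (B c)) -> (forall j, measurable (A j)) ->
  P (E0 `&` blocks_event s B A) =
  (P E0 * (\prod_(c <- s) P (block_product c @^-1` B c)) *
     \prod_(j | outside s j) L (A j))%E.
Proof.
elim: s A => [|c s IH] A.
  move=> _ _ mB mA; rewrite big_nil mule1 -E0_indep//; congr (P (_ `&` _)).
  by apply/seteqP; split=> w /=; [move=> [_ h] j; exact: h|move=> h; split].
move=> /= /andP[cs us] dis mB mA.
have dis' c1 c2 j : c1 \in s -> c2 \in s -> j \in c1 -> j \in c2 -> c1 = c2.
  by move=> s1 s2; apply: dis; rewrite inE ?s1 ?s2 orbT.
have outc j : j \in c -> outside s j.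
  move=> jc; apply/hasPn => c' sc'; apply/negP => jc'.
  by move: cs; rewrite (dis c c' j) ?inE ?eqxx ?sc' ?orbT.
have outE j : outside (c :: s) j = outside s j && (j \notin c).
  by rewrite /outside /= negb_or andbC.
(* [c] is the block that is split off: [E] is the event without the constraint
   on [c], and its constraints on the points of [c] are void. *)
pose E := E0 `&` blocks_event s B (fun j => if j \in c then setT else A j).
have mE : measurable E.
  apply: measurableI => //; apply: blocks_event_measurable => // j.
  by case: ifP.
(* The row of the variables of [c], completed by ones, has product
   [block_product c]. *)
pose X j : Om -> borel R[i] := if j \in c then z j else cst 1.
have mX j : measurable_fun setT (X j).
  by rewrite /X; case: ifP => // _; exact: measurable_cst.
have LX A1 : (forall j, measurable (A1 j)) ->
    P [set w | forall j, j \in c -> A1 j (z j w)] = (\prod_(j in c) L (A1 j))%E.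
  move=> mA1; have := iid_box z_iid (A := fun j => if j \in c then A1 j else setT).
  rewrite (bigID (mem c)) /= [X in (_ * X)%E]big1 => [|j /negbTE ->]; last first.
    exact: probability_setT.
  rewrite mule1 => h; rewrite -(eq_bigr _ (fun j jc => _ : L (if j \in c then A1 j else setT) = _)) => [|j ->]//.
  rewrite -h => [|j]; last by case: ifP.
  congr (P _); apply/seteqP; split=> w /= hw j.
    by case: ifPn => // jc; exact: hw.
  by move=> jc; have := hw j; rewrite jc.
have PE A1 : (forall j, measurable (A1 j)) ->
    P (E `&` [set w | forall j, j \in c -> A1 j (z j w)]) =
    (P E * \prod_(j in c) L (A1 j))%E.
  move=> mA1.
  have EA1 : E `&` [set w | forall j, j \in c -> A1 j (z j w)] =
      E0 `&` blocks_event s B (fun j => if j \in c then A1 j else A j).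
    apply/seteqP; split=> w /=.
      move=> [[e0 [h1 h2]] h3]; split => //; split => // j oj.
      by case: ifPn => jc; [exact: h3|have := h2 j oj; rewrite (negbTE jc)].
    move=> [e0 [h1 h2]]; split; first split => //; first split => // j oj.
      by have := h2 j oj; case: ifP.
    by move=> j jc; have := h2 j (outc j jc); rewrite jc.
  rewrite EA1 IH//; last by move=> j; case: ifP.
  rewrite /E IH//; last by move=> j; case: ifP.
  rewrite -[RHS]muleA; congr (_ * _)%E.
  rewrite (bigID (mem c)) [X in _ = (X * _)%E](bigID (mem c)) /=.
  have oc (F : 'I_N -> \bar R) : (\prod_(j | outside s j && (j \in c)) F j = \prod_(j in c) F j)%E.
    by apply: eq_bigl => j; case: (boolP (j \in c)) => [/outc ->|]//; rewrite andbF.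
  rewrite !oc [in RHS]big1 ?mul1e; last by move=> j ->; rewrite probability_setT.
  rewrite muleC; congr (_ * _)%E.
    by apply: eq_bigr => j /andP[_ /negbTE ->].
  by apply: eq_bigr => j ->.
have key : P (E `&` (block_product c @^-1` B c)) = (P E * P (block_product c @^-1` B c))%E.
  pose pr (v : 'rV[R[i]]_N) : borel R[i] := \prod_j v 0 j.
  have mpr : measurable_fun setT (pr : borel 'rV[R[i]]_N -> borel R[i]).
    by apply: measurable_prodC => j; exact: coord_measurable.
  have prX w : pr (\row_j X j w) = block_product c w.
    rewrite /pr /block_product [RHS]big_mkcond /=; apply: eq_bigr => j _.
    by rewrite mxE /X; case: ifP.
  have fE := fineK (fin_num_measure P E mE).
  have := @law_on_boxes _ N _ _ P E X _ _ P X (fine (P E)) mE mX mX _ _ _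
    (preimageT_measurable mpr (mB c)).
  rewrite fE => h.
  have sE : [set w | (pr @^-1` B c) (\row_j X j w)] = block_product c @^-1` B c.
    by apply/seteqP; split=> w /=; rewrite prX.
  rewrite sE in h; apply: h; first exact: fine_ge0.
  move=> A1 mA1.
  have [A11|A11] := pselect (forall j, j \notin c -> A1 j 1).
    have -> : [set w | forall j, A1 j (X j w)] = [set w | forall j, j \in c -> A1 j (z j w)].
      apply/seteqP; split=> w /= hw j; have := hw j; rewrite /X.
        by move=> + jc; rewrite jc.
      by case: ifPn => [_ /(_ isT)//|jc _]; exact: A11.
    by rewrite PE// LX.
  have -> : [set w | forall j, A1 j (X j w)] = set0.
    apply/seteqP; split=> w //= hw; apply: A11 => j jc.
    by have := hw j; rewrite /X (negbTE jc).
  by rewrite setI0 measure0 mule0.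
have -> : E0 `&` blocks_event (c :: s) B A = E `&` (block_product c @^-1` B c).
  apply/seteqP; split=> w /=.
    move=> [e0 [h1 h2]]; split; last by apply: h1; rewrite inE eqxx.
    split => //; split => [c' sc'|j oj]; first by apply: h1; rewrite inE sc' orbT.
    by case: ifPn => // jc; apply: h2; rewrite outE oj.
  move=> [[e0 [h1 h2]] h3]; split => //; split => [c'|j].
    by rewrite inE => /predU1P[->//|/h1].
  by rewrite outE => /andP[oj jc]; have := h2 j oj; rewrite (negbTE jc).
rewrite key /E IH//; last by move=> j; case: ifP.
have -> : (\prod_(j | outside s j) L (if j \in c then setT else A j) =
           \prod_(j | outside (c :: s) j) L (A j))%E.
  rewrite (bigID (mem c)) /= big1 ?mul1e; last first.
    by move=> j /andP[_ ->]; rewrite probability_setT.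
  apply: eq_big => [j|j /andP[_ /negbTE ->]//]; by rewrite outE.
by rewrite big_cons muleAC -(muleA (P E0)) [(_ * P (_ @^-1` _))%E]muleC.
Qed.

(** [blocks_independent] for the distinct blocks among the [c r]; the constraints
    on a repeated block are gathered at its representative. *)
Lemma blocks_pattern q (c : 'I_q -> {set 'I_N}) (k : 'I_q -> 'I_q)
    (A : 'I_q -> set (borel R[i])) :
  (forall r r', (c r == c r') = (k r == k r')) -> (forall r, k (k r) = k r) ->
  (forall r r' j, j \in c r -> j \in c r' -> c r = c r') ->
  (forall r, measurable (A r)) ->
  P (E0 `&` [set w | forall r, A r (block_product (c r) w)]) =
  (P E0 * \prod_(b | k b == b)
     P [set w | forall r, k r = b -> A r (block_product (c b) w)])%E.
Proof.
move=> ck kk dis mA.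
pose s := [seq c b | b <- [seq b <- index_enum 'I_q | k b == b]].
pose B C := \bigcap_(r in [set r | c r = C]) A r.
have mB C : measurable (B C).
  rewrite /B (_ : [set r | c r = C] = [set` [seq r <- index_enum 'I_q | c r == C]]).
    by rewrite bigcap_seq; apply: bigsetI_measurable => r _.
  by apply/seteqP; split=> r /=; rewrite mem_filter mem_index_enum andbT => /eqP.
have cin r : c r \in s.
  apply/mapP; exists (k r); first by rewrite mem_filter kk eqxx mem_index_enum.
  by apply/eqP; rewrite ck kk.
have := @blocks_independent s B (fun=> setT).
rewrite [X in (_ * X)%E]big1 => [|j _]; last exact: probability_setT.
rewrite mule1 big_map big_filter => h.
rewrite (_ : [set w | _] = blocks_event s B (fun=> setT)).
  rewrite h//.
  - congr (_ * _)%E; apply: eq_bigr => b /eqP kb; congr (P _).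
    apply/seteqP; split=> w /=; rewrite /B /=.
      by move=> hw r kr; apply: hw => /=; apply/eqP; rewrite ck kr kb.
    by move=> hw r /= /eqP; rewrite ck kb => /eqP /hw.
  - rewrite map_inj_in_uniq ?filter_uniq ?index_enum_uniq// => b b'.
    rewrite !mem_filter => /andP[/eqP kb _] /andP[/eqP kb' _] /eqP.
    by rewrite ck kb kb' => /eqP.
  - by move=> C C' j /mapP[b _ ->] /mapP[b' _ ->]; exact: dis.
apply/seteqP; split=> w /=.
  by move=> hw; split => // C _ r /= <-; exact: hw.
by move=> [hw _] r; have := hw _ (cin r); exact.
Qed.

End blocks.

Lemma mutually_independent_cat (R : realType) d (Om : measurableType d)
    (P : probability Om R) (I : choiceType) (J : set I) (F : I -> set (set Om))
    (s1 s2 : seq I) (A : I -> set Om) :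
  mutually_independent P J F -> uniq (s1 ++ s2) ->
  (forall i, i \in s1 ++ s2 -> J i /\ F i (A i)) ->
  P ((\bigcap_(i in [set` s1]) A i) `&` (\bigcap_(i in [set` s2]) A i)) =
  (P (\bigcap_(i in [set` s1]) A i) * \prod_(i <- s2) P (A i))%E.
Proof.
move=> indep u hA; rewrite indep; first last.
- by move=> i si; apply: hA; rewrite mem_cat si.
- by move: u; rewrite cat_uniq => /andP[].
rewrite -big_cat -indep//; congr (P _); apply/seteqP; split=> w /=.
  by move=> [h1 h2] i /=; rewrite mem_cat => /orP[/h1|/h2].
by move=> h; split=> i si; apply: h; rewrite /= mem_cat si ?orbT.
Qed.

(** * Complex roots in polar coordinates *)

Section polar.
Context (R : realType).
Implicit Types (r t : R) (z : R[i]).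

Definition polar r t : R[i] := ((r * cos t) +i* (r * sin t))%C.

Lemma polarM r t r' t' : polar r t * polar r' t' = polar (r * r') (t + t').
Proof.
apply/eqP; rewrite eq_complex /= cosD sinD; apply/andP; split; apply/eqP; ring.
Qed.

Lemma polarX r t k : polar r t ^+ k = polar (r ^+ k) (k%:R * t).
Proof.
elim: k => [|k IH]; last by rewrite exprS IH polarM exprS -natr1 mulrDl mul1r (addrC t).
by rewrite !expr0 mul0r /polar cos0 sin0 mulr1 mulr0.
Qed.

Lemma normc_polar r t : 0 <= r -> Normc.normc (polar r t) = r.
Proof.
move=> r0; rewrite /= !exprMn -mulrDr cos2Dsin2 mulr1 sqrtr_sqr ger0_norm//.
Qed.

Lemma polar_periodic r t n : polar r (t + n%:R * (2 * pi)) = polar r t.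
Proof.
rewrite /polar (_ : n%:R * (2 * pi) = (pi *+ 2) *+ n).
  by rewrite (periodicn (@sinD2pi R)) (periodicn (@cosD2pi R)).
by rewrite -[RHS]mulr_natl -[pi *+ 2]mulr_natl.
Qed.

Lemma polar_angle_inj r t t' : 0 < r -> 0 <= t < 2 * pi -> 0 <= t' < 2 * pi ->
  polar r t = polar r t' -> t = t'.
Proof.
move=> r0 ht ht' /eqP; rewrite eq_complex /= => /andP[/eqP h1 /eqP h2].
have rn0 : r != 0 by rewrite gt_eqF.
have {}h1 := mulfI rn0 h1; have {}h2 := mulfI rn0 h2.
pose d := (t - t') / 2.
have cd : cos (d *+ 2) = 1.
  rewrite (_ : d *+ 2 = t - t'); last by rewrite -mulr_natr divfK.
  by rewrite cosB h1 h2 -!expr2 cos2Dsin2.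
have sd : sin d = 0.
  apply/eqP; rewrite -sqrf_eq0 sin2cos2.
  by move: cd; rewrite cos_mulr2n -mulr_natr => e; apply/eqP; lra.
have [d0|d0|d0] := ltgtP d 0; last by move: d0; rewrite /d; lra.
  have : 0 < sin (- d) by apply: sin_gt0_pi; rewrite /d in d0 *; lra.
  by rewrite sinN sd oppr0 ltxx.
have : 0 < sin d by apply: sin_gt0_pi; rewrite /d in d0 *; lra.
by rewrite sd ltxx.
Qed.

(** Argument in [0, 2 pi), by the half-angle formula
    cot (t / 2) = y / (r - x). *)
Definition arg z : R :=
  if Normc.normc z == complex.Re z then 0
  else pi - 2 * atan (complex.Im z / (Normc.normc z - complex.Re z)).

Lemma arg_range z : 0 <= arg z < 2 * pi.
Proof.
rewrite /arg; case: ifP => _; first by rewrite lexx mulr_gt0 ?pi_gt0.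
set u := _ / _; have := atan_gtNpi2 u; have := atan_ltpi2 u; lra.
Qed.

Lemma polar_arg z : polar (Normc.normc z) (arg z) = z.
Proof.
case: z => x y; rewrite /arg /=; set r := Num.sqrt _.
have r0 : 0 <= r by exact: sqrtr_ge0.
have r2 : r ^+ 2 = x ^+ 2 + y ^+ 2 by rewrite sqr_sqrtr ?addr_ge0 ?sqr_ge0.
case: eqVneq => [rx|rx].
  rewrite /polar cos0 sin0 mulr1 mulr0 rx.
  have /eqP : y ^+ 2 = 0 by move: r2; rewrite rx; lra.
  by rewrite sqrf_eq0 => /eqP ->.
have rxn0 : r - x != 0 by rewrite subr_eq0.
have rgt0 : 0 < r.
  rewrite lt_neqAle r0 andbT eq_sym; apply: contra rx => /eqP re0.
  by move: r2; rewrite re0 expr0n /= => /esym/eqP; rewrite paddr_eq0 ?sqr_ge0// sqrf_eq0 eq_sym => /andP[].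
(* [s] is the tangent of [a] and the argument is [pi - 2 * a]. *)
set s := y / (r - x); set a := atan s.
have s2 : 1 + s ^+ 2 = 2 * r / (r - x).
  rewrite /s expr_div_n; have -> : y ^+ 2 = (r - x) * (r + x) by rewrite -subr_sqr r2; ring.
  by field.
have c2 : cos a ^+ 2 = (r - x) / (2 * r).
  rewrite cos_atan exprVn sqr_sqrtr; last by rewrite addr_ge0 ?sqr_ge0.
  by rewrite s2 invf_div.
have ca0 : cos a != 0 by rewrite -sqrf_eq0 c2 mulf_neq0// invr_neq0// mulf_neq0// gt_eqF.
have sa : sin a = s * cos a by rewrite -(atanK s) /tan -/a divfK.
have rn0 : r != 0 by rewrite gt_eqF.
rewrite /polar; congr (_ +i* _)%C.
  rewrite cosB cospi sinpi mul0r addr0 mulr_natl cos_mulr2n -mulr_natr c2.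
  by field.
rewrite sinB cospi sinpi mul0r sub0r mulr_natl sin_mulr2n -mulr_natr sa.
have -> : cos a * (s * cos a) = s * cos a ^+ 2 by ring.
by rewrite c2 /s; field; rewrite rn0.
Qed.

(** The [k]-th roots of a nonzero complex number, numbered by [l < k]. *)
Definition croot (k : nat) z (l : nat) : R[i] :=
  polar (expR (log_modulus z / k%:R)) ((arg z + 2 * pi * l%:R) / k%:R).

Lemma normc_croot k z l : Normc.normc (croot k z l) = expR (log_modulus z / k%:R).
Proof. by rewrite normc_polar// expR_ge0. Qed.

Lemma normc_gt0 z : z != 0 -> 0 < Normc.normc z.
Proof.
move=> z0; rewrite lt_neqAle; apply/andP; split; last by case: z {z0} => a b; exact: sqrtr_ge0.
by apply: contra z0 => /eqP/esym/Normc.eq0_normc ->.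
Qed.

Lemma crootK k z l : (0 < k)%N -> z != 0 -> croot k z l ^+ k = z.
Proof.
move=> k0 z0; have kn0 : k%:R != 0 :> R by rewrite pnatr_eq0 -lt0n.
rewrite polarX -expRM_natl mulrC divfK// mulrC divfK//.
rewrite lnK ?posrE ?normc_gt0// (mulrC (2 * pi)) polar_periodic.
exact: polar_arg.
Qed.

Lemma croot_inj k z l l' : (l < k)%N -> (l' < k)%N -> croot k z l = croot k z l' -> l = l'.
Proof.
move=> lk lk' h; have k0 : (0 < k)%N by exact: leq_ltn_trans lk.
have kp : 0 < k%:R :> R by rewrite ltr0n.
have kn0 : k%:R != 0 :> R by rewrite gt_eqF.
have range m : (m < k)%N -> 0 <= (arg z + 2 * pi * m%:R) / k%:R < 2 * pi.
  move=> mk; have /andP[a0 a1] := arg_range z; have p0 := @pi_gt0 R.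
  rewrite divr_ge0 ?addr_ge0 ?mulr_ge0 ?(ltW p0)//= ltr_pdivrMr//.
  have : (m.+1%:R <= k%:R :> R) by rewrite ler_nat.
  by rewrite -natr1 => mk'; nra.
have := polar_angle_inj (expR_gt0 _) (range l lk) (range l' lk') h.
move/(mulIf (invr_neq0 kn0))/addrI/mulfI => /(_ _)/eqP.
rewrite eqr_nat => /(_ _)/eqP; apply.
by rewrite mulf_neq0// gt_eqF// pi_gt0.
Qed.

Lemma crootP k z w : (0 < k)%N -> z != 0 -> w ^+ k = z ->
  exists2 l, (l < k)%N & w = croot k z l.
Proof.
move=> k0 z0 wz; pose s := [seq croot k z l | l <- iota 0 k].
have us : uniq s.
  rewrite map_inj_in_uniq ?iota_uniq// => l l'.
  by rewrite !mem_iota /= add0n; exact: croot_inj.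
have [/mapP[l]|ws] := boolP (w \in s).
  by rewrite mem_iota => /= lk ->; exists l.
pose p : {poly R[i]} := 'X^k - z%:P.
have sp : size p = k.+1 by rewrite size_XnsubC.
have p0 : p != 0 by rewrite -size_poly_eq0 sp.
have rp v : v ^+ k = z -> root p v.
  by move=> vz; rewrite /root /p hornerD hornerN hornerC hornerXn vz subrr.
have := @max_poly_roots _ p (w :: s) p0.
rewrite /= ws us rp//= sp size_map size_iota ltnn => /(_ _ isT).
suff -> : all (root p) s by move=> /(_ isT).
by apply/allP => _ /mapP[l _ ->]; rewrite rp// crootK.
Qed.

Lemma arg_measurable : measurable_fun setT (arg : borel R[i] -> R).
Proof.
apply: measurable_fun_ifT.
- apply: (measurable_fun_eqr (T := borel R[i])); first exact: normc_measurable.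
  exact: Re_measurable.
- exact: measurable_cst.
- apply: measurable_funB; first exact: measurable_cst.
  apply: measurable_funM; first exact: measurable_cst.
  apply: measurableT_comp.
    by apply: continuous_measurable_fun => u; exact: continuous_atan.
  apply: measurable_funM; first exact: Im_measurable.
  rewrite (_ : (fun z : borel R[i] => _) = (fun z : borel R[i] =>
      (Normc.normc z - complex.Re z) `^ (-1))).
    apply: (measurableT_comp (@measurable_powR R (-1))).
    by apply: measurable_funB; [exact: normc_measurable|exact: Re_measurable].
  apply/funext => -[x y]; rewrite powR_inv1// subr_ge0 /=.
  apply: le_trans (ler_norm _) _; rewrite -sqrtr_sqr ler_wsqrtr//.
  by rewrite lerDl sqr_ge0.
Qed.

Lemma polar_measurable d (Om : measurableType d) (f g : Om -> R) :
  measurable_fun setT f -> measurable_fun setT g ->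
  measurable_fun setT ((fun w => polar (f w) (g w)) : Om -> borel R[i]).
Proof.
move=> mf mg; apply: measurable_Complex; apply: measurable_funM => //.
  by apply: measurableT_comp => //; apply: continuous_measurable_fun; exact: continuous_cos.
by apply: measurableT_comp => //; apply: continuous_measurable_fun; exact: continuous_sin.
Qed.

Lemma croot_measurable k l :
  measurable_fun setT ((fun z => croot k z l) : borel R[i] -> borel R[i]).
Proof.
apply: polar_measurable.
  apply: (measurableT_comp (@measurable_expR R)).
  apply: measurable_funM; last exact: measurable_cst.
  exact: log_modulus_measurable.
apply: measurable_funM; last exact: measurable_cst.
by apply: measurable_funD; [exact: arg_measurable|exact: measurable_cst].
Qed.

Lemma polar_continuous (T : topologicalType) (f g : T -> R) (x : T) :
  {for x, continuous f} -> {for x, continuous g} ->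
  {for x, continuous (fun y => polar (f y) (g y))}.
Proof.
move=> cf cg; apply: Complex_cvg; apply: cvgM => //.
  by apply: (cvg_comp _ _ cg); exact: continuous_cos.
by apply: (cvg_comp _ _ cg); exact: continuous_sin.
Qed.

End polar.

Lemma log_modulus_prod (R : realType) (I : Type) (s : seq I) (p : pred I) (f : I -> R[i]) :
  (forall i, p i -> f i != 0) ->
  log_modulus (\prod_(i <- s | p i) f i) = \sum_(i <- s | p i) log_modulus (f i).
Proof.
move=> f0; elim: s => [|i s IH]; first by rewrite !big_nil /log_modulus Normc.normc1 ln1.
rewrite !big_cons; case: ifP => // pi; rewrite -IH /log_modulus Normc.normcM lnM ?posrE//.
  by rewrite normc_gt0// f0.
apply: normc_gt0; elim/big_ind: _ => [|x y|j /f0//]; first exact: oner_neq0.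
exact: mulf_neq0.
Qed.

(** * Integrals against mixtures of laws *)

Section plain_integrals.
Context d (T : measurableType d) (R : realType).
Local Open Scope ereal_scope.
Import HBNNSimple.

(** An integral looks at the values of the set function on measurable sets only.
    It transfers integrals between a measure and the plain set functions of the
    statement. *)
Lemma eq_integral_set_fun (mu1 mu2 : set T -> \bar R) (f : T -> \bar R) :
  (forall A, measurable A -> mu1 A = mu2 A) -> \int[mu1]_x f x = \int[mu2]_x f x.
Proof.
move=> m12; have e (h : {nnsfun T >-> R}) : sintegral mu1 h = sintegral mu2 h.
  by rewrite /sintegral; apply: eq_fsbigr => x _; rewrite m12.
rewrite /integral; congr (ereal_sup _ - ereal_sup _); apply/seteqP;
  by split=> _ [h hg <-]; exists h => //; rewrite e.
Qed.

(** For integrands such as the eigenvalue counts, which are controlled only off a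
    null set and may fail to be measurable on it: the simple functions below [f]
    can be cut off on the null set without changing their integrals. *)
Lemma integral_eq_off_null (mu : {measure set T -> \bar R}) (N : set T)
    (f g : T -> \bar R) : measurable N -> mu N = 0 ->
  (forall x, 0 <= f x) -> (forall x, 0 <= g x) ->
  (forall x, ~ N x -> f x = g x) -> \int[mu]_x f x = \int[mu]_x g x.
Proof.
move=> mN N0.
suff le (f1 f2 : T -> \bar R) : (forall x, 0 <= f1 x) -> (forall x, 0 <= f2 x) ->
    (forall x, ~ N x -> f1 x = f2 x) -> \int[mu]_x f1 x <= \int[mu]_x f2 x.
  move=> f0 g0 fg; apply/eqP; rewrite eq_le !le// => x Nx; rewrite fg//.
move=> f10 f20 f12.
rewrite [X in X <= _]ge0_integralE// [X in _ <= X]ge0_integralE//.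
rewrite !patch_setT; apply: ge_ereal_sup => _ [h hf1 <-] /=.
pose h2 : {nnsfun T >-> R} := proj_nnsfun h (measurableC mN).
have -> : sintegral mu h = sintegral mu h2.
  rewrite -!integralT_nnsfun; apply: ge0_ae_eq_integral => //.
  - exact/measurable_EFinP.
  - exact/measurable_EFinP.
  - by move=> x _; rewrite lee_fin.
  - by move=> x _; rewrite lee_fin.
  exists N; split => // x /= hx; apply: contrapT => Nx; apply: hx => _ /=.
  by rewrite /h2 /= mindicE mem_set// mulr1.
apply: ereal_sup_ubound; exists h2 => // x /=.
rewrite mindicE; case: (pselect (N x)) => Nx.
  by rewrite (_ : x \in ~` N = false) ?mulr0//; apply/negbTE; rewrite notin_setE; exact.
by rewrite mem_set// mulr1 -f12.
Qed.

Lemma integral_mrestr (mu : {measure set T -> \bar R}) (E : set T) (mE : measurable E)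
    (f : T -> \bar R) : measurable_fun setT f -> (forall x, 0 <= f x) ->
  \int[mrestr mu mE]_x f x = \int[mu]_(x in E) f x.
Proof.
move=> mf f0; rewrite -(setUv E) ge0_integral_setU//=; last 3 first.
- exact: measurableC.
- by rewrite setUv.
- exact/disj_setPCl.
rewrite [X in _ + X]null_set_integral ?adde0; first last.
- by rewrite /= /mrestr setICl measure0.
- exact: measurable_funTS.
- exact: measurableC.
apply: eq_measure_integral => A mA AE.
by rewrite /= /mrestr setIidl.
Qed.

End plain_integrals.

Section mixtures.
Context d (T : measurableType d) (R : realType).
Local Open Scope ereal_scope.

Lemma esum_finType (K : finType) (p : pred K) (a : K -> \bar R) :
  (forall k, 0 <= a k) -> \esum_(k in [set k | p k]) a k = \sum_(k | p k) a k.
Proof.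
move=> a0; rewrite esum_fset//; last exact: finite_finset.
rewrite -[RHS]big_filter [RHS]fsbig_seq ?filter_uniq ?index_enum_uniq//.
apply: eq_fsbigl; apply/seteqP; split=> k /=;
  by rewrite mem_filter mem_index_enum andbT.
Qed.

(** Enumerates a countable family along [nat], where the theorems on series
    apply. *)
Definition unpickled (K : countType) (D : set K) (a : K -> \bar R) (n : nat) : \bar R :=
  if @pickle_inv K n is Some y then (if y \in D then a y else 0) else 0.

Lemma unpickled_ge0 (K : countType) (D : set K) (a : K -> \bar R) n :
  (forall y, 0 <= a y) -> 0 <= unpickled D a n.
Proof. by rewrite /unpickled => a0; case: pickle_inv => // y; case: ifP. Qed.

Lemma esum_countType (K : countType) (D : set K) (a : K -> \bar R) :
  (forall y, 0 <= a y) ->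
  \esum_(y in D) a y = \sum_(n <oo) unpickled D a n.
Proof.
move=> a0; rewrite nneseries_esumT => [|n]; last exact: unpickled_ge0.
rewrite (eq_esum (b := fun y => unpickled D a (pickle y))); last first.
  by move=> y Dy; rewrite /unpickled pickleK_inv mem_set.
rewrite -(esum_image D pickle (unpickled D a)); last first.
  by move=> x y _ _; exact: (pcan_inj pickleK).
rewrite [LHS]esum_mkcond; apply: eq_esum => n _; case: ifPn => //.
rewrite notin_setE /= => hn; rewrite /unpickled; case e: (pickle_inv n) => [y|//].
case: ifPn => // /set_mem Dy; case: hn; exists y => //.
by have := pickle_invK (n : nat) => /(_ K); rewrite e /=.
Qed.

(** Mixtures of laws: sums of multiples of the laws of [X y] on the events [E y]. *)
Section mixture.
Context d' (Om : measurableType d') (P : probability Om R).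
Variables (K : countType) (D : set K) (c : K -> R) (E : K -> set Om) (X : K -> Om -> T).
Hypothesis c0 : forall y, (0 <= c y)%R.
Hypothesis mE : forall y, measurable (E y).
Hypothesis mX : forall y, measurable_fun setT (X y).
Variable mu : set T -> \bar R.
Hypothesis muE : forall A, measurable A ->
  mu A = \esum_(y in D) (c y)%:E * P (E y `&` X y @^-1` A).

Let part (y : K) : {measure set T -> \bar R} :=
  pack_measure (law_finite_measure P (mE y) (mX y) (c0 y)).

Let partE y A : part y A = (c y)%:E * P (E y `&` X y @^-1` A).
Proof. by rewrite /part /= pack_measureE. Qed.

Let integral_part y (f : T -> \bar R) :
  measurable_fun setT f -> (forall x, 0 <= f x) ->
  \int[part y]_x f x = (c y)%:E * \int[P]_(w in E y) f (X y w).
Proof.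
move=> mf f0; pose nu := mscale (NngNum (c0 y)) (mrestr P (mE y)).
rewrite (@eq_integral_set_fun _ _ _ _ (pushforward nu (X y))); last first.
  by move=> A mA; rewrite partE /pushforward /nu /mscale /= /mrestr setIC.
rewrite ge0_integral_pushforward// preimage_setT ge0_integral_mscale//=.
- by rewrite integral_mrestr//; exact: measurableT_comp.
- exact: measurableT_comp.
Qed.

Let part_ n : {measure set T -> \bar R} :=
  if @pickle_inv K n is Some y then (if y \in D then part y else mzero) else mzero.

Let part_E n A : part_ n A = unpickled D (fun y => part y A) n.
Proof. by rewrite /part_ /unpickled; case: pickle_inv => // y; case: ifP. Qed.

Let mu_series A : measurable A -> mu A = mseries part_ 0 A.
Proof.
move=> mA; rewrite muE// /mseries.
rewrite (eq_eseriesr (g := unpickled D (fun y => part y A))); last by move=> n _; exact: part_E.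
by rewrite -esum_countType//; apply: eq_esum => y _; rewrite partE.
Qed.

Lemma integral_mixture (f : T -> \bar R) :
  measurable_fun setT f -> (forall x, 0 <= f x) ->
  \int[mu]_x f x = \esum_(y in D) (c y)%:E * \int[P]_(w in E y) f (X y w).
Proof.
move=> mf f0; rewrite (eq_integral_set_fun _ mu_series).
rewrite ge0_integral_measure_series// esum_countType; last first.
  by move=> y; rewrite mule_ge0 ?lee_fin// integral_ge0.
apply: eq_eseriesr => n _; rewrite /part_ /unpickled.
case: pickle_inv => [y|]; last exact: integral_measure_zero.
by case: ifP => _; [exact: integral_part|exact: integral_measure_zero].
Qed.

Lemma mixture_is_finite_measure : (forall A, 0 <= mu A) ->
  \esum_(y in D) (c y)%:E * P (E y) < +oo -> is_finite_measure mu.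
Proof.
move=> mu0 fin.
apply: (@eq_is_finite_measure _ _ _ (mseries part_ 0)) => //.
  apply: measure_is_finite; change (mseries part_ 0 setT < +oo); rewrite -mu_series// muE//.
  by under eq_esum do rewrite preimage_setT setIT.
by move=> A mA; rewrite mu_series.
Qed.

End mixture.

End mixtures.

(** * The expected eigenvalue measure *)

Lemma measurable_forall d (Om : measurableType d) (K : finType) (F : K -> set Om) :
  (forall k, measurable (F k)) -> measurable [set w | forall k, F k w].
Proof.
move=> mF; rewrite [X in measurable X](_ : _ = \big[setI/setT]_k F k).
  exact: bigsetI_measurable.
rewrite -bigcap_seq; apply/seteqP; split=> w h k => [_|]; first exact: h.
by apply: h; rewrite /= mem_index_enum.
Qed.

Section matrix_model.
Context (R : realType) (N q : nat).
Implicit Types (s : 'S_N) (z : 'I_N -> R[i]) (j : {ffun 'I_q -> 'I_N}).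

(** Each point of a cycle is given the root numbered by its position, so that
    the eigenvalues are indexed by the points that are permuted. *)
Definition perm_eigen s z (i : 'I_N) : R[i] :=
  croot #|porbit s i| (\prod_(k in porbit s i) z k) (cycle_pos s i).

Definition perm_eigen_row s z j : 'rV[R[i]]_q := \row_r perm_eigen s z (j r).

Lemma perm_eigenX s z i : (forall k, z k != 0) ->
  perm_eigen s z i ^+ #|porbit s i| = \prod_(k in porbit s i) z k.
Proof.
move=> z0; rewrite crootK ?lt0n ?card_porbit_neq0//.
by rewrite prodf_seq_neq0; apply/allP => k _; rewrite z0 implybT.
Qed.

Lemma eigenvalues_perm_matrix s z : (forall k, z k != 0) ->
  perm_eq (eigenvalues (perm_matrix s z)) [seq perm_eigen s z i | i <- enum 'I_N].
Proof.
move=> z0; rewrite /eigenvalues; case: closed_field_poly_normal => r /= hr.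
apply: prod_XsubC_eq; move: hr; rewrite (monicP (char_poly_monic _)) scale1r => <-.
rewrite big_map big_enum /=; apply: char_poly_weighted_perm => //.
  by move=> i; exact: perm_eigenX.
move=> i i' e; rewrite /perm_eigen e => h; apply: (cycle_pos_inj e).
by apply: (croot_inj _ _ h); [rewrite -e|]; exact: cycle_pos_lt.
Qed.

(** The two lists of eigenvalues differ by a permutation of the indices, and
    permuting indices preserves distinct tuples. *)
Lemma distinct_tuples_perm_matrix s z (A : set (borel 'rV[R[i]]_q)) :
  (forall k, z k != 0) ->
  distinct_tuples_measure [set: 'I_N]
    (fun i : 'I_N => nth 0%R (eigenvalues (perm_matrix s z)) i) A =
  (\sum_(j : {ffun 'I_q -> 'I_N} | injectiveb j)
     (\1_A (perm_eigen_row s z j))%:E)%E.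
Proof.
move=> z0; have pe := eigenvalues_perm_matrix s z0.
have sz : size (eigenvalues (perm_matrix s z)) == N.
  by rewrite (perm_size pe) size_map size_enum_ord.
have [p hp] : exists p : 'S_N, forall i : 'I_N,
    nth 0 (eigenvalues (perm_matrix s z)) i = perm_eigen s z (p i).
  have : perm_eq (Tuple sz) [tuple perm_eigen s z i | i < N] by [].
  move=> /tuple_permP[p hp]; exists p => i; rewrite [eigenvalues _]hp.
  by rewrite nth_mktuple tnth_mktuple.
rewrite /distinct_tuples_measure.
rewrite (_ : [set j | _] = [set j : {ffun 'I_q -> 'I_N} | injectiveb j]); last first.
  apply/seteqP; split=> j /=; first by move=> [ij _]; exact/injectiveP.
  by move=> /injectiveP.
rewrite esum_finType; last by move=> j; rewrite diracE lee_fin ler0n.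
rewrite [RHS](reindex_onto (fun j => [ffun r => p (j r)])
   (fun j => [ffun r => (p^-1)%g (j r)])) /=; last first.
  by move=> j _; apply/ffunP => r; rewrite !ffunE permKV.
apply: eq_big => [j|j _].
  rewrite (_ : [ffun r => (p^-1)%g ([ffun r0 => p (j r0)] r)] = j).
    rewrite eqxx andbT; apply/injectiveP/injectiveP => h x y.
      by rewrite !ffunE => /perm_inj/h.
    by move=> e; apply: h; rewrite !ffunE e.
  by apply/ffunP => r; rewrite !ffunE permK.
rewrite (_ : \row_r _ = perm_eigen_row s z [ffun r => p (j r)]) ?diracE ?indicE//.
by apply/rowP => r; rewrite !mxE ffunE hp.
Qed.

(** The permutation and the weights are recovered from such a matrix; hence the
    law of the matrix alone gives the expectations of functions of them. *)
Definition perm_shape s : set (borel 'M[R[i]]_N) :=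
  [set m | (forall a b, a != s b -> m a b = 0) /\ (forall b, m (s b) b != 0)].

Definition shape_weight s (m : 'M[R[i]]_N) (k : 'I_N) : R[i] := m k ((s^-1)%g k).

Lemma perm_shapeE s m : perm_shape s m -> m = perm_matrix s (shape_weight s m).
Proof.
move=> [h1 h2]; apply/matrixP => a b; rewrite mxE /shape_weight.
by case: eqVneq => [->|ab]; rewrite ?permK ?mulr1n // mulr0n h1.
Qed.

Lemma shape_weight_neq0 s m k : perm_shape s m -> shape_weight s m k != 0.
Proof. by move=> [_ h]; have := h ((s^-1)%g k); rewrite permKV. Qed.

Lemma perm_matrix_shape s t z :
  perm_shape s (perm_matrix t z) <-> s = t /\ forall k, z k != 0.
Proof.
split=> [[h1 h2]|[-> z0]]; last first.
  split=> [a b /negbTE ab|b]; first by rewrite mxE ab.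
  by rewrite mxE eqxx mulr1n.
have st : s = t.
  apply/permP => b; have := h2 b; rewrite mxE; by case: (eqVneq (s b) (t b)) => // _; rewrite mulr0n eqxx.
split => // k; have := h2 ((s^-1)%g k); rewrite mxE st permKV.
by rewrite eqxx mulr1n.
Qed.

Lemma shape_weight_perm_matrix s z k : shape_weight s (perm_matrix s z) k = z k.
Proof. by rewrite /shape_weight mxE permKV eqxx. Qed.

Lemma perm_shape_measurable s : measurable (perm_shape s).
Proof.
have m0 : measurable ([set 0] : set (borel R[i])) by exact: measurable_set1C.
pose F1 (ab : 'I_N * 'I_N) : set (borel 'M[R[i]]_N) :=
  [set m | ab.1 != s ab.2 -> m ab.1 ab.2 = 0].
pose F2 (b : 'I_N) : set (borel 'M[R[i]]_N) := [set m | m (s b) b != 0].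
rewrite [X in measurable X](_ : _ =
  [set m | forall ab, F1 ab m] `&` [set m | forall b, F2 b m]); last first.
  apply/seteqP; split=> m [h1 h2]; split=> //; first by move=> [a b]; exact: h1.
  by move=> a b; exact: (h1 (a, b)).
apply: measurableI; apply: measurable_forall => a.
  rewrite /F1; case: (a.1 != s a.2); last first.
    by rewrite [X in measurable X](_ : _ = setT)//; apply/seteqP; split.
  rewrite [X in measurable X](_ : _ = (fun m : 'M[R[i]]_N => m a.1 a.2) @^-1` [set 0]).
    exact: (preimageT_measurable (@coord_measurable R N N a.1 a.2) m0).
  by apply/seteqP; split=> m /=; [exact|move=> + _].
rewrite [X in measurable X](_ : _ = (fun m : 'M[R[i]]_N => m (s a) a) @^-1` (~` [set 0])).
  exact: (preimageT_measurable (@coord_measurable R N N (s a) a) (measurableC m0)).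
by apply/seteqP; split=> m /=; rewrite /F2 /=; move/eqP.
Qed.

Lemma shape_weight_measurable s k :
  measurable_fun setT ((fun m => shape_weight s m k) : borel 'M[R[i]]_N -> borel R[i]).
Proof. exact: coord_measurable. Qed.

Lemma perm_eigen_row_measurable d (Om : measurableType d) s
    (Z : 'I_N -> Om -> borel R[i]) j :
  (forall k, measurable_fun setT (Z k)) ->
  measurable_fun setT ((fun w => perm_eigen_row s (fun k => Z k w) j) :
    Om -> borel 'rV[R[i]]_q).
Proof.
move=> mZ; apply: row_measurable => r.
apply: (measurableT_comp (croot_measurable _ _)).
exact: (measurable_prodC _ _ mZ).
Qed.

End matrix_model.

Section measure_helpers.
Context d (Om : measurableType d) (R : realType) (P : probability Om R).

Lemma measure_eq_off_null (N A B : set Om) : measurable N -> P N = 0%E ->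
  measurable A -> measurable B -> (forall w, ~ N w -> A w <-> B w) -> P A = P B.
Proof.
move=> mN N0 mA mB AB.
rewrite -(setIT A) -(setIT B) -!integral_indic//.
apply: (integral_eq_off_null mN N0) => [x|x|x /AB h]; rewrite ?lee_fin//.
rewrite !indicE; congr (_%:R%:E); congr nat_of_bool.
by apply/idP/idP; rewrite !inE => /h.
Qed.

Lemma measure_finite_partition (K : finType) (f : Om -> K) (A : set Om) :
  (forall k, measurable (f @^-1` [set k])) -> measurable A ->
  P A = (\sum_k P (f @^-1` [set k] `&` A))%E.
Proof.
move=> mf mA; rewrite -[in LHS](setIT A) -integral_indic//.
rewrite (eq_integral (fun w => (\sum_k (\1_(f @^-1` [set k] `&` A) w)%:E)%E)); last first.
  move=> w _; rewrite (bigD1 (f w)) //= big1 ?adde0.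
    rewrite !indicE; congr (_%:R%:E); congr nat_of_bool.
    by apply/idP/idP; rewrite !inE => h; [split|case: h].
  move=> k kf; rewrite indicE memNset// => -[/= e _].
  by move: kf; rewrite e eqxx.
rewrite ge0_integral_sum//.
- apply: eq_bigr => k _; rewrite integral_indic ?setIT//; exact: measurableI.
- by move=> k; apply/measurable_EFinP/measurable_indic; exact: measurableI.
Qed.

Lemma measurable_fun_cases (K : finType) (f : Om -> K) d' (T : measurableType d')
    (F : K -> Om -> T) :
  (forall k, measurable (f @^-1` [set k])) -> (forall k, measurable_fun setT (F k)) ->
  measurable_fun setT (fun w => F (f w) w).
Proof.
move=> mf mF _ A mA; rewrite setTI.
rewrite [X in measurable X](_ : _ =
  ~` [set w | forall k, (~` (f @^-1` [set k] `&` F k @^-1` A)) w]).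
  apply: measurableC; apply: measurable_forall => k; apply: measurableC.
  by apply: measurableI => //; exact: preimageT_measurable.
apply/seteqP; split=> w /=.
  by move=> h /(_ (f w)); apply.
by move=> h; apply: contrapT => nA; apply: h => k [<-].
Qed.

End measure_helpers.

Section model_transfer.
Context (R : realType) (theta : R) (L : probability (borel R[i]) R).
Hypothesis L0 : L [set (0 : R[i])] = 0%E.
Context (N q : nat) d (Om : measurableType d) (P : probability Om R)
  (M : Om -> borel 'M[R[i]]_N).
Context d' (Om' : measurableType d') (P' : probability Om' R)
  (s : Om' -> 'S_N) (z : 'I_N -> Om' -> borel R[i]).
Hypothesis s_law : forall t, measurable (s @^-1` [set t]) /\
  P' (s @^-1` [set t]) = (ewens theta t)%:E.
Hypothesis z_law : forall j, has_law P' (z j) L.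
Hypothesis sz_indep : mutually_independent P' setT
  (fun i : option 'I_N =>
     if i is Some j then sigma_of (z j) else [set s @^-1` B | B in setT]).
Hypothesis M_law : has_law P M
  (fun A => P' [set w | A (perm_matrix (s w) (fun j => z j w))]).

Lemma model_iid : iid P' z L.
Proof.
split=> // t A ut hA.
have := sz_indep (s := map Some t) (A := fun i => if i is Some j then A j else setT).
rewrite map_inj_uniq ?big_map; last by move=> ? ? [].
move=> /(_ ut) <-; last first.
  by move=> i /mapP[j jt ->]; split => //; exact: (hA j jt).2.
congr (P' _); apply/seteqP; split=> w h.
  by move=> i /= /mapP[j jt ->]; exact: h.
by move=> j jt; have := h (Some j); apply; rewrite /= map_f.
Qed.

Lemma model_s_z_indep t (A : 'I_N -> set (borel R[i])) :
  (forall j, measurable (A j)) ->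
  P' (s @^-1` [set t] `&` [set w | forall j, A j (z j w)]) =
  (P' (s @^-1` [set t]) * \prod_j L (A j))%E.
Proof.
move=> mA.
have := mutually_independent_fin (K := option 'I_N) (f := id)
  (A := fun i => if i is Some j then z j @^-1` A j else s @^-1` [set t])
  sz_indep (@inj_id _).
move=> h; rewrite (_ : _ `&` _ = [set w | forall k : option 'I_N,
   (if k is Some j then z j @^-1` A j else s @^-1` [set t]) w]); last first.
  apply/seteqP; split=> w /=; first by move=> [h1 h2] [j|]; [exact: h2|].
  by move=> hw; split; [exact: (hw None)|move=> j; exact: (hw (Some j))].
rewrite h.
  rewrite (bigD1 None) //=; congr (_ * _)%E.
  rewrite (reindex_omap Some id) /=; last by case.
  rewrite (eq_bigl xpredT); last by move=> j; rewrite eqxx.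
  by apply: eq_bigr => j _; exact: (z_law j).2.
move=> [j|]; split => //; first by exists (A j) => //; rewrite setTI.
Qed.

Lemma model_zero_null : measurable [set w | ~ forall j, (z j w : R[i]) != 0] /\
  P' [set w | ~ forall j, (z j w : R[i]) != 0] = 0%E.
Proof.
have m0 : measurable ([set 0] : set (borel R[i])) by exact: measurable_set1C.
have e : [set w | forall j, (z j w : R[i]) != 0] =
    [set w | forall j, (~` [set 0] : set (borel R[i])) (z j w)].
  by apply/seteqP; split=> w /= h j; apply/eqP; exact: h.
have m1 : measurable [set w | forall j, (z j w : R[i]) != 0].
  rewrite e; apply: measurable_forall => j.
  by apply: (preimageT_measurable (z_law j).1); exact: measurableC.
split; first exact: measurableC.
have PZ1 : P' [set w | forall j, (z j w : R[i]) != 0] = 1%E.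
  rewrite e (iid_box (A := fun=> ~` ([set 0] : set (borel R[i]))) model_iid); last by move=> j; exact: measurableC.
  by rewrite big1// => j _; rewrite probability_setC// L0 sube0.
rewrite (_ : [set w | ~ _] = ~` [set w | forall j, (z j w : R[i]) != 0])//.
by rewrite probability_setC// PZ1 subee.
Qed.

Let row (j : {ffun 'I_q -> 'I_N}) w := perm_eigen_row (s w) (fun k => z k w) j.

Lemma model_row_measurable (j : {ffun 'I_q -> 'I_N}) :
  measurable_fun setT (row j : Om' -> borel 'rV[R[i]]_q).
Proof.
have mF t : measurable_fun setT ((fun w => perm_eigen_row t (fun k => z k w) j) :
    Om' -> borel 'rV[R[i]]_q).
  by apply: perm_eigen_row_measurable => k; exact: (z_law k).1.
exact: (measurable_fun_cases (fun t => (s_law t).1) mF).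
Qed.

(** The integrand of [mu_tilde] is a function of the matrix, whose law is that of
    the model. It is made explicit on the matrices with the shape of some
    permutation, which carry the whole law. *)
Lemma mu_tilde_model (A : set (borel 'rV[R[i]]_q)) : measurable A ->
  mu_tilde P M A =
  (\sum_(j : {ffun 'I_q -> 'I_N} | injectiveb j) P' (row j @^-1` A))%E.
Proof.
move=> mA; have [mZ PZ] := model_zero_null; have mM := M_law.1.
pose S t (j : {ffun 'I_q -> 'I_N}) : set (borel 'M[R[i]]_N) :=
  perm_shape t `&` [set m | A (perm_eigen_row t (shape_weight t m) j)].
have mS t j : measurable (S t j).
  apply: measurableI; first exact: perm_shape_measurable.
  exact: (preimageT_measurable (perm_eigen_row_measurable (N := N) t j
    (shape_weight_measurable t)) mA).
(* [G] is the set of the matrices with the shape of some permutation. *)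
pose G : set (borel 'M[R[i]]_N) := [set m | ~ forall t, (~` perm_shape t) m].
have mG : measurable G.
  apply: measurableC; apply: measurable_forall => t; apply: measurableC.
  exact: perm_shape_measurable.
have PG : P (~` (M @^-1` G)) = 0%E.
  rewrite probability_setC; last exact: preimageT_measurable.
  rewrite M_law.2// (_ : [set w | _] = ~` [set w | ~ forall j, (z j w : R[i]) != 0]).
    by rewrite probability_setC// PZ sube0 subee.
  apply/seteqP; split=> w /=; rewrite /G /=.
    move=> h hz; apply: h => t /perm_matrix_shape[_ z0]; exact: hz.
  move=> /contrapT z0 h; apply: (h (s w)); exact/perm_matrix_shape.
transitivity (\int[P]_w (\sum_(j : {ffun 'I_q -> 'I_N} | injectiveb j)
    \sum_t (\1_(M @^-1` S t j) w)%:E))%E.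
  apply: (integral_eq_off_null (N := ~` (M @^-1` G))) => //.
  - by apply: measurableC; exact: preimageT_measurable.
  - by move=> w; rewrite /distinct_tuples_measure; apply: esum_ge0 => ? _; rewrite diracE lee_fin.
  - by move=> w; apply: sume_ge0 => j _; apply: sume_ge0 => t _; rewrite lee_fin.
  move=> w /contrapT; rewrite /G /= => /existsNP[t /contrapT Mt].
  have z0 k := shape_weight_neq0 k Mt.
  rewrite {1}(perm_shapeE Mt) distinct_tuples_perm_matrix//.
  apply: eq_bigr => j _; rewrite (bigD1 t) //= big1 ?adde0.
    rewrite !indicE; congr (_%:R%:E); congr nat_of_bool.
    by apply/idP/idP; rewrite !inE /S /= => h; [split|case: h].
  move=> t' t't; rewrite indicE memNset// => -[/= + _].
  rewrite (perm_shapeE Mt) => /perm_matrix_shape[e _].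
  by move: t't; rewrite e eqxx.
have mMS t j : measurable (M @^-1` S t j) by exact: preimageT_measurable.
under eq_integral do rewrite -big_filter.
rewrite ge0_integral_sum//; first last.
- by move=> j w _; apply: sume_ge0 => t _; rewrite lee_fin.
- by move=> j; apply: emeasurable_sum => t; apply/measurable_EFinP/measurable_indic.
rewrite big_filter; apply: eq_bigr => j _; rewrite ge0_integral_sum//; last first.
  by move=> t; apply/measurable_EFinP/measurable_indic.
have mrow := preimageT_measurable (model_row_measurable j) mA.
rewrite (measure_finite_partition P' (f := s)) //; last by move=> t; exact: (s_law t).1.
apply: eq_bigr => t _; transitivity (P (M @^-1` S t j)).
  by rewrite integral_indic// setIT.
rewrite (M_law.2 _ (mS t j)).
apply: (measure_eq_off_null mZ PZ).
- have mF u : measurable_fun setT ((fun w => perm_matrix u (fun k => z k w)) :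
      Om' -> borel 'M[R[i]]_N).
    apply: measurable_matrix => a b; under eq_fun do rewrite mxE.
    by case: (a == u b); [exact: (z_law a).1|exact: measurable_cst].
  exact: (preimageT_measurable (measurable_fun_cases (fun u => (s_law u).1) mF) (mS t j)).
- by apply: measurableI => //; exact: (s_law t).1.
have eW u w : shape_weight u (perm_matrix u (fun k => z k w)) = (fun k => z k w : R[i]).
  by apply/funext => k; rewrite shape_weight_perm_matrix.
move=> w /contrapT z0; rewrite /S /=; split.
  by move=> [/perm_matrix_shape[-> _]]; rewrite eW.
by move=> [/= <- h]; split; [exact/perm_matrix_shape|rewrite eW].
Qed.

End model_transfer.

(** * Powers of the uniform law on a circle *)

Section rowcons.
Context (R : realType).

Definition rowcons q (x : R[i]) (v : 'rV[R[i]]_q) : 'rV[R[i]]_q.+1 :=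
  row_mx (x%:M : 'M[R[i]]_1) v.

Lemma rowcons0 q x (v : 'rV[R[i]]_q) : rowcons x v 0 ord0 = x.
Proof.
have := row_mxEl (x%:M : 'M[R[i]]_1) v 0 0; rewrite lshift0 => e.
by rewrite /rowcons [LHS]e mxE eqxx mulr1n.
Qed.

Lemma rowconsS q x (v : 'rV[R[i]]_q) k : rowcons x v 0 (lift ord0 k) = v 0 k.
Proof.
have := row_mxEr (x%:M : 'M[R[i]]_1) v 0 k; rewrite rshift1 => e.
by rewrite /rowcons [LHS]e.
Qed.

Definition rowpair q (xv : borel R[i] * borel 'rV[R[i]]_q) : borel 'rV[R[i]]_q.+1 :=
  rowcons xv.1 xv.2.

Lemma rowpair_measurable q : measurable_fun setT (@rowpair q).
Proof.
apply: measurable_matrix => i j; rewrite /rowpair ord1.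
case: (unliftP ord0 j) => [k|] ->.
  under eq_fun do rewrite rowconsS.
  exact: (measurableT_comp (coord_measurable 0 k) measurable_snd).
by under eq_fun do rewrite rowcons0; exact: measurable_fst.
Qed.

Lemma rowcons_measurable q (x : R[i]) :
  measurable_fun setT (rowcons x : borel 'rV[R[i]]_q -> borel 'rV[R[i]]_q.+1).
Proof.
apply: measurable_matrix => i j; rewrite ord1.
case: (unliftP ord0 j) => [k|] ->.
  by under eq_fun do rewrite rowconsS; exact: coord_measurable.
by under eq_fun do rewrite rowcons0; exact: measurable_cst.
Qed.

End rowcons.

Section circle_power.
Context (R : realType) (r : R).
Local Open Scope ereal_scope.

Let pi2_gt0 : (0 < 2 * pi :> R)%R.
Proof. by rewrite mulr_gt0// pi_gt0. Qed.

Let u : probability (measurableTypeR R) R := uniform_prob pi2_gt0.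

Let polar_r_measurable : measurable_fun setT (polar r : measurableTypeR R -> borel R[i]).
Proof. exact: polar_measurable. Qed.

Lemma uniform_circleE A : uniform_circle r A = u (polar r @^-1` A).
Proof. by []. Qed.

Lemma uniform_circle_finite : is_finite_measure (uniform_circle r).
Proof.
have := law_finite_measure u measurableT polar_r_measurable (@ler01 R).
by congr is_finite_measure; apply/funext => A; rewrite mul1e setTI.
Qed.

Let circ : {finite_measure set (borel R[i]) -> \bar R} := pack_measure uniform_circle_finite.

Let circE : circ = uniform_circle r :> (set (borel R[i]) -> \bar R).
Proof. exact: pack_measureE. Qed.

Lemma integral_uniform_circle (g : borel R[i] -> \bar R) :
  measurable_fun setT g -> (forall x, 0 <= g x) ->
  \int[uniform_circle r]_x g x =
  ((2 * pi)^-1)%:E * \int[lebesgue_measure]_(t in `[0%R, (2 * pi)%R]) g (polar r t).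
Proof.
move=> mg g0.
rewrite (@eq_integral_set_fun _ _ _ _ (pushforward u (polar r : measurableTypeR R -> borel R[i])))//.
rewrite ge0_integral_pushforward// preimage_setT integral_uniform//=.
  by rewrite subr0.
exact: measurableT_comp.
Qed.

(** The integral against the power of the uniform law, in the form in which one
    coordinate can be frozen at a time. *)
Fixpoint circle_mean (q : nat) : ('rV[R[i]]_q -> \bar R) -> \bar R :=
  match q with
  | 0 => fun f => f 0%R
  | q'.+1 => fun f => \int[uniform_circle r]_x
      circle_mean (fun v : 'rV[R[i]]_q' => f (rowcons x v))
  end.

(** Each step of [product_power] is the image of a product measure under
    [rowcons], and Tonelli's theorem gives the iterated integral. *)
Lemma product_power_measure q :
  exists nu : {finite_measure set (borel 'rV[R[i]]_q) -> \bar R},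
  [/\ @product_power R (uniform_circle r) q = nu,
      nu setT = 1 &
      forall f : borel 'rV[R[i]]_q -> \bar R, measurable_fun setT f ->
        (forall v, 0 <= f v) -> \int[nu]_v f v = circle_mean f].
Proof.
elim: q => [|q [nu [nuE nu1 nuI]]].
  exists (dirac (0%R : borel 'rV[R[i]]_0)); split => //.
    by rewrite /= diracT.
  by move=> f mf f0; rewrite integral_dirac// diracT mul1e.
pose pr : {measure set (borel R[i] * borel 'rV[R[i]]_q) -> \bar R} := (circ \x nu)%E.
have prE B : pr B = \int[uniform_circle r]_x nu (xsection B x) by rewrite -circE.
have prT : pr setT = 1.
  rewrite -setXTT; transitivity (circ setT * nu setT).
    exact: (product_measure1E circ nu).
  by rewrite nu1 mule1 circE uniform_circleE preimage_setT probability_setT.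
have fin : is_finite_measure (fun A => pr (@rowpair R q @^-1` A)).
  split.
  - by rewrite preimage_set0 measure0.
  - by move=> A; exact: measure_ge0.
  - move=> F mF tF mUF; rewrite preimage_bigcup.
    apply: measure_semi_sigma_additive.
    + by move=> i; exact: (preimageT_measurable (@rowpair_measurable R q) (mF i)).
    + by move=> i j _ _ [x [h1 h2]]; apply: tF => //; exists (rowpair x).
    + by apply: bigcup_measurable => i _; exact: (preimageT_measurable (@rowpair_measurable R q) (mF i)).
  - by rewrite preimage_setT prT ltry.
exists (pack_measure fin); split.
- rewrite /= pack_measureE; apply/funext => A /=.
  rewrite nuE prE.
  congr (integral _ _ _); apply/funext => x.
  by congr (nu _); apply/seteqP; split=> v; rewrite /xsection/= inE.
- by rewrite /= pack_measureE preimage_setT prT.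
- move=> f mf f0; rewrite (@eq_integral_set_fun _ _ _ _ (pushforward pr (@rowpair R q))); last first.
    by move=> A mA; rewrite /= pack_measureE.
  have mf' := measurableT_comp mf (@rowpair_measurable R q).
  rewrite (ge0_integral_pushforward (@rowpair_measurable R q) pr measurableT)//.
  rewrite (_ : _ @^-1` _ = setT)//.
  transitivity (\int[circ]_x fubini_F nu (f \o @rowpair R q) x).
    exact: (fubini_tonelli1 (m1 := circ) (m2 := nu) _ mf' (fun z => f0 _)).
  rewrite circE /=; congr (integral _ _ _); apply/funext => x.
  rewrite /fubini_F nuI//; first exact: (measurableT_comp mf (rowcons_measurable x)).
  by move=> v; exact: f0.
Qed.

Lemma circle_mean_measurable q (f : borel 'rV[R[i]]_q.+1 -> \bar R) :
  measurable_fun setT f -> (forall v, 0 <= f v) ->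
  measurable_fun setT (fun x : borel R[i] =>
    circle_mean (fun v : 'rV[R[i]]_q => f (rowcons x v))).
Proof.
move=> mf f0; have [nu [_ _ nuI]] := product_power_measure q.
rewrite (_ : (fun x => _) = fubini_F nu (f \o @rowpair R q)).
  have mf' := measurableT_comp mf (@rowpair_measurable R q).
  exact: (measurable_fun_fubini_tonelli_F (m2 := nu) _ mf' (fun z => f0 _)).
apply/funext => x; rewrite /fubini_F nuI//; first exact: (measurableT_comp mf (rowcons_measurable x)).
by move=> v; exact: f0.
Qed.

Lemma circle_mean_ge0 q (f : 'rV[R[i]]_q -> \bar R) :
  (forall v, 0 <= f v) -> 0 <= circle_mean f.
Proof.
elim: q f => [|q IH] f f0 /=; first exact: f0.
rewrite -circE; apply: integral_ge0 => x _.
exact: (IH (fun v => f (rowcons x v)) (fun v => f0 _)).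
Qed.

(** Only the values on the circle matter. *)
Lemma circle_mean_le q (f g : borel 'rV[R[i]]_q -> \bar R) (e : R) :
  measurable_fun setT f -> measurable_fun setT g ->
  (forall v, 0 <= f v) -> (forall v, 0 <= g v) -> (0 <= e)%R ->
  (forall v : 'rV[R[i]]_q, (forall k, exists2 t, (0 <= t <= 2 * pi)%R & v 0%R k = polar r t) ->
     f v <= g v + e%:E) ->
  circle_mean f <= circle_mean g + e%:E.
Proof.
move=> mf mg f0 g0 e0; elim: q f g mf mg f0 g0 => [|q IH] f g mf mg f0 g0 fg /=.
  by apply: fg => -[].
rewrite integral_uniform_circle; first last.
- by move=> x; apply: circle_mean_ge0.
- exact: circle_mean_measurable.
have -> : \int[uniform_circle r]_x circle_mean (fun v : 'rV[R[i]]_q => g (rowcons x v)) + e%:E =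
    \int[uniform_circle r]_x (circle_mean (fun v : 'rV[R[i]]_q => g (rowcons x v)) + e%:E).
  rewrite -circE ge0_integralD//.
  - by rewrite integral_cst//= circE uniform_circleE preimage_setT probability_setT mule1.
  - by move=> x _; apply: circle_mean_ge0.
  - exact: circle_mean_measurable.
rewrite integral_uniform_circle; first last.
- by move=> x; rewrite adde_ge0// circle_mean_ge0.
- by apply: emeasurable_funD => //; exact: circle_mean_measurable.
have mp := polar_r_measurable.
apply: lee_wpmul2l; first by rewrite lee_fin invr_ge0 mulr_ge0// pi_ge0.
apply: ge0_le_integral => //.
- by move=> t _; apply: circle_mean_ge0.
- by apply: measurable_funTS; apply: (measurableT_comp (circle_mean_measurable mf f0)).
- apply: measurable_funTS; apply: emeasurable_funD => //.
  exact: (measurableT_comp (circle_mean_measurable mg g0)).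
- move=> t; rewrite /= in_itv /= => ht.
  apply: IH => //.
  + exact: (measurableT_comp mf (rowcons_measurable _)).
  + exact: (measurableT_comp mg (rowcons_measurable _)).
  + move=> v hv; apply: fg => k; case: (unliftP ord0 k) => [l|] ->.
      by rewrite rowconsS; exact: hv.
    by rewrite rowcons0; exists t.
Qed.

End circle_power.

(** * The weak law of large numbers *)

Section weak_law.
Context (R : realType).
Local Open Scope ereal_scope.
Import HBSimple.

Lemma has_law_integral d (Om : measurableType d) (P : probability Om R)
    d' (T : measurableType d') (X : Om -> T) (mu : set T -> \bar R) (f : T -> \bar R) :
  has_law P X mu -> measurable_fun setT f -> (forall x, 0 <= f x) ->
  \int[P]_w f (X w) = \int[mu]_x f x.
Proof.
move=> [mX XE] mf f0.
rewrite (@eq_integral_set_fun _ _ _ mu (pushforward P X)); last first.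
  by move=> A mA; rewrite -XE.
by rewrite (ge0_integral_pushforward mX P measurableT).
Qed.

Lemma measurable_fin_sum d (T : measurableType d) (K : finType) (p : pred K)
    (f : K -> T -> \bar R) :
  (forall k, measurable_fun setT (f k)) ->
  measurable_fun setT (fun x => \sum_(k | p k) f k x).
Proof.
by move=> mf; under eq_fun do rewrite -big_filter; exact: emeasurable_sum.
Qed.

Lemma integral_fin_sum d (T : measurableType d) (mu : {measure set T -> \bar R})
    (K : finType) (p : pred K) (f : K -> T -> \bar R) :
  (forall k, measurable_fun setT (f k)) -> (forall k x, 0 <= f k x) ->
  \int[mu]_x (\sum_(k | p k) f k x) = \sum_(k | p k) \int[mu]_x f k x.
Proof.
move=> mf f0; under eq_integral do rewrite -big_filter.
by rewrite ge0_integral_sum// big_filter.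
Qed.

Lemma ge_set_measurable d (Om : measurableType d) (g : Om -> R) (a : R) :
  measurable_fun setT g -> measurable [set w | (a <= g w)%R].
Proof.
move=> mg; have := preimageT_measurable mg (measurable_itv `[a, +oo[).
by congr measurable; apply/seteqP; split => w /=; rewrite in_itv/= andbT.
Qed.

Lemma markov_real d (Om : measurableType d) (P : probability Om R) (g : Om -> R) (a b : R) :
  measurable_fun setT g -> (forall w, 0 <= g w)%R -> (0 < a)%R ->
  \int[P]_w (g w)%:E <= b%:E -> P [set w | (a <= g w)%R] <= (b / a)%:E.
Proof.
move=> mg g0 a0 gb; rewrite EFinM muleC lee_pdivlMl//.
apply: le_trans gb.
have mE : measurable_fun setT (EFin \o g) by exact/measurable_EFinP.
have := le_integral_abse P measurableT mE a0; rewrite setTI /=.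
have -> : [set x | a%:E <= `|(g x)%:E|] = [set w | (a <= g w)%R].
  by apply/seteqP; split => w /=; rewrite lee_fin ger0_norm.
by under eq_integral do rewrite /= ger0_norm//.
Qed.

Context d (T : measurableType d) (L : probability T R).

Lemma iid_pair_integral (K : choiceType) d' (Om : measurableType d') (P : probability Om R)
    (X : K -> Om -> T) (i j : K) (f : T * T -> \bar R) :
  iid P X L -> i != j -> measurable_fun setT f -> (forall x, 0 <= f x) ->
  \int[P]_w f (X i w, X j w) = \int[L]_x \int[L]_y f (x, y).
Proof.
move=> [Xlaw Xind] ij mf f0.
have mX k : measurable_fun setT (X k) by have [] := Xlaw k.
pose Y w := (X i w, X j w).
have mY : measurable_fun setT Y by exact: measurable_fun_pair.
transitivity (\int[pushforward P Y]_z f z).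
  by rewrite (ge0_integral_pushforward mY P measurableT).
have fin : is_finite_measure (pushforward P Y).
  have := law_finite_measure P measurableT mY (@ler01 R).
  by congr is_finite_measure; apply/funext => A; rewrite mul1e setTI.
have e : forall A, measurable A -> (L \x L)%E A = pushforward P Y A.
  move=> A mA; rewrite -[in RHS](pack_measureE fin).
  apply: product_measure_unique => // B C mB mC.
  rewrite [LHS](congr1 (fun m => m _) (pack_measureE fin)) /pushforward /=.
  pose A_ := fun k : K => if k == i then X i @^-1` B else X j @^-1` C.
  have := Xind [:: i; j] A_; rewrite /= inE ij => /(_ isT) H.
  rewrite (_ : _ @^-1` _ = \bigcap_(k in [set` [:: i; j]]) A_ k).
    rewrite H.
      rewrite big_cons big_seq1 /A_ eqxx eq_sym (negbTE ij).
      by have [_ ->] := Xlaw i => //; have [_ ->] := Xlaw j.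
    move=> k; rewrite !inE => /orP[] /eqP ->; split => //; rewrite /A_ ?eqxx.
      by exists B => //; rewrite setTI.
    by rewrite eq_sym (negbTE ij); exists C => //; rewrite setTI.
  apply/seteqP; split => w /=.
    move=> [h1 h2] k /=; rewrite !inE => /orP[] /eqP ->; rewrite /A_ ?eqxx//.
    by rewrite eq_sym (negbTE ij).
  move=> h; split; first by have := h i; rewrite /= !inE eqxx /A_ eqxx; exact.
  by have := h j; rewrite /= !inE eqxx orbT /A_ eq_sym (negbTE ij); exact.
rewrite -(eq_integral_set_fun _ e).
exact: (fubini_tonelli1 _ mf f0).
Qed.

(** Chebyshev's inequality: in the second moment of the sum, the terms off the
    diagonal are [e ^ 2] and those on it are at most [B ^ 2]. *)
Lemma weak_law_bounded (K : finType) d' (Om : measurableType d') (P : probability Om R)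
    (X : K -> Om -> T) (S : {set K}) (h : T -> R) (B delta e : R) :
  iid P X L -> (0 < #|S|)%N -> measurable_fun setT h ->
  (forall x, 0 <= h x <= B)%R -> (0 < delta)%R -> \int[L]_x (h x)%:E = e%:E ->
  P [set w | (delta <= `| #|S|%:R^-1 * (\sum_(j in S) h (X j w)) - e |)%R] <=
  (B ^+ 2 / (#|S|%:R * delta ^+ 2))%:E.
Proof.
move=> Xiid S0 mh hB d0 he; set n : R := #|S|%:R.
have n0 : (0 < n)%R by rewrite ltr0n.
have [Xlaw _] := Xiid.
have mX k : measurable_fun setT (X k) by have [] := Xlaw k.
have h0 x : (0 <= h x)%R by have /andP[] := hB x.
have mhX k : measurable_fun setT (fun w => h (X k w)) by exact: measurableT_comp.
pose Sm w := (\sum_(j in S) h (X j w))%R.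
have mS : measurable_fun setT Sm by rewrite /Sm; under eq_fun do rewrite -big_enum /=; exact: measurable_sum.
have S_ge0 w : (0 <= Sm w)%R by apply: sumr_ge0.
have e0 : (0 <= e)%R by rewrite -lee_fin -he; apply: integral_ge0 => x _; rewrite lee_fin.
have mE (g : Om -> R) : measurable_fun setT g -> measurable_fun setT (EFin \o g).
  by move=> mg; exact/measurable_EFinP.
have ES : \int[P]_w (Sm w)%:E = (n * e)%:E.
  under eq_integral do rewrite /Sm -sumEFin.
  rewrite integral_fin_sum; first last.
  - by move=> k w; rewrite lee_fin.
  - by move=> k; exact: mE.
  rewrite (eq_bigr (fun=> e%:E)).
    by rewrite sumEFin sumr_const mulr_natl.
  move=> k _; rewrite -he; apply: (has_law_integral (f := EFin \o h) (Xlaw k)) => //.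
  exact/measurable_EFinP.
have ES2 : \int[P]_w ((Sm w) ^+ 2)%:E <= (n ^+ 2 * e ^+ 2 + n * B ^+ 2)%:E.
  have -> : \int[P]_w ((Sm w) ^+ 2)%:E =
      \sum_(i in S) \sum_(j in S) \int[P]_w (h (X i w) * h (X j w))%:E.
    under eq_integral.
      move=> w _; rewrite expr2 /Sm mulr_suml -sumEFin.
      under eq_bigr do rewrite mulr_sumr -sumEFin.
      over.
    rewrite integral_fin_sum; first last.
    - by move=> k w; apply: sume_ge0 => l _; rewrite lee_fin mulr_ge0.
    - move=> k; apply: measurable_fin_sum => l; apply: mE; exact: measurable_funM.
    apply: eq_bigr => i _; rewrite integral_fin_sum//.
    - by move=> k; apply: mE; exact: measurable_funM.
    - by move=> k w; rewrite lee_fin mulr_ge0.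
  apply: (@le_trans _ _ (\sum_(i in S) (n * e ^+ 2 + B ^+ 2)%:E)); last first.
    rewrite sumEFin sumr_const lee_fin -[leLHS]mulr_natl -/n.
    by rewrite le_eqVlt; apply/orP; left; apply/eqP; ring.
  apply: lee_sum => i iS; rewrite (bigD1 i)//= addeC EFinD.
  apply: leeD.
    apply: (@le_trans _ _ (\sum_(j in S) (e ^+ 2)%:E)); last first.
      by rewrite sumEFin sumr_const lee_fin mulr_natl.
    rewrite [leRHS](bigD1 i)//= -[leLHS]add0e; apply: leeD.
      by rewrite lee_fin sqr_ge0.
    apply: lee_sum => j /andP[_ ji].
    rewrite (@iid_pair_integral _ _ _ P X i j (fun z => (h z.1 * h z.2)%:E)) //; first last.
    - by move=> x; rewrite lee_fin mulr_ge0.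
    - apply/measurable_EFinP; apply: measurable_funM.
        exact: (measurableT_comp mh measurable_fst).
      exact: (measurableT_comp mh measurable_snd).
    - by rewrite eq_sym.
    under eq_integral.
      move=> x _ /=; under eq_integral do rewrite EFinM.
      rewrite ge0_integralZl//; first last.
      - by rewrite lee_fin.
      - by move=> y _; rewrite lee_fin.
      - exact/measurable_EFinP.
      rewrite he; over.
    rewrite ge0_integralZr//; first last.
    - by move=> y _; rewrite lee_fin.
    - exact/measurable_EFinP.
    by rewrite he -EFinM expr2.
  rewrite -[leRHS]mule1 -(@probability_setT _ _ _ P) -integral_cst//.
  apply: ge0_le_integral => //.
  - by move=> w _; rewrite lee_fin mulr_ge0.
  - by apply: mE; exact: measurable_funM.
  - by move=> w _; rewrite lee_fin expr2; have /andP[? ?] := hB (X i w); apply: ler_pM.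
pose g w := ((n^-1 * Sm w - e) ^+ 2)%R.
have mg : measurable_fun setT g.
  apply: measurable_funX; apply: measurable_funB => //.
  by apply: measurable_funM.
have -> : [set w | (delta <= `|n^-1 * (\sum_(j in S) h (X j w)) - e|)%R] =
          [set w | (delta ^+ 2 <= g w)%R].
  apply/seteqP; split => w /=; rewrite /g -/(Sm w).
    by move=> h1; rewrite -(real_normK (num_real (_ - _))) ler_pXn2r ?nnegrE// ltW.
  by rewrite -(real_normK (num_real (_ - _))) ler_pXn2r ?nnegrE// ltW.
have -> : (B ^+ 2 / (n * delta ^+ 2) = (B ^+ 2 / n) / (delta ^+ 2))%R.
  by rewrite invfM mulrA.
apply: markov_real => //; [by move=> w; exact: sqr_ge0 | by rewrite exprn_gt0|].
(* The expansion of the square, arranged without subtraction. *)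
have : \int[P]_w (g w)%:E + (2 * e ^+ 2)%:E = (n ^- 2)%:E * \int[P]_w ((Sm w) ^+ 2)%:E + (e ^+ 2)%:E.
  have mS2 : measurable_fun setT (fun w => (Sm w) ^+ 2)%R by exact: measurable_funX.
  have cst c : \int[P]_w (cst c%:E w) = c%:E :> \bar R.
    by rewrite (integral_cst P measurableT) [X in _ * X](probability_setT P) mule1.
  have -> : (2 * e ^+ 2)%:E = \int[P]_w ((2 * e / n) * Sm w)%:E.
    under eq_integral do rewrite EFinM.
    rewrite ge0_integralZl//; first last.
    - by rewrite lee_fin divr_ge0 ?mulr_ge0// ltW.
    - by move=> y _; rewrite lee_fin.
    - exact: mE.
    rewrite ES -EFinM; congr EFin; field; exact: lt0r_neq0.
  rewrite -ge0_integralZl//; first last.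
  - by rewrite lee_fin invr_ge0 exprn_ge0// ltW.
  - by move=> y _; rewrite lee_fin sqr_ge0.
  - exact: mE.
  rewrite -[(e ^+ 2)%:E]cst -!ge0_integralD//; first last.
  - by apply: mE; exact: measurable_funM.
  - by move=> y _; rewrite lee_fin mulr_ge0 ?divr_ge0 ?mulr_ge0// ltW.
  - exact: mE.
  - by move=> y _; rewrite lee_fin sqr_ge0.
  - by move=> y _; rewrite lee_fin sqr_ge0.
  - by under eq_fun do rewrite -EFinM; apply: mE; exact: measurable_funM.
  - by move=> y _; rewrite lee_fin mulr_ge0// ?sqr_ge0// invr_ge0 exprn_ge0// ltW.
  apply: eq_integral => w _ /=; rewrite -EFinM -!EFinD; congr EFin.
  by rewrite /g; field; exact: lt0r_neq0.
move=> H.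
rewrite -(leeD2rE (\int[P]_w (g w)%:E) _ (_ : (2 * e ^+ 2)%:E \is a fin_num))// H.
apply: (@le_trans _ _ ((n ^- 2)%:E * (n ^+ 2 * e ^+ 2 + n * B ^+ 2)%:E + (e ^+ 2)%:E)).
  by apply: leeD => //; apply: lee_wpmul2l => //; rewrite lee_fin invr_ge0 exprn_ge0// ltW.
rewrite -EFinM -!EFinD lee_fin; rewrite le_eqVlt; apply/orP; left; apply/eqP; field; exact: lt0r_neq0.
Qed.

(** Approximate [h] in L1 by a simple function [g]: Chebyshev's inequality
    handles the bounded function [g + B], and Markov's inequality the mean of
    [`|h - g|]. The rank [A] comes before the probability space, so that the law
    applies to all the cycles of matrices of all sizes at once. *)
Lemma weak_law (h : T -> R) (delta eta : R) :
  L.-integrable setT (EFin \o h) -> (0 < delta)%R -> (0 < eta)%R ->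
  exists A : nat, forall (K : finType) d' (Om : measurableType d') (P : probability Om R)
    (X : K -> Om -> T) (S : {set K}), iid P X L -> (A <= #|S|)%N ->
    P [set w | (delta <= `| #|S|%:R^-1 * (\sum_(j in S) h (X j w)) - fine 'E_L[h] |)%R] <= eta%:E.
Proof.
move=> ih d0 eta0.
have [g_ [ig _ gh]] := approximation_sfun_integrable measurableT ih.
(* [kappa <= delta / 3] controls the change of the expectation, and
   [kappa <= delta * eta / 6] makes Markov's bound at [delta / 3] at most [eta / 2]. *)
pose kappa : R := (Num.min (delta / 3) (delta * eta / 6))%R.
have k0 : (0 < kappa)%R.
  by rewrite lt_min divr_gt0//= divr_gt0// mulr_gt0.
have mh : measurable_fun setT h by apply/measurable_EFinP; exact: measurable_int ih.
have [n hn] : exists n, \int[L]_z `|(h z)%:E - (g_ n z)%:E| <= kappa%:E.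
  have /fine_cvgP[fn] := gh.
  move=> /cvgrPdist_le /(_ _ k0) cv; near \oo => n; exists n.
  have : (`|0 - fine (\int[L]_z `|(h z)%:E - (g_ n z)%:E|)| <= kappa)%R by near: n.
  have f1 : \int[L]_z `|(h z)%:E - (g_ n z)%:E| \is a fin_num by near: n.
  rewrite sub0r normrN ger0_norm; first by rewrite -lee_fin fineK.
  by apply: fine_ge0; apply: integral_ge0.
have ign := ig n; set g := g_ n in hn ign *.
have [B B0 gB] : exists2 B : R, (0 < B)%R & forall x, (`|g x| <= B)%R.
  have [b [_ bg]] := simple_bounded g; exists (`|b| + 1)%R; first by rewrite ltr_wpDl.
  by move=> x; apply: bg => //; rewrite ltr_pwDr// ler_norm.
pose h1 x := (g x + B)%R.
have mg : measurable_fun setT g by [].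
have mh1 : measurable_fun setT h1 by exact: measurable_funD.
have h1B x : (0 <= h1 x <= 2 * B)%R.
  by have := gB x; rewrite ler_norml /h1 => /andP[? ?]; apply/andP; split; lra.
pose e1 := fine (\int[L]_x (h1 x)%:E).
have he1 : \int[L]_x (h1 x)%:E = e1%:E.
  rewrite fineK// ge0_fin_numE; last first.
    by apply: integral_ge0 => x _; rewrite lee_fin; case/andP: (h1B x).
  apply: (@le_lt_trans _ _ (\int[L]_x (cst (2 * B)%:E x))).
    apply: ge0_le_integral => //.
    - by move=> x _; rewrite lee_fin; case/andP: (h1B x).
    - exact/measurable_EFinP.
    - by move=> x _; rewrite lee_fin; case/andP: (h1B x).
  by rewrite (integral_cst L measurableT) [X in _ * X](probability_setT L) mule1 ltry.
pose k x : R := `|h x - g x|%R.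
have mk : measurable_fun setT k.
  by apply: measurableT_comp => //; apply: measurable_funB.
have kI : \int[L]_x (k x)%:E <= kappa%:E.
  by apply: le_trans hn; rewrite le_eqVlt; apply/orP; left; apply/eqP; apply: eq_integral => x _.
have eh : (`|fine 'E_L[h] - (e1 - B)| <= kappa)%R.
  have iB : L.-integrable setT (EFin \o cst B) by exact: finite_measure_integrable_cst.
  have -> : (e1 - B = \int[L]_x g x)%R.
    rewrite /e1 -/(Rintegral L setT h1) /h1 (RintegralD measurableT ign iB).
    by rewrite Rintegral_cst// [X in fine X](probability_setT L) mulr1 addrK.
  rewrite unlock -/(Rintegral L setT h) -(RintegralB measurableT ih ign).
  have ihg : L.-integrable setT (EFin \o (fun x => h x - g x)%R).
    by have := integrableB measurableT ih ign.
  apply: (le_trans (le_normr_Rintegral measurableT ihg)).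
  rewrite -lee_fin /Rintegral fineK//.
  rewrite ge0_fin_numE; first exact: le_lt_trans kI (ltry _).
  by apply: integral_ge0 => x _; rewrite lee_fin.
(* The rank from which Chebyshev's bound at [delta / 3] is at most [eta / 2]. *)
pose A := (Num.truncn ((2 * B) ^+ 2 * 18 / (delta ^+ 2 * eta))%R).+1.
exists A => K d' Om P X S Xiid AS.
have S0 : (0 < #|S|)%N by exact: leq_trans AS.
have [Xlaw _] := Xiid.
have mX i : measurable_fun setT (X i) by have [] := Xlaw i.
have d3 : (0 < delta / 3)%R by rewrite divr_gt0.
have b1 := weak_law_bounded Xiid S0 mh1 h1B d3 he1.
pose km w : R := (#|S|%:R^-1 * \sum_(j in S) k (X j w))%R.
have mkX j : measurable_fun setT (fun w => k (X j w)) by exact: measurableT_comp.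
have mkm : measurable_fun setT km.
  apply: measurable_funM => //.
  by under eq_fun do rewrite -big_enum /=; exact: measurable_sum.
have km0 w : (0 <= km w)%R by rewrite mulr_ge0 ?invr_ge0// sumr_ge0// => j _; exact: normr_ge0.
have b2 : P [set w | (delta / 3 <= km w)%R] <= (kappa / (delta / 3))%:E.
  apply: markov_real => //.
  rewrite /km; under eq_integral do rewrite EFinM -sumEFin.
  rewrite ge0_integralZl//; first last.
  - by move=> w _; apply: sume_ge0 => j _; rewrite lee_fin normr_ge0.
  - by apply: measurable_fin_sum => j; exact/measurable_EFinP.
  rewrite integral_fin_sum; first last.
  - by move=> j w; rewrite lee_fin normr_ge0.
  - by move=> j; exact/measurable_EFinP.
  rewrite lee_pdivrMl ?ltr0n//.
  apply: (@le_trans _ _ (\sum_(j in S) kappa%:E)).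
    apply: lee_sum => j _; apply: le_trans kI; rewrite (has_law_integral (f := EFin \o k) (Xlaw j))//.
      exact/measurable_EFinP.
    by move=> x; rewrite lee_fin normr_ge0.
  by rewrite sumEFin sumr_const -EFinM mulr_natl.
have m1 : measurable [set w | (delta / 3 <= `| #|S|%:R^-1 * (\sum_(j in S) h1 (X j w)) - e1 |)%R].
  apply: ge_set_measurable; apply: measurableT_comp => //.
  apply: measurable_funB => //; apply: measurable_funM => //.
  under eq_fun do rewrite -big_enum /=; apply: measurable_sum => j.
  exact: measurableT_comp.
have m2 : measurable [set w | (delta / 3 <= km w)%R] by exact: ge_set_measurable.
have m3 : measurable [set w | (delta <= `| #|S|%:R^-1 * (\sum_(j in S) h (X j w)) - fine 'E_L[h] |)%R].
  apply: ge_set_measurable; apply: measurableT_comp => //.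
  apply: measurable_funB => //; apply: measurable_funM => //.
  under eq_fun do rewrite -big_enum /=; apply: measurable_sum => j.
  exact: measurableT_comp.
apply: (@le_trans _ _ (P ([set w | (delta / 3 <= `| #|S|%:R^-1 * (\sum_(j in S) h1 (X j w)) - e1 |)%R] `|`
   [set w | (delta / 3 <= km w)%R]))).
  apply: le_measure; rewrite ?inE//; first exact: measurableU.
  move=> w /=; apply: contraPP => /not_orP[] /negP; rewrite -ltNge => l1 /negP; rewrite -ltNge => l2.
  apply/negP; rewrite -ltNge.
  have n1 : (#|S|%:R^-1 * #|S|%:R = 1 :> R)%R by rewrite mulVf// pnatr_eq0 -lt0n.
  have -> : (#|S|%:R^-1 * (\sum_(j in S) h (X j w)) - fine 'E_L[h] =
    (#|S|%:R^-1 * (\sum_(j in S) h1 (X j w)) - e1) +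
    #|S|%:R^-1 * (\sum_(j in S) (h (X j w) - g (X j w))) - (fine 'E_L[h] - (e1 - B)))%R.
    rewrite sumrB big_split /= sumr_const -[(B *+ _)%R]mulr_natr !mulrDr mulrN.
    rewrite (mulrCA _ B) n1; ring.
  have kd : (kappa <= delta / 3)%R by rewrite ge_min lexx.
  have l3 : (`|#|S|%:R^-1 * (\sum_(j in S) (h (X j w) - g (X j w)))| <= km w)%R.
    rewrite normrM ger0_norm ?invr_ge0//; apply: ler_wpM2l; first by rewrite invr_ge0.
    exact: ler_norm_sum.
  apply: (le_lt_trans (ler_normB _ _)); apply: (le_lt_trans (lerD (ler_normD _ _) eh)).
  lra.
apply: le_trans (measureU2 _ _ _) _ => //.
apply: (le_trans (leeD b1 b2)); rewrite -EFinD lee_fin.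
have kd : (kappa <= delta * eta / 6)%R by rewrite ge_min lexx orbT.
have nA : ((2 * B) ^+ 2 * 18 / (delta ^+ 2 * eta) <= #|S|%:R)%R.
  by apply: ltW; apply: lt_le_trans (truncnS_gt _) _; rewrite ler_nat.
have n0 : (0 < #|S|%:R :> R)%R by rewrite ltr0n.
have -> : eta = (eta / 2 + eta / 2)%R by rewrite -splitr.
apply: lerD.
  rewrite ler_pdivrMr; last by rewrite mulr_gt0// exprn_gt0.
  move: nA; rewrite ler_pdivrMr; last by rewrite mulr_gt0// exprn_gt0.
  move=> nA; apply: (@le_trans _ _ (((#|S|%:R * (delta ^+ 2 * eta)) / 18)%R)).
    by rewrite ler_pdivlMr.
  by rewrite le_eqVlt; apply/orP; left; apply/eqP; field.
rewrite ler_pdivrMr//; apply: (le_trans kd).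
by rewrite le_eqVlt; apply/orP; left; apply/eqP; field.
Unshelve. all: by end_near.
Qed.

End weak_law.

(** * Riemann sums on circles *)

Section uniform_continuity.
Context (R : realType).

Lemma uniform_on_compact_rows n (K : set 'rV[R]_n) (G : 'rV[R]_n -> R) (eps : R) :
  compact K -> continuous G -> 0 < eps ->
  exists2 eta : R, 0 < eta & forall u u' : 'rV[R]_n, K u ->
    (forall i, `|u 0 i - u' 0 i| < eta) -> `|G u - G u'| < eps.
Proof.
move=> /compact_near_coveringP cK cG e0.
pose Q (eta : R) (u : 'rV[R]_n) := forall u' : 'rV[R]_n,
  (forall i, `|u 0 i - u' 0 i| < eta) -> `|G u - G u'| < eps.
have /(_ _) H := cK _ (0^'+ : set_system R) Q _.
suff : \forall eta \near (0^'+ : set_system R), K `<=` Q eta.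
  move=> h; near (0 : R)^'+ => eta.
  have e1 : 0 < eta by [].
  have e2 : K `<=` Q eta by near: eta.
  by exists eta => // u u' Ku uu'; exact: (e2 u Ku u').
apply: H => u0 _.
have e2 : 0 < eps / 2 by rewrite divr_gt0.
have /cvgrPdist_lt/(_ _ e2)/nbhs_ballP[e /= e_gt0 he] := cG u0.
have h2 : 0 < e / 2 by rewrite divr_gt0.
near=> u eta => u' uu'.
have eta_e : eta < e / 2 by near: eta; apply: nbhs_right_lt.
have u0u : ball u0 (e / 2) u by near: u; exact: nbhsx_ballx.
have b1 : ball u0 e u.
  apply: le_ball u0u; rewrite ler_pdivrMr// ler_pMr//.
  by rewrite ler1n.
have b2 : ball u0 e u'.
  case: u0u => _ u0u; split => // i j; rewrite ord1.
  have := u0u 0 j; rewrite -!ball_normE /= => h.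
  rewrite -(subrK (u 0 j) (u0 0 j)) -addrA.
  apply: (le_lt_trans (ler_normD _ _)); rewrite (splitr e); apply: ltrD => //.
  exact: lt_trans (uu' j) _.
have := he _ b1; have := he _ b2 => /= h3 h4.
rewrite -(subrK (G u0) (G u)) -addrA (splitr eps).
by apply: (le_lt_trans (ler_normD _ _)); apply: ltrD; rewrite // distrC.
Unshelve. all: by end_near.
Qed.

(** Closeness is measured on polar coordinates, in which the arcs of the circle
    are intervals; the second point may fall slightly outside the annulus. *)
Definition polar_close (r eta : R) (x y : R[i]) :=
  exists rho rho' t t', [/\ r / 2 <= rho <= 2 * r, 0 <= t <= 2 * pi,
    `|rho - rho'| < eta, `|t - t'| < eta & x = polar rho t /\ y = polar rho' t'].

(** Uniform continuity, on the compact box of the polar coordinates. *)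
Lemma uniform_on_annulus q (f : 'rV[R[i]]_q -> R) (r eps : R) :
  continuous f -> 0 < eps ->
  exists2 eta : R, 0 < eta & forall v v' : 'rV[R[i]]_q,
    (forall k, polar_close r eta (v 0 k) (v' 0 k)) -> `|f v - f v'| < eps.
Proof.
move=> cf e0.
pose phi (u : 'rV[R]_(q + q)) : 'rV[R[i]]_q :=
  \row_k polar (u 0 (lshift q k)) (u 0 (rshift q k)).
have cphi : continuous phi.
  move=> u A [B uB BA].
  have h k : \forall x \near u, B 0 k (phi x 0 k).
    have := uB 0 k; rewrite mxE => hB.
    have c := polar_continuous (@coord_continuous _ 1 (q + q) 0 (lshift q k) u)
      (@coord_continuous _ 1 (q + q) 0 (rshift q k) u).
    by apply: (@filterS _ (nbhs u) _ _ _ _ (c _ hB)) => x /=; rewrite mxE.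
  have H := filter_forall (nbhs_filter u) h.
  by move: H; apply: (@filterS _ (nbhs u)) => x hx; apply: BA => i j; rewrite ord1; exact: hx.
pose S (i : 'I_(q + q)) : set R :=
  if fintype.split i is inl _ then `[r / 2, 2 * r]%classic else `[0, 2 * pi]%classic.
have cS i : compact (S i) by rewrite /S; case: fintype.split => _; exact: segment_compact.
have [eta eta0 H] := @uniform_on_compact_rows _ _ (f \o phi) _ (rV_compact cS)
  (fun x => continuous_comp (cphi x) (cf _)) e0.
exists eta => // v v' vv'.
have /choice[w hw] := vv'.
have /choice[w1 hw1] := hw.
have /choice[w2 hw2] := hw1.
have /choice[w3 hw3] := hw2.
pose U (a b : 'I_q -> R) : 'rV[R]_(q + q) :=
  \row_i (match fintype.split i with inl k => a k | inr k => b k end).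
have UE a b (x : 'rV[R[i]]_q) : (forall k, x 0 k = polar (a k) (b k)) -> x = phi (U a b).
  move=> xE; apply/rowP => k; rewrite xE !mxE; congr (polar _ _).
    by rewrite (unsplitK (inl k)).
  by rewrite (unsplitK (inr k)).
have -> : v = phi (U w w2) by apply: UE => k; have [_ _ _ _ []] := hw3 k.
have -> : v' = phi (U w1 w3) by apply: UE => k; have [_ _ _ _ []] := hw3 k.
apply: (H (U w w2) (U w1 w3)).
  move=> i; rewrite /S mxE; case: fintype.split => k; have [h1 h2 _ _ _] := hw3 k.
    by rewrite /= in_itv.
  by rewrite /= in_itv.
by move=> i; rewrite !mxE; case: fintype.split => k; have [] := hw3 k.
Qed.

Lemma half_double (r : R) : 0 < r -> r / 2 <= r <= 2 * r.
Proof. by move=> r0; apply/andP; split; lra. Qed.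

End uniform_continuity.

Section arcs.
Context (R : realType).
Local Open Scope ereal_scope.
Local Notation mu := (@lebesgue_measure R).

Lemma integral_arcs (h : measurableTypeR R -> \bar R) (d : R) (k : nat) :
  (0 <= d)%R -> measurable_fun setT h -> (forall t, 0 <= h t) ->
  \int[mu]_(t in `]0%R, (k%:R * d)%R]) h t =
  \sum_(l < k) \int[mu]_(t in `](l%:R * d)%R, (l.+1%:R * d)%R]) h t.
Proof.
move=> d0 mh h0; elim: k => [|k IH].
  by rewrite big_ord0 mul0r set_itvoc0 integral_set0.
rewrite big_ord_recr /= -IH -ge0_integral_setU//=.
- congr (integral _ _ _); apply/seteqP; split => t /=; rewrite !in_itv /=.
    by case: (leP t (k%:R * d)%R) => h1 /andP[-> ->]; [left|right].
  have kd : (0 <= k%:R * d)%R by rewrite mulr_ge0.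
  have kd1 : (k%:R * d <= k.+1%:R * d)%R by rewrite ler_wpM2r// ler_nat.
  by case=> /andP[h1 h2]; apply/andP; split => //; [exact: le_trans kd1|exact: le_lt_trans h1].
- exact: measurable_funTS.
- rewrite disj_set2E; apply/eqP/seteqP; split => // t [] /=; rewrite !in_itv /=.
  by move=> /andP[_ h1] /andP[h2 _]; move: (lt_le_trans h2 h1); rewrite ltxx.
Qed.

Variables (r eta eps : R).
Hypotheses (r0 : (0 < r)%R) (eta0 : (0 < eta)%R) (eps0 : (0 <= eps)%R).

Definition oscillates (g : R[i] -> \bar R) := forall x y, polar_close r eta x y ->
  g x <= g y + eps%:E /\ g y <= g x + eps%:E.

Let pi20 : (0 < 2 * pi :> R)%R.
Proof. by rewrite mulr_gt0// pi_gt0. Qed.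

Lemma circle_close t : (0 <= t <= 2 * pi)%R -> polar_close r eta (polar r t) (polar r t).
Proof.
move=> ht; exists r, r, t, t; rewrite !subrr normr0; split => //.
exact: half_double.
Qed.

(** The circle is cut into arcs of length [2 * pi / k]; the [l]-th one is within
    [eta] of the [l]-th root, in both polar coordinates. *)
Lemma roots_mean (g : borel R[i] -> \bar R) (k : nat) (T : R[i]) :
  measurable_fun setT g -> (forall x, 0 <= g x) -> oscillates g ->
  (0 < k)%N -> (2 * pi / k%:R < eta)%R ->
  (`|r - expR (log_modulus T / k%:R)| < eta)%R ->
  \sum_(l < k) g (croot k T l) <= k%:R%:E * (\int[uniform_circle r]_x g x + eps%:E) /\
  k%:R%:E * \int[uniform_circle r]_x g x <= \sum_(l < k) g (croot k T l) + (k%:R * eps)%:E.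
Proof.
move=> mg g0 og k0 dk rk; set d : R := (2 * pi / k%:R)%R in dk.
have kR : (0 < k%:R :> R)%R by rewrite ltr0n.
have d0 : (0 < d)%R by rewrite divr_gt0.
pose h (t : measurableTypeR R) := g (polar r t).
have mh : measurable_fun setT h.
  by apply: (measurableT_comp mg); exact: polar_measurable.
have h0 t : 0 <= h t by exact: g0.
have Wk : \int[uniform_circle r]_x g x =
    ((2 * pi)^-1)%:E * \sum_(l < k) \int[mu]_(t in `](l%:R * d)%R, (l.+1%:R * d)%R]) h t.
  rewrite integral_uniform_circle// -integral_arcs// ?ltW//.
  have -> : (k%:R * d = 2 * pi)%R by rewrite /d mulrC divfK// gt_eqF.
  rewrite integral_itv_obnd_cbnd//; exact: measurable_funTS.
have arc_close (l : 'I_k) t : (l%:R * d < t <= l.+1%:R * d)%R ->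
    polar_close r eta (polar r t) (croot k T l).
  move=> /andP[t1 t2].
  have lk : (l.+1%:R * d <= 2 * pi)%R.
    apply: (@le_trans _ _ (k%:R * d)%R); first by apply: ler_wpM2r; [exact: ltW|rewrite ler_nat].
    by rewrite /d mulrC divfK// gt_eqF.
  have [a0 a1] := andP (arg_range T).
  exists r, (expR (log_modulus T / k%:R)), t, ((arg T + 2 * pi * l%:R) / k%:R)%R; split => //.
  - exact: half_double.
  - by rewrite (le_trans t2 lk) andbT ltW// (le_lt_trans _ t1)// mulr_ge0// ltW.
  - have -> : ((arg T + 2 * pi * l%:R) / k%:R = arg T / k%:R + l%:R * d)%R.
      by rewrite mulrDl /d; congr (_ + _)%R; ring.
    have b0 : (0 <= arg T / k%:R)%R by rewrite divr_ge0.
    have b1 : (arg T / k%:R <= d)%R by rewrite ler_pM2r ?invr_gt0// ltW.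
    move: t2; rewrite -[l.+1]addn1 natrD mulrDl mul1r => t2.
    apply: le_lt_trans dk; rewrite ler_norml; apply/andP; split; lra.
have arc_len (l : 'I_k) : mu (`](l%:R * d)%R, (l.+1%:R * d)%R]) = d%:E.
  rewrite lebesgue_measure_itv /= lte_fin ltr_pM2r// ltr_nat ltnSn -EFinB.
  by rewrite -mulrBl -natrB// subSnn mul1r.
have marc (l : 'I_k) : measurable_fun `](l%:R * d)%R, (l.+1%:R * d)%R] h.
  exact: measurable_funTS.
have cstI (c : \bar R) (l : 'I_k) :
    \int[mu]_(t in `](l%:R * d)%R, (l.+1%:R * d)%R]) cst c t = d%:E * c.
  by rewrite muleC -(arc_len l) integral_cst.
have epsI (l : 'I_k) :
    (d * eps)%:E = \int[mu]_(t in `](l%:R * d)%R, (l.+1%:R * d)%R]) cst eps%:E t.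
  by rewrite cstI EFinM.
have up (l : 'I_k) : d%:E * g (croot k T l) <=
    \int[mu]_(t in `](l%:R * d)%R, (l.+1%:R * d)%R]) h t + (d * eps)%:E.
  rewrite -(cstI _ l) (epsI l) -ge0_integralD//; last exact: marc.
  apply: ge0_le_integral => //.
  - by move=> t _; exact: g0.
  - by apply: emeasurable_funD; [exact: marc|].
  - move=> t; rewrite /= in_itv /= => ht.
    by have [_] := og _ _ (arc_close l t ht).
have low (l : 'I_k) : \int[mu]_(t in `](l%:R * d)%R, (l.+1%:R * d)%R]) h t <=
    d%:E * g (croot k T l) + (d * eps)%:E.
  rewrite -(cstI _ l) (epsI l) -ge0_integralD//; last by move=> t _; exact: g0.
  apply: ge0_le_integral => //.
  - exact: marc.
  - exact: emeasurable_funD.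
  - move=> t; rewrite /= in_itv /= => ht.
    by have [] := og _ _ (arc_close l t ht).
have kd : (k%:R = 2 * pi / d)%R by rewrite /d invf_div mulrCA divff ?mulr1// gt_eqF.
have I0 l : 0 <= \int[mu]_(t in `](l%:R * d)%R, (l.+1%:R * d)%R]) h t.
  by apply: integral_ge0.
have S0 : 0 <= \sum_(l < k) \int[mu]_(t in `](l%:R * d)%R, (l.+1%:R * d)%R]) h t.
  by apply: sume_ge0.
have di : (d^-1 * d = 1)%R by rewrite mulVf// gt_eqF.
have Seps : \sum_(l < k) (d * eps)%:E = (2 * pi * eps)%:E.
  by rewrite sumEFin sumr_const card_ord -[(_ *+ k)%R]mulr_natl mulrA /d mulrCA divff ?mulr1 ?gt_eqF.
set W := \sum_(l < k) \int[mu]_(t in _) _ in Wk S0.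
set S := \sum_(l < k) g (croot k T l).
have H1 : d%:E * S <= W + (2 * pi * eps)%:E.
  by rewrite ge0_sume_distrr// -Seps -big_split; apply: lee_sum => l _; exact: up.
have H2 : W <= d%:E * S + (2 * pi * eps)%:E.
  by rewrite ge0_sume_distrr// -Seps -big_split; apply: lee_sum => l _; exact: low.
have di0 : 0 <= (d^-1)%:E by rewrite lee_fin invr_ge0 ltW.
have pe0 : 0 <= (2 * pi * eps)%:E by rewrite lee_fin mulr_ge0// ltW.
have kpi : (k%:R / (2 * pi) = d^-1 :> R)%R.
  by rewrite /d invf_div.
have kIE : k%:R%:E * \int[uniform_circle r]_x g x = (d^-1)%:E * W.
  by rewrite Wk muleA -EFinM kpi.
have SE : S = (d^-1)%:E * (d%:E * S) by rewrite muleA -EFinM di mul1e.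
have epsE : (k%:R * eps)%:E = (d^-1)%:E * (2 * pi * eps)%:E.
  by rewrite -EFinM kd; congr EFin; rewrite mulrCA mulrA mulrAC.
have I1 : 0 <= \int[uniform_circle r]_x g x.
  by rewrite Wk mule_ge0// lee_fin invr_ge0 ltW.
split.
- rewrite ge0_muleDr// -EFinM kIE epsE -ge0_muleDr//.
  by rewrite [leLHS]SE; exact: lee_wpmul2l.
- rewrite kIE epsE [X in _ <= X + _]SE -ge0_muleDr//.
    exact: lee_wpmul2l.
  by rewrite mule_ge0 ?sume_ge0// lee_fin ltW.
Qed.

End arcs.

Section cycle_sums.
Context (R : realType).

Lemma sum_over_cycles (V : nmodType) (T : finType) (s : {perm T}) (p : pred {set T})
    (F : {set T} -> nat -> V) :
  \sum_(i | p (porbit s i)) F (porbit s i) (cycle_pos s i) =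
  \sum_(C in porbits s | p C) \sum_(l < #|C|) F C l.
Proof.
rewrite (partition_big (porbit s) (fun C => (C \in porbits s) && p C)) /=; last first.
  by move=> i pi; rewrite pi andbT; apply/imsetP; exists i.
apply: eq_bigr => C /andP[/imsetP[i0 _ ->] pC].
rewrite -(big_cycle_pos s _ i0 (F (porbit s i0))).
apply: eq_big => [i|i /andP[_ /eqP ->]//].
by rewrite eq_porbit_mem; apply: andb_idl; rewrite -eq_porbit_mem => /eqP ->.
Qed.

Local Open Scope ereal_scope.

Variables (r eta eps : R).
Hypotheses (r0 : (0 < r)%R) (eta0 : (0 < eta)%R) (eps0 : (0 <= eps)%R).

Variables (I : finType) (p : pred I) (om : I -> R[i]).
Local Notation n := (#|[pred i | p i]|%:R : R).

(** Riemann sums over the points [om i] with [p i] approach the mean on the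
    circle, for all functions that oscillate little at scale [eta]; the first
    condition places the points in the annulus. *)
Definition equidistributed :=
  (forall i, p i -> polar_close r eta (om i) (om i)) /\
  forall g : borel R[i] -> \bar R, measurable_fun setT g -> (forall x, 0 <= g x) ->
    oscillates r eta eps g ->
    \sum_(i | p i) g (om i) <= n%:E * (\int[uniform_circle r]_x g x + eps%:E) /\
    n%:E * \int[uniform_circle r]_x g x <= \sum_(i | p i) g (om i) + (n * eps)%:E.

Lemma sum_ffunS q (f : 'rV[R[i]]_q.+1 -> \bar R) :
  \sum_(j : {ffun 'I_q.+1 -> I} | [forall k, p (j k)]) f (\row_k om (j k)) =
  \sum_(i | p i) \sum_(j : {ffun 'I_q -> I} | [forall k, p (j k)])
    f (rowcons (om i) (\row_k om (j k))).
Proof.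
rewrite pair_big /=.
pose h (ij : I * {ffun 'I_q -> I}) : {ffun 'I_q.+1 -> I} :=
  [ffun k => if unlift ord0 k is Some l then ij.2 l else ij.1].
have h0 ij : h ij ord0 = ij.1 by rewrite ffunE unlift_none.
have hS ij l : h ij (lift ord0 l) = ij.2 l by rewrite ffunE liftK.
rewrite (reindex h); last first.
  exists (fun j : {ffun 'I_q.+1 -> I} => (j ord0, [ffun l => j (lift ord0 l)])).
    move=> [i j] _; congr pair; first by rewrite h0.
    by apply/ffunP => l; rewrite ffunE hS.
  move=> j _; apply/ffunP => k; case: (unliftP ord0 k) => [l|] ->.
    by rewrite hS ffunE.
  by rewrite h0.
apply: eq_big => [[i j]|[i j] _].
  apply/forallP/andP => [H|[pi /forallP pj] k].
    split; first by have := H ord0; rewrite h0.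
    by apply/forallP => l; have := H (lift ord0 l); rewrite hS.
  by case: (unliftP ord0 k) => [l|] ->; rewrite ?h0 ?hS.
congr f; apply/rowP => k; rewrite mxE.
by case: (unliftP ord0 k) => [l|] ->; rewrite ?h0 ?hS ?rowcons0 ?rowconsS ?mxE.
Qed.

Definition row_oscillates q (f : 'rV[R[i]]_q -> \bar R) := forall v v' : 'rV[R[i]]_q,
  (forall k, polar_close r eta (v 0%R k) (v' 0%R k)) ->
  f v <= f v' + eps%:E /\ f v' <= f v + eps%:E.

(** Induction on the number of coordinates, the first one being frozen: the mean
    over the other coordinates oscillates as little as [f] in the first one. *)
Lemma equidistributed_tuples q (f : borel 'rV[R[i]]_q -> \bar R) :
  equidistributed -> measurable_fun setT f -> (forall v, 0 <= f v) -> row_oscillates f ->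
  let S := \sum_(j : {ffun 'I_q -> I} | [forall k, p (j k)]) f (\row_k om (j k)) in
  S <= (n ^+ q)%:E * (circle_mean r f + (q%:R * eps)%:E) /\
  (n ^+ q)%:E * circle_mean r f <= S + (n ^+ q * (q%:R * eps))%:E.
Proof.
move=> [cl eq1]; elim: q f => [|q IH] f mf f0 of_ S.
  have -> : S = f 0%R.
    rewrite /S (big_pred1 (ffun0 (card_ord 0))) => [|j]; last first.
      rewrite /=.
      have -> : [forall k, p (j k)] by apply/forallP => -[].
      by apply/esym/eqP/ffunP => -[].
    by congr f; apply/rowP => -[].
  by rewrite expr0 mul0r adde0 /= mulr0 adde0 mul1e.
rewrite {}/S sum_ffunS.
have n0 : (0 <= n)%R by rewrite ler0n.
have nq0 : (0 <= n ^+ q)%R by rewrite exprn_ge0.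
have qe0 : (0 <= q%:R * eps)%R by rewrite mulr_ge0.
pose g (x : borel R[i]) := circle_mean r (fun v : 'rV[R[i]]_q => f (rowcons x v)).
have g0 x : 0 <= g x by apply: circle_mean_ge0 => v; exact: f0.
have mg : measurable_fun setT g by exact: circle_mean_measurable.
have mfx x : measurable_fun setT (fun v : borel 'rV[R[i]]_q => f (rowcons x v)).
  exact: (measurableT_comp mf (rowcons_measurable x)).
have og : oscillates r eta eps g.
  move=> x y xy.
  have H (v : 'rV[R[i]]_q) : (forall k, exists2 t, (0 <= t <= 2 * pi)%R & v 0%R k = polar r t) ->
      f (rowcons x v) <= f (rowcons y v) + eps%:E /\
      f (rowcons y v) <= f (rowcons x v) + eps%:E.
    move=> hv; apply: of_ => k; case: (unliftP ord0 k) => [l|] ->.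
      by rewrite !rowconsS; have [t ht ->] := hv l; exact: circle_close.
    by rewrite !rowcons0.
  by split; apply: circle_mean_le => // v hv; have [] := H v hv.
have [up low] := eq1 g mg g0 og.
have IHi i : p i ->
    let Si := \sum_(j : {ffun 'I_q -> I} | [forall k, p (j k)])
      f (rowcons (om i) (\row_k om (j k))) in
    Si <= (n ^+ q)%:E * (g (om i) + (q%:R * eps)%:E) /\
    (n ^+ q)%:E * g (om i) <= Si + (n ^+ q * (q%:R * eps))%:E.
  move=> pi; apply: (IH (fun v => f (rowcons (om i) v))) => // v v' vv'.
  by apply: of_ => k; case: (unliftP ord0 k) => [l|] ->; rewrite ?rowconsS ?rowcons0//; exact: cl.
have sumc c : \sum_(i | p i) c%:E = (n * c)%:E by rewrite sumEFin sumr_const mulr_natl.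
have Ig0 : 0 <= \int[uniform_circle r]_x g x by exact: (circle_mean_ge0 r (f := f)).
have Sg0 : 0 <= \sum_(i | p i) g (om i) by apply: sume_ge0.
rewrite -[circle_mean r f]/(\int[uniform_circle r]_x g x).
have q1 : (q.+1%:R * eps = eps + q%:R * eps)%R by rewrite -natr1 mulrDl mul1r addrC.
split.
- apply: (@le_trans _ _ (\sum_(i | p i) (n ^+ q)%:E * (g (om i) + (q%:R * eps)%:E))).
    by apply: lee_sum => i pi; have [] := IHi i pi.
  rewrite -ge0_sume_distrr; last by move=> i _; rewrite adde_ge0.
  rewrite [X in _ * X](big_split _ _ _ (fun i => g (om i))) /= sumc.
  rewrite [in leRHS]exprSr [in leRHS]EFinM -muleA; apply: lee_wpmul2l; first by rewrite lee_fin.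
  have e0e : 0 <= eps%:E by rewrite lee_fin.
  have qee : 0 <= (q%:R * eps)%:E by rewrite lee_fin.
  rewrite q1 EFinD addeA (ge0_muleDr _ (adde_ge0 Ig0 e0e) qee).
  by apply: leeD; rewrite // EFinM.
- rewrite exprSr EFinM -muleA.
  apply: (le_trans (lee_wpmul2l _ low)); first by rewrite lee_fin.
  rewrite ge0_muleDr ?lee_fin ?mulr_ge0//.
  have -> : (n ^+ q * n * (q.+1%:R * eps) = n * (n ^+ q * (q%:R * eps)) + n ^+ q * (n * eps))%R.
    by rewrite q1; ring.
  rewrite EFinD addeA -EFinM; apply: leeD => //.
  rewrite ge0_sume_distrr// -sumc -big_split /=.
  by apply: lee_sum => i pi; have [] := IHi i pi.
Qed.

End cycle_sums.

(** * Convergence of the normalized measures *)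

Section good_cycles.
Context (R : realType) (N : nat).
Implicit Types (s : 'S_N) (z : 'I_N -> R[i]).

Definition good_cycle (m delta : R) (A : nat) z (C : {set 'I_N}) :=
  (A <= #|C|)%N && (`|m - log_modulus (\prod_(k in C) z k) / #|C|%:R| < delta).

Local Open Scope ereal_scope.

(** The points on a good cycle are the roots of one number, with modulus near
    [expR m] because the mean of the log-moduli is near [m]. *)
Lemma good_cycles_equidistributed (m delta eta eps : R) (A : nat) s z :
  (0 < eta)%R -> (0 <= eps)%R -> (eta <= expR m / 2)%R -> (0 < A)%N -> (2 * pi / A%:R < eta)%R ->
  (forall x, `|m - x| < delta -> `|expR m - expR x| < eta)%R ->
  equidistributed (expR m) eta eps (fun i => good_cycle m delta A z (porbit s i))
    (perm_eigen s z).
Proof.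
move=> eta0 eps0 eta_r A0 Aeta cexp; have r0 := expR_gt0 m.
have pi20 : (0 < 2 * pi :> R)%R by rewrite mulr_gt0// pi_gt0.
split.
- move=> i /andP[_ /cexp H].
  have [a0 a1] := andP (arg_range (\prod_(k in porbit s i) z k)%R).
  have C0 : (0 < #|porbit s i|%:R :> R)%R by rewrite ltr0n (leq_ltn_trans _ (cycle_pos_lt s i)).
  exists (expR (log_modulus (\prod_(k in porbit s i) z k)%R / #|porbit s i|%:R)).
  exists (expR (log_modulus (\prod_(k in porbit s i) z k)%R / #|porbit s i|%:R)).
  exists ((arg (\prod_(k in porbit s i) z k)%R + 2 * pi * (cycle_pos s i)%:R) / #|porbit s i|%:R)%R.
  exists ((arg (\prod_(k in porbit s i) z k)%R + 2 * pi * (cycle_pos s i)%:R) / #|porbit s i|%:R)%R.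
  rewrite !subrr normr0; split => //.
    move: H; rewrite ltr_norml => /andP[h1 h2]; move: eta_r h1 h2 r0.
    by move: (expR m) (expR _) => x y *; apply/andP; split; lra.
  apply/andP; split; first by rewrite divr_ge0// addr_ge0// mulr_ge0// ltW.
  rewrite ler_pdivrMr//; apply: (@le_trans _ _ (2 * pi * (cycle_pos s i).+1%:R)%R).
    by rewrite -[((cycle_pos s i).+1%:R)%R]natr1 [leRHS]mulrDr [(2 * pi * 1)%R]mulr1 addrC lerD2l ltW.
  by rewrite ler_pM2l// ler_nat cycle_pos_lt.
move=> g mg g0 og.
pose p := good_cycle m delta A z.
have sumE (J : \bar R) : 0 <= J -> #|[pred i | p (porbit s i)]|%:R%:E * J =
    \sum_(C in porbits s | p C) #|C|%:R%:E * J.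
  move=> J0.
  have H (K : finType) (k : pred K) : \sum_(i | k i) J = #|[pred i | k i]|%:R%:E * J.
    rewrite -sum1_card natr_sum -sumEFin ge0_sume_distrl//.
    by apply: eq_bigr => i _; rewrite mul1e.
  rewrite -H (sum_over_cycles s p (fun _ _ => J)).
  by apply: eq_bigr => C _; rewrite H card_ord.
rewrite (sum_over_cycles s p (fun C l => g (croot #|C| (\prod_(k in C) z k)%R l))).
have each (C : {set 'I_N}) : p C ->
   \sum_(l < #|C|) g (croot #|C| (\prod_(k in C) z k)%R l) <=
     #|C|%:R%:E * (\int[uniform_circle (expR m)]_x g x + eps%:E) /\
   #|C|%:R%:E * \int[uniform_circle (expR m)]_x g x <=
     \sum_(l < #|C|) g (croot #|C| (\prod_(k in C) z k)%R l) + (#|C|%:R * eps)%:E.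
  move=> /andP[leAC /cexp H]; have C0 : (0 < #|C|)%N by exact: leq_trans A0 leAC.
  apply: (@roots_mean _ _ eta) => //.
  apply: le_lt_trans Aeta; rewrite ler_pM2l// lef_pV2 ?posrE ?ltr0n ?ler_nat//.
have I0 : 0 <= \int[uniform_circle (expR m)]_x g x.
  by rewrite integral_uniform_circle// mule_ge0 ?integral_ge0// lee_fin invr_ge0 ltW.
have e0 : 0 <= eps%:E by rewrite lee_fin.
split.
  rewrite sumE; last by rewrite adde_ge0.
  by apply: lee_sum => C /andP[_ pC]; have [] := each C pC.
rewrite EFinM !sumE// -big_split /=.
by apply: lee_sum => C /andP[_ pC]; have [_] := each C pC; rewrite EFinM.
Qed.

End good_cycles.

Section tuples_estimate.
Context (R : realType).

Lemma exprn_diff_le (a b : R) q : 0 <= b -> b <= a ->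
  a ^+ q - b ^+ q <= q%:R * a ^+ q.-1 * (a - b).
Proof.
move=> b0 ba; have a0 := le_trans b0 ba; have ab : 0 <= a - b by rewrite subr_ge0.
elim: q => [|q IH]; first by rewrite !expr0 subrr !mul0r.
have -> : a ^+ q.+1 - b ^+ q.+1 = a * (a ^+ q - b ^+ q) + b ^+ q * (a - b).
  by rewrite !exprS; ring.
have -> : q.+1%:R * a ^+ q.+1.-1 * (a - b) = q%:R * a ^+ q * (a - b) + a ^+ q * (a - b).
  by rewrite -natr1 /=; ring.
apply: lerD; last by apply: ler_wpM2r => //; rewrite lerXn2r.
apply: (le_trans (ler_wpM2l a0 IH)).
case: (q) => [|n] /=; first by rewrite !mul0r mulr0.
by rewrite exprS le_eqVlt; apply/orP; left; apply/eqP; ring.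
Qed.

Lemma circle_mean_fin q (r B : R) (f : borel 'rV[R[i]]_q -> R) :
  measurable_fun setT f -> (forall v, 0 <= f v <= B) ->
  exists2 m : R, circle_mean r (EFin \o f) = m%:E & 0 <= m <= B.
Proof.
move=> mf fB; have [nu [_ nu1 nuI]] := product_power_measure r q.
have f0 v : (0 <= (EFin \o f) v)%E by rewrite lee_fin; case/andP: (fB v).
have mE : measurable_fun setT (EFin \o f) by exact/measurable_EFinP.
have I0 : (0 <= circle_mean r (EFin \o f))%E by rewrite -nuI//; exact: integral_ge0.
have IB : (circle_mean r (EFin \o f) <= B%:E)%E.
  rewrite -nuI// -[leRHS]mule1 -nu1 -(integral_cst nu measurableT).
  apply: ge0_le_integral => //.
  - by move=> v _; rewrite lee_fin; case/andP: (fB v).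
exists (fine (circle_mean r (EFin \o f))).
  by rewrite fineK// ge0_fin_numE// (le_lt_trans IB)// ltry.
apply/andP; split; first exact: fine_ge0.
by rewrite -lee_fin fineK// ge0_fin_numE// (le_lt_trans IB)// ltry.
Qed.

(** Sums over distinct tuples and sums over tuples of good points both differ
    from the sum over all tuples by at most [B] for each tuple that is dropped. *)
Lemma tuples_estimate (r eta eps B m : R) (I : finType) (p : pred I) (om : I -> R[i])
    q (f : borel 'rV[R[i]]_q -> R) :
  0 < r -> 0 < eta -> 0 <= eps -> 0 <= B ->
  equidistributed r eta eps p om ->
  measurable_fun setT f -> (forall v, 0 <= f v <= B) ->
  row_oscillates r eta eps (EFin \o f) ->
  circle_mean r (EFin \o f) = m%:E -> 0 <= m <= B ->
  let N : R := #|I|%:R in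
  let b : R := #|[pred i | ~~ p i]|%:R in
  let S := \sum_(j : {ffun 'I_q -> I} | injectiveb j) f (\row_k om (j k)) in
  S <= N ^+ q * (m + q%:R * eps) + B * (q%:R * N ^+ q.-1) * b /\
  N ^+ q * m <= S + B * (N ^+ q - (#|I| ^_ q)%:R) + B * (q%:R * N ^+ q.-1) * b
                + N ^+ q * (q%:R * eps).
Proof.
move=> r0 eta0 eps0 B0 eqd mf fB osc cm /andP[m0 mB] N b S.
have f0 v : 0 <= f v by case/andP: (fB v).
have f_B v : f v <= B by case/andP: (fB v).
have mE : measurable_fun setT (EFin \o f) by exact/measurable_EFinP.
have fE0 v : (0 <= (EFin \o f) v)%E by rewrite lee_fin.
have := @equidistributed_tuples _ _ _ _ r0 eta0 eps0 _ _ _ _ (EFin \o f) eqd mE fE0 osc.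
set n : R := #|[pred i | p i]|%:R; rewrite cm /= sumEFin -!EFinM -!EFinD !lee_fin.
set SG := \sum_(j | _) _; move=> [up low].
have Nb : N = n + b.
  by rewrite /N /n /b -natrD; congr (_%:R); rewrite -[LHS](cardC [pred i | p i]).
have b0 : 0 <= b by rewrite ler0n.
have n0 : 0 <= n by rewrite ler0n.
have nN : n <= N by rewrite Nb lerDl.
have dq : N ^+ q - n ^+ q <= q%:R * N ^+ q.-1 * b.
  by rewrite (_ : b = N - n) ?exprn_diff_le// Nb addrAC subrr add0r.
pose all_p (j : {ffun 'I_q -> I}) := [forall k, p (j k)].
have call : \sum_(j : {ffun 'I_q -> I}) (1 : R) = N ^+ q.
  by rewrite sumr_const card_ffun card_ord natrX.
have cp : \sum_(j : {ffun 'I_q -> I} | all_p j) (1 : R) = n ^+ q.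
  rewrite sumr_const -natrX; congr (_%:R).
  rewrite -[X in (_ ^ X)%N](card_ord q) -card_ffun_on.
  by apply: eq_card => j; rewrite [LHS]unfold_in; apply/forallP/ffun_onP.
have cinj : \sum_(j : {ffun 'I_q -> I} | injectiveb j) (1 : R) = (#|I| ^_ q)%:R.
  by rewrite sumr_const; congr (_%:R); rewrite -[in RHS](card_ord q) -card_inj_ffuns cardsE.
have compl (P : pred {ffun 'I_q -> I}) :
    \sum_(j | ~~ P j) (1 : R) = \sum_(j : {ffun 'I_q -> I}) (1 : R) - \sum_(j | P j) (1 : R).
  by rewrite [X in _ = X - _](bigID P) /= addrAC subrr add0r.
have cnp : \sum_(j : {ffun 'I_q -> I} | ~~ all_p j) (1 : R) = N ^+ q - n ^+ q.
  by rewrite compl call cp.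
have cninj : \sum_(j : {ffun 'I_q -> I} | ~~ injectiveb j) (1 : R) = N ^+ q - (#|I| ^_ q)%:R.
  by rewrite (compl (fun j : {ffun 'I_q -> I} => injectiveb j)) call cinj.
pose A := \sum_(j : {ffun 'I_q -> I}) f (\row_k om (j k)).
have SA : S <= A.
  by rewrite /A (bigID (fun j : {ffun 'I_q -> I} => injectiveb j)) /= lerDl sumr_ge0.
have AS : A <= S + B * (N ^+ q - (#|I| ^_ q)%:R).
  rewrite /A (bigID (fun j : {ffun 'I_q -> I} => injectiveb j)) /= lerD2l -cninj mulr_sumr.
  by apply: ler_sum => j _; rewrite mulr1.
have GA : SG <= A by rewrite /A (bigID all_p) /= lerDl sumr_ge0.
have AG : A <= SG + B * (N ^+ q - n ^+ q).
  rewrite /A (bigID all_p) /= lerD2l -cnp mulr_sumr.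
  by apply: ler_sum => j _; rewrite mulr1.
have nNq : n ^+ q <= N ^+ q by rewrite lerXn2r// nnegrE (le_trans n0).
have qe : 0 <= q%:R * eps by rewrite mulr_ge0.
have Bd := ler_wpM2l B0 dq.
split.
- apply: (le_trans SA); apply: (le_trans AG); apply: lerD; last by rewrite -mulrA.
  by apply: (le_trans up); apply: ler_wpM2r => //; rewrite addr_ge0.
- have h1 : N ^+ q * m <= n ^+ q * m + B * (N ^+ q - n ^+ q).
    rewrite -subr_ge0.
    have -> : n ^+ q * m + B * (N ^+ q - n ^+ q) - N ^+ q * m = (B - m) * (N ^+ q - n ^+ q) by ring.
    by rewrite mulr_ge0// subr_ge0.
  have h2 : n ^+ q * (q%:R * eps) <= N ^+ q * (q%:R * eps) by exact: ler_wpM2r.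
  by rewrite -!mulrA in Bd *; lra.
Qed.

End tuples_estimate.

Section bad_points.
Context (R : realType) (theta : R) (L : probability (borel R[i]) R).
Hypothesis theta0 : 0 < theta.
Hypothesis L0 : L [set (0 : R[i])] = 0%E.
Context (N : nat) d' (Om' : measurableType d') (P' : probability Om' R)
  (s : Om' -> 'S_N) (z : 'I_N -> Om' -> borel R[i]).
Hypothesis s_law : forall t, measurable (s @^-1` [set t]) /\
  P' (s @^-1` [set t]) = (ewens theta t)%:E.
Hypothesis z_law : forall j, has_law P' (z j) L.
Hypothesis sz_indep : mutually_independent P' setT
  (fun i : option 'I_N =>
     if i is Some j then sigma_of (z j) else [set s @^-1` B | B in setT]).

Lemma measurable_bool d (T : measurableType d) (b : bool) : measurable [set _ : T | b].
Proof.
case: b; first by rewrite (_ : [set _ | _] = setT)//; apply/seteqP; split.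
by rewrite (_ : [set _ | _] = set0)//; apply/seteqP; split.
Qed.

Lemma measurable_cases d (Om : measurableType d) (K : finType) (f : Om -> K) (E : K -> set Om) :
  (forall k, measurable (f @^-1` [set k])) -> (forall k, measurable (E k)) ->
  measurable [set w | E (f w) w].
Proof.
move=> mf mE; rewrite (_ : [set w | _] = [set w | forall k, (~` (f @^-1` [set k]) `|` E k) w]).
  by apply: measurable_forall => k; apply: measurableU => //; exact: measurableC.
apply/seteqP; split => w /= h; last by case: (h (f w)).
by move=> k; have [<-|fk] := pselect (f w = k); [right|left].
Qed.

Lemma ewens_event (Q : pred 'S_N) :
  P' [set w | Q (s w)] = (\sum_(t | Q t) ewens theta t)%:E.
Proof.
have mQ : measurable [set w | Q (s w)].
  have := @measurable_cases _ _ _ s (fun t => [set w | Q t]) (fun t => (s_law t).1).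
  by apply => t; exact: measurable_bool.
rewrite (measure_finite_partition P' (fun t => (s_law t).1) mQ) [in RHS]big_mkcond -sumEFin.
apply: eq_bigr => t _; case: ifP => Qt.
  rewrite -(s_law t).2; congr (P' _); apply/seteqP; split => w /=; first by case.
  by move=> e; split => //; rewrite e.
rewrite (_ : _ `&` _ = set0) ?measure0//; apply/seteqP; split => w //= [-> ].
by rewrite Qt.
Qed.

(** The expected number of cycles of length [k] is at most [2 * theta / k], and
    each carries [k] points. *)
Lemma short_cycles_mean (A : nat) : (A.*2 <= N)%N ->
  (\sum_i P' [set w | (#|porbit (s w) i| < A)%N] <= (2 * theta * A%:R)%:E)%E.
Proof.
move=> AN; under eq_bigr do rewrite (ewens_event (fun t => #|porbit t _| < A)%N).
rewrite sumEFin lee_fin (exchange_big_dep predT)//=.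
have -> : \sum_(t : 'S_N) \sum_(i | (#|porbit t i| < A)%N) ewens theta t =
    \sum_(k < A) k%:R * \sum_(t : 'S_N) ewens theta t *
      (tuples_count (fun C : {set 'I_N} => #|C|) (porbits t) [:: k : nat])%:R.
  under [RHS]eq_bigr do rewrite mulr_sumr.
  rewrite exchange_big /=; apply: eq_bigr => t _.
  rewrite sumr_const -mulr_natr short_cycles_card natr_sum mulr_sumr.
  by apply: eq_bigr => k _; rewrite natrM mulrCA.
apply: (@le_trans _ _ (\sum_(k < A) (2 * theta))); last by rewrite sumr_const card_ord mulr_natr.
apply: ler_sum => -[k kA] _ /=; case: (posnP k) => [->|k0].
  by rewrite mul0r mulr_ge0// ltW.
rewrite (ewens_tuples theta0 N (ks := [:: k])) /= ?k0// addn0 /Poisson_moment big_seq1.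
rewrite mulrA mulrCA divff ?mulr1 ?pnatr_eq0 -?lt0n// mulrC ler_pM2r//.
by apply: mass_ratio_half => //; lia.
Qed.

Lemma cycle_deviation_measurable (m delta : R) (C : {set 'I_N}) :
  measurable [set v : borel 'rV[R[i]]_N |
    delta <= `|m - log_modulus (\prod_(k in C) v 0 k) / #|C|%:R|].
Proof.
apply: ge_set_measurable; apply: measurableT_comp => //.
apply: measurable_funB => //; apply: measurable_funM => //.
apply: (measurableT_comp (@log_modulus_measurable R)).
by apply: measurable_prodC => k; exact: coord_measurable.
Qed.

(** A cycle that is at least [A] long deviates with probability at most
    [kappa], whichever its points. *)
Lemma bad_point_probability (delta kappa : R) (A : nat) (i : 'I_N) :
  let m := fine 'E_L[@log_modulus R] in
  (0 < A)%N -> 0 <= kappa ->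
  (forall C : {set 'I_N}, (A <= #|C|)%N ->
    P' [set w | (delta <= `| #|C|%:R^-1 * (\sum_(j in C) log_modulus (z j w)) - m |)%R] <= kappa%:E)%E ->
  measurable [set w | ~~ good_cycle m delta A (fun k => z k w) (porbit (s w) i)] /\
  (P' [set w | ~~ good_cycle m delta A (fun k => z k w) (porbit (s w) i)] <=
   P' [set w | (#|porbit (s w) i| < A)%N] + kappa%:E)%E.
Proof.
move=> m A0 k0 wl.
have zm k : measurable_fun setT (z k) by have [] := z_law k.
pose dev (C : {set 'I_N}) : set Om' := [set w | delta <= `|m - log_modulus (\prod_(k in C) (z k w : R[i])) / #|C|%:R|].
pose devv (C : {set 'I_N}) : set (borel 'rV[R[i]]_N) := [set v | delta <= `|m - log_modulus (\prod_(k in C) v 0 k) / #|C|%:R|].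
have mdevv C : measurable (devv C) by exact: cycle_deviation_measurable.
have devE C : dev C = [set w | devv C (\row_k z k w)].
  have e w : \prod_(k in C) (\row_k z k w : 'rV[R[i]]_N) 0 k = \prod_(k in C) (z k w : R[i]).
    by apply: eq_bigr => k _; rewrite mxE.
  by apply/seteqP; split => w; rewrite /dev /devv /= e.
have mdev C : measurable (dev C).
  by rewrite devE; exact: (preimageT_measurable (row_measurable zm) (mdevv C)).
have badE : [set w | ~~ good_cycle m delta A (fun k => z k w) (porbit (s w) i)] =
    [set w | (#|porbit (s w) i| < A)%N] `|` [set w | (A <= #|porbit (s w) i|)%N /\ dev (porbit (s w) i) w].
  apply/seteqP; split => w /=; rewrite /good_cycle negb_and -ltnNge -leNgt.
    by case: ltnP => h //=; [left|right].
  by case=> [->//|[_ h]]; apply/orP; right.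
have mshort : measurable [set w | (#|porbit (s w) i| < A)%N].
  have := @measurable_cases _ _ _ s (fun t => [set w | (#|porbit t i| < A)%N]) (fun t => (s_law t).1).
  by apply => t; exact: measurable_bool.
have mD t : measurable [set w | (A <= #|porbit t i|)%N /\ dev (porbit t i) w].
  case: (A <= _)%N; last by rewrite (_ : [set _ | _] = set0)//; apply/seteqP; split => w // [].
  by rewrite (_ : [set _ | _] = dev (porbit t i))//; apply/seteqP; split => w // [].
have mdevs : measurable [set w | (A <= #|porbit (s w) i|)%N /\ dev (porbit (s w) i) w].
  exact: (@measurable_cases _ _ _ s (fun t => [set w | (A <= #|porbit t i|)%N /\ dev (porbit t i) w]) (fun t => (s_law t).1)).
rewrite badE; split; first exact: measurableU.
apply: le_trans (measureU2 _ _ _) _ => //; apply: leeD => //.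
rewrite [leLHS](measure_finite_partition P' (fun t => (s_law t).1) mdevs).
have iidz := model_iid z_law sz_indep.
have devk (C : {set 'I_N}) : (A <= #|C|)%N -> (P' (dev C) <= kappa%:E)%E.
  move=> AleC; apply: le_trans (wl C AleC); rewrite le_eqVlt; apply/orP; left; apply/eqP.
  have [mZ PZ] := model_zero_null L0 z_law sz_indep.
  apply: (measure_eq_off_null mZ PZ) => //.
    apply: ge_set_measurable; apply: measurableT_comp => //.
    apply: measurable_funB => //; apply: measurable_funM => //.
    under eq_fun do rewrite -big_enum /=; apply: measurable_sum => j.
    exact: (measurableT_comp (@log_modulus_measurable R)).
  move=> w /contrapT nz; rewrite /dev /= (log_modulus_prod _ (fun k _ => nz k)).
  by rewrite mulrC distrC.
apply: (@le_trans _ _ (\sum_t P' (s @^-1` [set t]) * kappa%:E)%E); last first.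
  rewrite -ge0_sume_distrl//.
  have -> : (\sum_t P' (s @^-1` [set t]) = 1)%E.
    rewrite -(probability_setT P') (measure_finite_partition P' (fun t => (s_law t).1) measurableT).
    by apply: eq_bigr => t _; rewrite setIT.
  by rewrite mul1e.
apply: lee_sum => t _.
have [At|tA] := leqP A #|porbit t i|; last first.
  rewrite (_ : _ `&` _ = set0) ?measure0 ?mule_ge0//.
  by apply/seteqP; split => w //= [-> []]; rewrite leqNgt tA.
have -> : s @^-1` [set t] `&` [set w | (A <= #|porbit (s w) i|)%N /\ dev (porbit (s w) i) w] =
    s @^-1` [set t] `&` dev (porbit t i).
  by apply/seteqP; split => w /= [-> h]; split => //; case: h.
have [c0 cE] : exists2 c : R, 0 <= c & P' (s @^-1` [set t]) = c%:E.
  exists (ewens theta t); last by rewrite (s_law t).2.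
  by rewrite -lee_fin -(s_law t).2 measure_ge0.
move=> cE'; rewrite devE.
(* The weights are independent of the permutation. *)
rewrite (@law_on_boxes _ _ _ _ P' _ z _ _ P' z c0)//; first last.
- move=> B mB; rewrite (model_s_z_indep z_law sz_indep)// -cE'.
  by rewrite (iid_box iidz).
- exact: (s_law t).1.
by rewrite cE' -devE; apply: lee_wpmul2l; rewrite ?lee_fin//; exact: devk.
Qed.

End bad_points.

Section weak_convergence.
Context (R : realType).
Local Open Scope ereal_scope.

(** A bounded test function plus a constant is nonnegative, and the constant is
    handled by the total masses. *)
Lemma weakly_converges_nonneg (T : ptopologicalType)
    (mu_ : nat -> set (borel T) -> \bar R) (mu : set (borel T) -> \bar R) :
  (\forall n \near \oo, is_finite_measure (mu_ n)) -> is_finite_measure mu ->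
  (forall g : T -> R, continuous g -> (exists B : R, forall x, 0 <= g x <= B)%R ->
     (fun n => \int[mu_ n]_x (g x)%:E) @ \oo --> \int[mu]_x (g x)%:E) ->
  weakly_converges mu_ mu.
Proof.
move=> fin_ fin H; split=> // f cf [c fc].
have c0 : (0 <= c)%R by apply: le_trans (fc point).
pose g x := (f x + c)%R.
have cg : continuous g by move=> x; apply: cvgD; [exact: cf|exact: cvg_cst].
have gB x : (0 <= g x <= 2 * c)%R.
  by have := fc x; rewrite ler_norml /g => /andP[h1 h2]; apply/andP; split; lra.
have mg : measurable_fun setT (g : borel T -> R) by exact: continuous_borel_measurable.
have split_int (m : set (borel T) -> \bar R) : is_finite_measure m ->
    [/\ \int[m]_x (g x)%:E \is a fin_num, \int[m]_x (1%R)%:E \is a fin_num &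
      \int[m]_x (f x)%:E = \int[m]_x (g x)%:E - c%:E * \int[m]_x (1%R)%:E].
  move=> mfin; pose nu : {finite_measure set (borel T) -> \bar R} := pack_measure mfin.
  have -> : m = nu by rewrite /nu /= pack_measureE.
  have iB (h : borel T -> R) (B : R) : measurable_fun setT h -> (forall x, 0 <= h x <= B)%R ->
      nu.-integrable setT (EFin \o h).
    move=> mh hB; apply: measurable_bounded_integrable => //.
      by rewrite -ge0_fin_numE// fin_num_measure.
    exists B; split; first exact: num_real.
    move=> x Bx y _ /=; have /andP[h0 h1] := hB y.
    by rewrite ger0_norm// (le_trans h1)// ltW.
  have ig := iB _ _ mg gB.
  have i1 : nu.-integrable setT (EFin \o cst 1%R).
    by apply: (iB _ 1%R) => // x; rewrite /= ler01 lexx.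
  split; [exact: integrable_fin_num|exact: integrable_fin_num|].
  rewrite -integralZl//.
  rewrite -integralB//; last exact: integrableZl.
  by apply: eq_integral => x _; rewrite -EFinM mulr1 -EFinB /g addrK.
have [fg f1 fE] := split_int mu fin.
rewrite fE.
have Hg := H g cg (ex_intro _ (2 * c)%R gB).
have c1 : continuous (cst 1%R : T -> R) by move=> x; exact: cvg_cst.
have B1 : exists B : R, forall x : T, (0 <= (cst 1%R : T -> R) x <= B)%R.
  by exists 1%R => x; rewrite ler01 lexx.
have H1 : c%:E * \int[mu_ n]_x (cst 1%R x)%:E @[n --> \oo] --> c%:E * \int[mu]_x (cst 1%R x)%:E.
  by apply: cvgeZl => //; exact: H.
have lim := cvgeB (fin_num_adde_defl _ (_ : - _ \is a fin_num)) Hg H1.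
have fin1 : - (c%:E * \int[mu]_x (cst 1%R x)%:E) \is a fin_num by rewrite fin_numN fin_numM.
apply: cvg_trans (lim _ fin1).
apply: near_eq_cvg; near=> n.
have finn : is_finite_measure (mu_ n) by near: n.
by have [_ _ ->] := split_int _ finn.
Unshelve. all: by end_near.
Qed.

End weak_convergence.

Section normalized_measures.
Context (R : realType) (theta : R) (L : probability (borel R[i]) R).
Hypothesis theta0 : 0 < theta.
Hypothesis L0 : L [set (0 : R[i])] = 0%E.
Hypothesis log_integrable : L.-integrable setT (EFin \o @log_modulus R).

Section fixed_size.
Context (N q : nat) d (Om : measurableType d) (P : probability Om R)
  (M : Om -> borel 'M[R[i]]_N).
Context d' (Om' : measurableType d') (P' : probability Om' R)
  (s : Om' -> 'S_N) (z : 'I_N -> Om' -> borel R[i]).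
Hypothesis s_law : forall t, measurable (s @^-1` [set t]) /\
  P' (s @^-1` [set t]) = (ewens theta t)%:E.
Hypothesis z_law : forall j, has_law P' (z j) L.
Hypothesis sz_indep : mutually_independent P' setT
  (fun i : option 'I_N =>
     if i is Some j then sigma_of (z j) else [set s @^-1` B | B in setT]).
Hypothesis M_law : has_law P M
  (fun A => P' [set w | A (perm_matrix (s w) (fun j => z j w))]).

Let row (j : {ffun 'I_q -> 'I_N}) w := perm_eigen_row (s w) (fun k => z k w) j.

Let mrow j : measurable_fun setT (row j : Om' -> borel 'rV[R[i]]_q).
Proof. exact: (model_row_measurable s_law z_law). Qed.

Lemma scaled_mu_tilde_mixture (c : R) (A : set (borel 'rV[R[i]]_q)) : 0 <= c -> measurable A ->
  (c%:E * mu_tilde P M A =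
   \esum_(j in [set j : {ffun 'I_q -> 'I_N} | injectiveb j])
     (c%:E * P' (setT `&` (row j : Om' -> borel 'rV[R[i]]_q) @^-1` A)))%E.
Proof.
move=> c0 mA; rewrite (mu_tilde_model L0 s_law z_law sz_indep M_law mA).
rewrite esum_finType; last by move=> j; rewrite mule_ge0// lee_fin.
rewrite ge0_sume_distrr//.
by apply: eq_bigr => j _; rewrite setTI.
Qed.

Lemma scaled_mu_tilde_finite (c : R) : 0 <= c ->
  is_finite_measure (fun A => c%:E * mu_tilde (q := q) P M A)%E.
Proof.
move=> c0.
have := mixture_is_finite_measure (c := fun=> c) (E := fun=> setT)
  (mu := fun A => (c%:E * mu_tilde (q := q) P M A)%E) (fun=> c0) (fun=> measurableT) mrow
  (fun A mA => scaled_mu_tilde_mixture c0 mA).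
apply.
- move=> A; rewrite mule_ge0 ?lee_fin//; apply: integral_ge0 => w _.
  by apply: esum_ge0 => j _; rewrite lee_fin.
- rewrite esum_finType; last by move=> j; rewrite mule_ge0// lee_fin.
  apply: (@le_lt_trans _ _ (\sum_(j : {ffun 'I_q -> 'I_N} | injectiveb j) c%:E)%E).
    by apply: lee_sum => j _; rewrite [X in (_ * X)%E](probability_setT P') mule1.
  by rewrite sumEFin ltry.
Qed.

Lemma integral_scaled_mu_tilde (c : R) (f : borel 'rV[R[i]]_q -> R) :
  0 <= c -> measurable_fun setT f -> (forall v, 0 <= f v) ->
  (\int[fun A => c%:E * mu_tilde (q := q) P M A]_v (f v)%:E =
   c%:E * \int[P']_w (\sum_(j : {ffun 'I_q -> 'I_N} | injectiveb j) f (row j w))%:E)%E.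
Proof.
move=> c0 mf f0.
have mE : measurable_fun setT (EFin \o f) by exact/measurable_EFinP.
rewrite (integral_mixture (c := fun=> c) (E := fun=> setT) _ _ mrow
  (fun A mA => scaled_mu_tilde_mixture c0 mA))//.
rewrite esum_finType; last first.
  by move=> j; rewrite mule_ge0 ?lee_fin//; apply: integral_ge0 => w _; rewrite lee_fin.
rewrite -ge0_sume_distrr; last by move=> j _; apply: integral_ge0 => w _; rewrite lee_fin.
congr (_ * _)%E; under [RHS]eq_integral do rewrite -sumEFin.
rewrite integral_fin_sum//; last by move=> j w; rewrite lee_fin.
by move=> j; exact: (measurableT_comp mE (mrow j)).
Qed.

(** The expectation of [tuples_estimate]: the bad points are those on short
    cycles, [2 * theta * A] on average, and those on deviating cycles, of
    expected number at most [N * kappa]. *)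
Lemma mean_estimate (f : borel 'rV[R[i]]_q -> R) (B m eta eps delta kappa : R) (A : nat) :
  let mL := fine 'E_L[@log_modulus R] in
  measurable_fun setT f -> (forall v, 0 <= f v <= B) -> 0 < eta -> 0 <= eps ->
  row_oscillates (expR mL) eta eps (EFin \o f) ->
  circle_mean (expR mL) (EFin \o f) = m%:E -> 0 <= m <= B ->
  eta <= expR mL / 2 -> (0 < A)%N -> 2 * pi / A%:R < eta ->
  (forall x, `|mL - x| < delta -> `|expR mL - expR x| < eta) -> 0 <= kappa ->
  (forall C : {set 'I_N}, (A <= #|C|)%N ->
    P' [set w | (delta <= `| #|C|%:R^-1 * (\sum_(j in C) log_modulus (z j w)) - mL |)%R] <= kappa%:E)%E ->
  (A.*2 <= N)%N ->
  let e := B * (q%:R * N%:R ^+ q.-1) * (2 * theta * A%:R + N%:R * kappa) in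
  exists2 Z : R,
    (\int[P']_w (\sum_(j : {ffun 'I_q -> 'I_N} | injectiveb j) f (row j w))%:E = Z%:E)%E &
    Z <= N%:R ^+ q * (m + q%:R * eps) + e /\
    N%:R ^+ q * m <= Z + B * (N%:R ^+ q - (N ^_ q)%:R) + N%:R ^+ q * (q%:R * eps) + e.
Proof.
move=> mL mf fB eta0 eps0 osc cm mB eta_r A0 Aeta cexp k0 wl AN e.
have f0 v : 0 <= f v by case/andP: (fB v).
have B0 : 0 <= B by apply: le_trans (f0 0) _; case/andP: (fB 0).
pose F w := \sum_(j : {ffun 'I_q -> 'I_N} | injectiveb j) f (row j w).
pose Bad i : set Om' := [set w | ~~ good_cycle mL delta A (fun k => z k w) (porbit (s w) i)].
pose b w : R := #|[pred i | ~~ good_cycle mL delta A (fun k => z k w) (porbit (s w) i)]|%:R.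
have bad i := bad_point_probability L0 s_law z_law sz_indep i A0 k0 wl.
have bE w : b w = \sum_i \1_(Bad i) w.
  rewrite /b -sum1_card natr_sum big_mkcond; apply: eq_bigr => i _.
  rewrite indicE; case: ifPn => h; first by rewrite mem_set.
  by rewrite memNset// => h'; move: h; rewrite inE /= h'.
have mF : measurable_fun setT F.
  rewrite /F; under eq_fun do rewrite -big_filter.
  by apply: measurable_sum => j; exact: (measurableT_comp mf (mrow j)).
have F0 w : 0 <= F w by apply: sumr_ge0.
have mb : measurable_fun setT b.
  rewrite (_ : b = fun w => \sum_i \1_(Bad i) w); last by apply/funext.
  by apply: measurable_sum => i; apply: measurable_indic; have [] := bad i.
have b0 w : 0 <= b w by rewrite ler0n.
have mE (g : Om' -> R) : measurable_fun setT g -> measurable_fun setT (EFin \o g).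
  by move=> mg; exact/measurable_EFinP.
have Eb : (\int[P']_w (b w)%:E <= (2 * theta * A%:R + N%:R * kappa)%:E)%E.
  under eq_integral do rewrite bE -sumEFin.
  rewrite integral_fin_sum; first last.
  - by move=> i w; rewrite lee_fin.
  - by move=> i; apply: mE; apply: measurable_indic; have [] := bad i.
  apply: (@le_trans _ _ (\sum_i (P' [set w | (#|porbit (s w) i| < A)%N] + kappa%:E))%E).
    apply: lee_sum => i _; rewrite integral_indic//; last by have [] := bad i.
    by rewrite setIT; have [] := bad i.
  rewrite big_split /= sumEFin sumr_const card_ord EFinD -[(kappa *+ N)%R]mulr_natl.
  by apply: leeD => //; exact: (short_cycles_mean theta0 s_law AN).
have PT : P' setT = 1%E by exact: probability_setT.
have cstI c : (\int[P']_w (cst c w)%:E = c%:E)%E.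
  by rewrite [LHS](integral_cst P' measurableT c%:E) [X in (_ * X)%E](probability_setT P') mule1.
pose D := B * (q%:R * N%:R ^+ q.-1).
have D0 : 0 <= D by rewrite !mulr_ge0// exprn_ge0.
have point w : F w <= N%:R ^+ q * (m + q%:R * eps) + D * b w /\
    N%:R ^+ q * m <= F w + (B * (N%:R ^+ q - (N ^_ q)%:R) + N%:R ^+ q * (q%:R * eps)) + D * b w.
  have eqd := good_cycles_equidistributed (s w) (fun k => z k w) eta0 eps0 eta_r A0 Aeta cexp.
  have := tuples_estimate (expR_gt0 mL) eta0 eps0 B0 eqd mf fB osc cm mB.
  by rewrite /= card_ord => -[h1 h2]; split => //; rewrite addrA [leRHS]addrAC; exact: h2.
have Db : (\int[P']_w (D * b w)%:E <= e%:E)%E.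
  under eq_integral do rewrite EFinM.
  rewrite ge0_integralZl//; first last.
  - by move=> w _; rewrite lee_fin.
  - exact: mE.
  by rewrite /e -/D [leRHS]EFinM; apply: lee_wpmul2l; rewrite ?lee_fin.
have mDb : measurable_fun setT (fun w => D * b w) by exact: measurable_funM.
have Db0 w : (0 <= (D * b w)%:E)%E by rewrite lee_fin mulr_ge0.
have /andP[m0 m1] := mB.
have up : (\int[P']_w (F w)%:E <= (N%:R ^+ q * (m + q%:R * eps) + e)%:E)%E.
  have c0 : 0 <= N%:R ^+ q * (m + q%:R * eps) by rewrite mulr_ge0 ?exprn_ge0// addr_ge0// mulr_ge0.
  rewrite EFinD; apply: le_trans (leeD (lexx _) Db).
  rewrite -cstI -ge0_integralD//; first last.
  - exact: mE.
  - exact: mE.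
  apply: ge0_le_integral => //.
  - by move=> w _; rewrite lee_fin.
  - exact: mE.
  - by apply: emeasurable_funD => //; exact: mE.
  - by move=> w _; rewrite -EFinD lee_fin; have [] := point w.
have Zfin : (\int[P']_w (F w)%:E)%E \is a fin_num.
  rewrite ge0_fin_numE; first exact: le_lt_trans up (ltry _).
  by apply: integral_ge0 => w _; rewrite lee_fin.
exists (fine (\int[P']_w (F w)%:E)%E); first by rewrite fineK.
split; first by rewrite -lee_fin fineK.
pose a := B * (N%:R ^+ q - (N ^_ q)%:R) + N%:R ^+ q * (q%:R * eps).
have a0 : 0 <= a.
  rewrite addr_ge0 ?mulr_ge0 ?exprn_ge0// subr_ge0 -natrX ler_nat.
  elim: (q) => // n IH; rewrite ffactnSr expnSr; exact: leq_mul IH (leq_subr _ _).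
have low : ((N%:R ^+ q * m)%:E <= \int[P']_w (F w)%:E + a%:E + e%:E)%E.
  apply: le_trans (leeD (lexx _) Db).
  rewrite -(cstI a) -(cstI (_ * _)) -!ge0_integralD//; first last.
  - exact: mE.
  - exact: mE.
  - by move=> w _; rewrite lee_fin.
  - exact: mE.
  - by apply: emeasurable_funD => //; exact: mE.
  - by move=> w _; rewrite adde_ge0// lee_fin.
  apply: ge0_le_integral => //.
  - by move=> w _; rewrite lee_fin mulr_ge0// exprn_ge0.
  - exact: mE.
  - by apply: emeasurable_funD; [apply: emeasurable_funD => //|]; exact: mE.
  - by move=> w _; rewrite -!EFinD lee_fin; have [] := point w.
rewrite -lee_fin; apply: (le_trans low).
by rewrite -[in leLHS](fineK Zfin) -!EFinD lee_fin /a !addrA.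
Qed.

End fixed_size.

End normalized_measures.

Section first_part.
Context (R : realType).

Lemma ffact_lower (N q : nat) : (q <= N)%N ->
  N%:R ^+ q - (N ^_ q)%:R <= q%:R * N%:R ^+ q.-1 * q%:R :> R.
Proof.
move=> qN.
have h : ((N - q) ^ q <= N ^_ q)%N.
  suff H m : (m <= q)%N -> ((N - q) ^ m <= N ^_ m)%N by exact: H.
  elim: m => // m IH mq; rewrite ffactnSr expnSr; apply: leq_mul; first exact: IH (ltnW mq).
  by apply: leq_sub2l; exact: ltnW.
have hq : q%:R = N%:R - (N - q)%:R :> R by rewrite natrB// opprB addrCA subrr addr0.
rewrite [X in _ <= _ * X]hq; apply: le_trans (exprn_diff_le _ _ _) => //.
  by rewrite lerD2l lerN2 -natrX ler_nat.
by rewrite ler_nat leq_subr.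
Qed.

Lemma polar_close_le (r eta eta' : R) x y : eta <= eta' ->
  polar_close r eta x y -> polar_close r eta' x y.
Proof.
move=> le_eta [rho [rho' [t [t' [h1 h2 h3 h4 h5]]]]].
by exists rho, rho', t, t'; split => //; [exact: lt_le_trans h3 _|exact: lt_le_trans h4 _].
Qed.

Theorem normalized_convergence (theta : R) (q : nat) (L : probability (borel R[i]) R)
    (d : measure_display) (Om : measurableType d) (P : probability Om R)
    (M : forall N : nat, Om -> 'M[R[i]]_N) :
  0 < theta -> (1 <= q)%N -> L [set (0 : R[i])] = 0%E ->
  (forall N, (1 <= N)%N -> follows_ewens_matrix theta L P (M N)) ->
  L.-integrable setT (EFin \o @log_modulus R) ->
  weakly_converges
    (fun N A => (((N ^_ q)%:R^-1)%:E * mu_tilde P (M N) A)%E)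
    (@product_power R (uniform_circle (expR (fine 'E_L[@log_modulus R]))) q).
Proof.
move=> theta0 q1 L0 M_law ilog; set mL := fine 'E_L[@log_modulus R].
have [nu [nuE nu1 nuI]] := product_power_measure (expR mL) q.
have c0 N : 0 <= (N ^_ q)%:R^-1 :> R by rewrite invr_ge0.
apply: weakly_converges_nonneg.
- near=> N; have N1 : (1 <= N)%N by near: N; exact: nbhs_infty_ge.
  have [d' [Om' [P' [s [z [s_law z_law sz_indep law]]]]]] := M_law N N1.
  exact: (scaled_mu_tilde_finite L0 q s_law z_law sz_indep law (c0 N)).
- rewrite nuE; apply: measure_is_finite.
  by rewrite [X in (X < _)%E](_ : _ = 1%E)// ltry.
move=> g cg [B gB].
have mg : measurable_fun setT (g : borel 'rV[R[i]]_q -> R) by exact: continuous_borel_measurable.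
have g0 v : 0 <= g v by case/andP: (gB v).
have B0 : 0 <= B by apply: le_trans (g0 0) _; case/andP: (gB 0).
have [m cm mB] := circle_mean_fin (expR mL) mg gB.
have /andP[m0 m1] := mB.
have mE : measurable_fun setT (EFin \o g : borel 'rV[R[i]]_q -> _) by exact/measurable_EFinP.
rewrite nuE nuI; [|exact: mE|by move=> v; rewrite lee_fin].
rewrite cm; apply/fine_cvgP.
(* The limit is finite, so that convergence may be stated in the reals. *)
suff H (e : R) : 0 < e -> \forall N \near \oo, exists2 x : R,
    (\int[fun A => ((N ^_ q)%:R^-1)%:E * mu_tilde P (M N) A]_v (g v)%:E = x%:E)%E & `|m - x| <= e.
  split.
    by have := H 1 ltr01; apply: filterS => N [x -> _].
  by apply/cvgrPdist_le => e e0; have := H e e0; apply: filterS => N [x /= -> ].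
move=> e0.
(* All the errors are multiples of [kap]. *)
pose K := 2 * (q%:R + 2 * B * q%:R + 2 * B) : R.
have K0 : 0 <= K by rewrite mulr_ge0// !addr_ge0// !mulr_ge0.
pose kap := Num.min (1 / 2) (e / (K + 1)).
have K1 : 0 < K + 1 by rewrite ltr_wpDl.
have kap0 : 0 < kap by rewrite lt_min !divr_gt0.
have kap_half : kap <= 1 / 2 by rewrite ge_min lexx.
have kapK : kap * K <= e.
  have h : kap <= e / (K + 1) by rewrite ge_min lexx orbT.
  apply: (le_trans (ler_wpM2r K0 h)); rewrite mulrAC ler_pdivrMr// ler_pM2l//.
  by rewrite lerDl.
have [eta1 eta10 osc1] := uniform_on_annulus (expR mL) cg kap0.
have r0 := expR_gt0 mL.
pose eta := Num.min eta1 (expR mL / 2).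
have eta0 : 0 < eta by rewrite lt_min eta10 divr_gt0.
have osc : row_oscillates (expR mL) eta kap (EFin \o g).
  move=> v v' vv'; have : `|g v - g v'| < kap.
    apply: osc1 => k; apply: polar_close_le (vv' k); by rewrite ge_min lexx.
  rewrite ltr_norml => /andP[h1 h2].
  by rewrite -!EFinD !lee_fin; split; lra.
have eta_r : eta <= expR mL / 2 by rewrite ge_min lexx orbT.
have [delta delta0 cexp] : exists2 delta : R, 0 < delta &
    forall x, `|mL - x| < delta -> `|expR mL - expR x| < eta.
  have /cvgrPdist_lt/(_ _ eta0)/nbhs_ballP[delta /= d0 hd] := @continuous_expR R mL.
  by exists delta => // x hx; apply: hd.
have [A0 wl] := weak_law ilog delta0 kap0.
(* Cycles longer than [A] obey the law of large numbers and have their roots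
   closer than [eta] to each other. *)
pose A := maxn A0.+1 (Num.truncn (2 * pi / eta)).+1.
have A_gt0 : (0 < A)%N by rewrite leq_max.
have Aeta : 2 * pi / A%:R < eta.
  have : 2 * pi / eta < A%:R.
    by apply: lt_le_trans (truncnS_gt _) _; rewrite ler_nat leq_max leqnn orbT.
  by rewrite !ltr_pdivrMr ?ltr0n// (mulrC eta).
(* From these ranks on, short cycles and repeated indices account for a
   proportion [kap] at most. *)
pose N1 := (Num.truncn (2 * theta * A%:R / kap)).+1.
pose N2 := (Num.truncn (q%:R * q%:R / kap)).+1.
near=> N.
have NA : (A.*2 <= N)%N by near: N; exact: nbhs_infty_ge.
have hN1 : (N1 <= N)%N by near: N; exact: nbhs_infty_ge.
have hN2 : (N2 <= N)%N by near: N; exact: nbhs_infty_ge.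
have qN : (q <= N)%N by near: N; exact: nbhs_infty_ge.
have N0 : (0 < N)%N by exact: leq_trans qN.
have NR : 0 < N%:R :> R by rewrite ltr0n.
have [d' [Om' [P' [s [z [s_law z_law sz_indep law]]]]]] := M_law N N0.
have iidz := model_iid z_law sz_indep.
have wlN (C : {set 'I_N}) : (A <= #|C|)%N ->
    (P' [set w | (delta <= `| #|C|%:R^-1 * (\sum_(j in C) log_modulus (z j w)) - mL |)%R] <= kap%:E)%E.
  move=> AleC; apply: wl => //; apply: leq_trans AleC.
  by rewrite leq_max leqnSn.
have [Z ZE [Zup Zlow]] := mean_estimate theta0 L0 s_law z_law sz_indep mg gB eta0 (ltW kap0)
  osc cm mB eta_r A_gt0 Aeta cexp (ltW kap0) wlN NA.
exists ((N ^_ q)%:R^-1 * Z).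
  by rewrite (integral_scaled_mu_tilde L0 s_law z_law sz_indep law (c0 N) mg g0) ZE.
set F : R := (N ^_ q)%:R in Zup Zlow *.
have F0 : 0 < F by rewrite ltr0n ffact_gt0.
have FN : F <= N%:R ^+ q.
  rewrite /F -natrX ler_nat.
  suff H p : (N ^_ p <= N ^ p)%N by exact: H.
  by elim: p => // p IH; rewrite ffactnSr expnSr; exact: leq_mul IH (leq_subr _ _).
have Npred : N%:R ^+ q.-1 * N%:R = N%:R ^+ q :> R by rewrite -exprSr prednK.
have NF : N%:R ^+ q - F <= kap * N%:R ^+ q.
  apply: (le_trans (ffact_lower qN)); rewrite -Npred mulrAC mulrA [leRHS]mulrAC.
  apply: ler_wpM2r; first by rewrite exprn_ge0.
  rewrite mulrC -ler_pdivrMl// mulrC; apply: ltW; apply: lt_le_trans (truncnS_gt _) _.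
  by rewrite ler_nat.
have err : B * (q%:R * N%:R ^+ q.-1) * (2 * theta * A%:R + N%:R * kap) <=
    N%:R ^+ q * (2 * B * q%:R * kap).
  apply: (@le_trans _ _ (B * (q%:R * N%:R ^+ q.-1) * (2 * (N%:R * kap)))); last first.
    by rewrite -Npred le_eqVlt; apply/orP; left; apply/eqP; ring.
  apply: ler_wpM2l; first by rewrite !mulr_ge0// exprn_ge0.
  have : 2 * theta * A%:R <= N%:R * kap; last lra.
  rewrite -ler_pdivrMr//; apply: ltW; apply: lt_le_trans (truncnS_gt _) _.
  by rewrite ler_nat.
have -> : m - F^-1 * Z = F^-1 * (F * m - Z) by rewrite mulrBr mulrA mulVf ?mul1r// gt_eqF.
rewrite normrM ger0_norm ?invr_ge0 ?(ltW F0)// mulrC ler_pdivrMr//.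
pose X : R := N%:R ^+ q.
have X0 : 0 <= X by rewrite exprn_ge0.
have XF : X <= 2 * F.
  have : kap * X <= 1 / 2 * X by exact: ler_wpM2r.
  by move: NF; rewrite -/X; lra.
have main : `|F * m - Z| <= X * (kap * (q%:R + 2 * B * q%:R + 2 * B)).
  have Bk : B * (X - F) <= B * (kap * X) by exact: ler_wpM2l.
  have mk : m * (X - F) <= B * (kap * X).
    by apply: ler_pM => //; rewrite subr_ge0.
  have mF : F * m <= X * m by exact: ler_wpM2r.
  move: Zup Zlow err; rewrite -/X.
  set E := B * (q%:R * N%:R ^+ q.-1) * _ => Zup Zlow err.
  rewrite ler_norml; apply/andP; split.
    have -> : - (X * (kap * (q%:R + 2 * B * q%:R + 2 * B))) =
       - (X * (q%:R * kap)) - X * (2 * B * q%:R * kap) - 2 * (B * (kap * X)) by ring.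
    have h : 0 <= B * (kap * X) by rewrite !mulr_ge0// ltW.
    have e1 : X * (m + q%:R * kap) = X * m + X * (q%:R * kap) by ring.
    have e2 : m * (X - F) = X * m - F * m by ring.
    by move: Zup mk; rewrite e1 e2; lra.
  have -> : X * (kap * (q%:R + 2 * B * q%:R + 2 * B)) =
       X * (q%:R * kap) + X * (2 * B * q%:R * kap) + 2 * (B * (kap * X)) by ring.
  have h : 0 <= B * (kap * X) by rewrite !mulr_ge0// ltW.
  lra.
apply: (le_trans main).
apply: (@le_trans _ _ (2 * F * (kap * (q%:R + 2 * B * q%:R + 2 * B)))).
  by apply: ler_wpM2r => //; rewrite mulr_ge0 ?(ltW kap0)// !addr_ge0// !mulr_ge0.
have -> : 2 * F * (kap * (q%:R + 2 * B * q%:R + 2 * B)) = kap * K * F by rewrite /K; ring.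
by apply: ler_wpM2r => //; exact: ltW.
Unshelve. all: by end_near.
Qed.

End first_part.

(** * Sums over countable families *)

Section esums.
Context (R : realType).
Local Open Scope ereal_scope.

Lemma esum_ge_term (K : choiceType) (D : set K) (a : K -> \bar R) y :
  D y -> (forall y, 0 <= a y) -> a y <= \esum_(y in D) a y.
Proof.
move=> Dy a0; apply: esum_ge; exists [set y]; last by rewrite fsbig_set1.
by split; [exact: finite_set1|move=> _ ->].
Qed.

Lemma esumZl (K : countType) (D : set K) (c : \bar R) (a : K -> \bar R) :
  0 <= c -> (forall y, 0 <= a y) ->
  \esum_(y in D) c * a y = c * \esum_(y in D) a y.
Proof.
move=> c0 a0; have ca0 y : 0 <= c * a y by exact: mule_ge0.
case: c c0 ca0 => [c c0|_|//] ca0; last first.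
  have [az|/existsNP[y /not_implyP[Dy ay]]] := pselect (forall y, D y -> a y = 0).
    by rewrite !esum1 ?mule0// => y Dy; rewrite az// mule0.
  have ay0 : 0 < a y by rewrite lt0e a0 andbT; apply/eqP.
  have h1 := esum_ge_term Dy a0.
  rewrite [RHS]gt0_mulye; last exact: lt_le_trans ay0 h1.
  by apply/eqP; rewrite -leye_eq; apply: le_trans (esum_ge_term Dy ca0); rewrite gt0_mulye.
rewrite !esum_countType//.
rewrite -nneseriesZl; last by move=> n _; exact: unpickled_ge0.
apply: eq_eseriesr => n _; rewrite /unpickled; case: pickle_inv => [y|]; last by rewrite mule0.
by case: ifP => _; rewrite ?mule0.
Qed.

Lemma esumZr (K : countType) (D : set K) (c : \bar R) (a : K -> \bar R) :
  0 <= c -> (forall y, 0 <= a y) ->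
  \esum_(y in D) a y * c = (\esum_(y in D) a y) * c.
Proof.
move=> c0 a0; rewrite [RHS]muleC -esumZl//.
by apply: eq_esum => y _; rewrite muleC.
Qed.

Lemma integral_esum d (T : measurableType d) (mu : {measure set T -> \bar R})
    (K : countType) (D : set K) (f : K -> T -> \bar R) :
  (forall y, D y -> measurable_fun setT (f y)) -> (forall y x, 0 <= f y x) ->
  \int[mu]_x (\esum_(y in D) f y x) = \esum_(y in D) \int[mu]_x f y x.
Proof.
move=> mf f0.
under eq_integral do rewrite esum_countType//.
rewrite esum_countType; last by move=> y; apply: integral_ge0 => x _.
rewrite integral_nneseries//; first last.
- by move=> n x _; apply: unpickled_ge0 => y.
- move=> n; rewrite /unpickled; case: (@pickle_inv K n) => [y|]; last exact: measurable_cst.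
  have [/set_mem Dy|_] := boolP (y \in D); [exact: mf|exact: measurable_cst].
apply: eq_eseriesr => n _; rewrite /unpickled; case: (@pickle_inv K n) => [y|].
  by case: ifP => _//; rewrite integral0.
by rewrite integral0.
Qed.

Lemma esum_finType_image (K : finType) (p : pred K) (T : choiceType) (D : set T) (e : K -> T)
    (a : T -> \bar R) : (forall y, 0 <= a y) -> set_bij [set k | p k] D e ->
  \esum_(y in D) a y = \sum_(k | p k) a (e k).
Proof. by move=> a0 be; rewrite (reindex_esum _ _ _ _ be)// esum_finType. Qed.

Lemma esum_ffun_prod m (g : 'I_m -> nat -> \bar R) : (forall i n, 0 <= g i n) ->
  \esum_(n in [set: {ffun 'I_m -> nat}]) \prod_i g i (n i) =
  \prod_i \esum_(x in [set: nat]) g i x.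
Proof.
elim: m g => [|m IH] g g0.
  rewrite big_ord0 (_ : setT = [set ffun0 (card_ord 0)]).
    by rewrite esum_set1 big_ord0.
  by apply/seteqP; split => // n _ /=; apply/ffunP => -[].
pose h (xn : nat * {ffun 'I_m -> nat}) : {ffun 'I_m.+1 -> nat} :=
  [ffun k => if unlift ord0 k is Some l then xn.2 l else xn.1].
have h0 xn : h xn ord0 = xn.1 by rewrite ffunE unlift_none.
have hS xn l : h xn (lift ord0 l) = xn.2 l by rewrite ffunE liftK.
have bh : set_bij [set: nat * {ffun 'I_m -> nat}] [set: {ffun 'I_m.+1 -> nat}] h.
  split => //.
    move=> [x n] [x' n'] _ _ e; congr pair; first by rewrite -[x]/((x, n).1) -h0 e h0.
    by apply/ffunP => l; rewrite -[n]/((x, n).2) -hS e hS.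
  move=> n _; exists (n ord0, [ffun l => n (lift ord0 l)]) => //.
  apply/ffunP => k; case: (unliftP ord0 k) => [l|] ->; rewrite ?h0 ?hS//.
  by rewrite ffunE.
rewrite (reindex_esum _ _ _ _ bh)//.
rewrite big_ord_recl -IH//.
rewrite (_ : [set: nat * {ffun 'I_m -> nat}] = [set: nat] `*`` (fun=> [set: {ffun 'I_m -> nat}])).
  rewrite -(@esum_esum _ _ _ setT (fun=> setT)
    (fun x n => \prod_i g i (h (x, n) i)))//; last by move=> x n _ _; apply: prode_ge0.
  rewrite -esumZr//; last by apply: esum_ge0 => n _; apply: prode_ge0.
  apply: eq_esum => x _; rewrite -esumZl//; last by move=> n; apply: prode_ge0.
  apply: eq_esum => n _; rewrite big_ord_recl h0; congr (_ * _).
  by apply: eq_bigr => i _; rewrite hS.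
by apply/seteqP; split.
Qed.

(** The factor [n ^_ c] cancels the first factors of [n!], and shifting the
    index by [c] leaves the total mass times [lambda ^ c]. *)
Lemma poisson_ffact_moment (lambda : R) (c : nat) : (0 < lambda)%R ->
  \esum_(n in [set: nat]) (n ^_ c)%:R%:E * poisson_prob lambda 0 [set n] = (lambda ^+ c)%:E.
Proof.
move=> l0.
have pE n : poisson_prob lambda 0 [set n] = (poisson_pmf lambda n)%:E.
  by rewrite /poisson_prob l0 esum_set1// lee_fin poisson_pmf_ge0.
have p0 n : (0 <= poisson_pmf lambda n)%R by exact: poisson_pmf_ge0.
have p1 : \esum_(n in [set: nat]) (poisson_pmf lambda n)%:E = 1.
  by have := probability_setT (poisson_prob lambda 0); rewrite /= /poisson_prob l0.
have F0 n : 0 <= (n ^_ c)%:R%:E * poisson_prob lambda 0 [set n].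
  by rewrite pE -EFinM lee_fin mulr_ge0.
rewrite (_ : \esum_(n in _) _ = \esum_(n in range (addn c)) (n ^_ c)%:R%:E * poisson_prob lambda 0 [set n]).
  have bc : set_bij [set: nat] (range (addn c)) (addn c).
    by split => // x y _ _ /addnI.
  rewrite (reindex_esum _ _ _ _ bc).
  rewrite -[RHS]mule1 -[X in _ * X]p1 -esumZl; first last.
  - by move=> n; rewrite lee_fin.
  - by rewrite lee_fin exprn_ge0// ltW.
  apply: eq_esum => n _; rewrite pE -!EFinM /poisson_pmf l0; congr EFin.
  have h : ((c + n)`! = (c + n) ^_ c * n`!)%N by rewrite -(ffact_fact (leq_addr n c)) addKn.
  rewrite h natrM exprD; have f1 : (((c + n) ^_ c)%:R != 0 :> R)%R by rewrite pnatr_eq0 -lt0n ffact_gt0 leq_addr.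
  have f2 : (n`!%:R != 0 :> R)%R by rewrite pnatr_eq0 -lt0n fact_gt0.
  by field; rewrite f1 f2.
rewrite [RHS]esum_mkcond; apply: eq_esum => n _; case: ifPn => // hn.
rewrite ffact_small ?mul0e// ltnNge; apply: contra hn => cn.
by rewrite inE; exists (n - c)%N => //; rewrite subnKC.
Qed.

Lemma esum_ord_lt (n : nat) : \esum_(x in [set: nat]) (if (x < n)%N then 1 else 0) = n%:R%:E :> \bar R.
Proof.
rewrite -[RHS]mule1 -[in RHS](card_ord n) -sum1_card natr_sum -sumEFin.
rewrite ge0_sume_distrl; last by move=> i _; rewrite lee_fin.
rewrite (_ : \esum_(x in _) _ = \esum_(x in [set x | (x < n)%N]) (1 : \bar R)); last first.
  rewrite [RHS]esum_mkcond; apply: eq_esum => x _.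
  by case: ifPn => [h|h]; [rewrite mem_set|rewrite memNset//= => h'; move: h; rewrite h'].
rewrite (@esum_finType_image _ predT _ _ (fun i : 'I_n => i : nat))//.
  by apply: eq_bigr => i _; rewrite mul1e.
split => //; [by move=> i _ /=|by move=> i j _ _ /val_inj|by move=> x /= xn; exists (Ordinal xn)].
Qed.

End esums.

(** * The limit point process *)

Section product_laws.
Context (R : realType) (L : probability (borel R[i]) R).

Lemma product_law_block (K : finType) (C : {set K}) k
    d (Om : measurableType d) (P : probability Om R) (X : K -> Om -> borel R[i])
    d' (Om' : measurableType d') (P' : probability Om' R) (T : Om' -> borel R[i]) (A : set (borel R[i])) :
  iid P X L -> #|C| = k -> has_product_law L k P' T -> measurable A ->
  P [set w | A (\prod_(j in C) (X j w : R[i]))] = P' (T @^-1` A).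
Proof.
move=> Xiid Ck [d1 [Om1 [P1 [Y [Yiid [_ TY]]]]]] mA; rewrite TY//.
pose S : {set 'I_k} := finset.finset (fun=> true).
have -> : [set w | A (\prod_(i < k) (Y i w : R[i]))] = [set w | A (\prod_(i in S) (Y i w : R[i]))].
  have e w : \prod_(i < k) (Y i w : R[i]) = \prod_(i in S) (Y i w : R[i]).
    by apply: eq_bigl => i; rewrite inE.
  by apply/seteqP; split => w /=; rewrite e.
by apply: (iid_prod_law Xiid Yiid) => //; rewrite Ck -[LHS]card_ord; apply: eq_card => i; rewrite !inE.
Qed.

Lemma product_law_unique k
    d (Om : measurableType d) (P : probability Om R) (X : Om -> borel R[i])
    d' (Om' : measurableType d') (P' : probability Om' R) (T : Om' -> borel R[i]) (A : set (borel R[i])) :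
  has_product_law L k P X -> has_product_law L k P' T -> measurable A ->
  P (X @^-1` A) = P' (T @^-1` A).
Proof.
move=> [d1 [Om1 [P1 [Y [Yiid [_ XY]]]]]] TL mA; rewrite XY//.
pose S : {set 'I_k} := finset.finset (fun=> true).
rewrite -(product_law_block (C := S) Yiid _ TL mA).
  have e w : \prod_(i < k) (Y i w : R[i]) = \prod_(i in S) (Y i w : R[i]).
    by apply: eq_bigl => i; rewrite inE.
  by congr (P1 _); apply/seteqP; split => w /=; rewrite e.
by rewrite -[RHS]card_ord; apply: eq_card => i; rewrite !inE.
Qed.

End product_laws.

Section limit_process.
Context (R : realType) (theta : R) (L : probability (borel R[i]) R).
Hypothesis theta0 : 0 < theta.
Hypothesis L0 : L [set (0 : R[i])] = 0%E.
Context d (Om : measurableType d) (Q : probability Om R)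
  (a : nat -> Om -> nat) (T : nat -> nat -> Om -> borel R[i]).
Hypothesis lim : limit_variables theta L Q a T.

Let T_law k p : (0 < k)%N -> (0 < p)%N -> has_product_law L k Q (T k p).
Proof. by case: lim => _ h _; exact: h. Qed.

Lemma limit_T_measurable k p : (0 < k)%N -> (0 < p)%N -> measurable_fun setT (T k p).
Proof. by move=> k0 p0; have [? [? [? [? [_ []]]]]] := T_law k0 p0. Qed.

Lemma limit_a_preimage k (B : set nat) : (0 < k)%N -> measurable (a k @^-1` B).
Proof. by move=> k0; case: lim => h _ _; exact: (preimageT_measurable (h k k0).1). Qed.

(** Distinct products are independent of each other and of the counts [a k]; the
    coordinates that share a product are gathered at their representative. *)
Lemma limit_boxes q (k p c : 'I_q -> nat) (pi : 'I_q -> 'I_q) (B : 'I_q -> set (borel R[i])) :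
  (forall r, 0 < k r)%N -> (forall r, 0 < p r)%N -> (forall r, pi (pi r) = pi r) ->
  (forall r r', ((k r, p r) == (k r', p r')) = (pi r == pi r')) ->
  (forall r, measurable (B r)) ->
  (Q ([set w | forall r, (c r <= a (k r) w)%N] `&` [set w | forall r, B r (T (k r) (p r) w)]) =
   Q [set w | forall r, (c r <= a (k r) w)%N] *
   \prod_(b | pi b == b) Q [set w | forall r, pi r = b -> B r (T (k b) (p b) w)])%E.
Proof.
move=> k0 p0 piK kp mB; have [_ _ ind] := lim.
pose A (i : nat + nat * nat) : set Om := match i with
  | inl kk => [set w | forall r, k r = kk -> (c r <= a kk w)%N]
  | inr (kk, pp) => [set w | forall r, (k r, p r) = (kk, pp) -> B r (T kk pp w)]
  end.
pose s1 : seq (nat + nat * nat) := undup [seq inl (k r) | r <- enum 'I_q].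
pose s2 : seq (nat + nat * nat) := [seq inr (k b, p b) | b <- enum 'I_q & pi b == b].
have mem1 r : inl (k r) \in s1 by rewrite mem_undup map_f// mem_enum.
have base r : (k (pi r), p (pi r)) = (k r, p r) by apply/eqP; rewrite kp piK.
have mem2 r : inr (k r, p r) \in s2.
  by rewrite -base; apply/mapP; exists (pi r) => //; rewrite mem_filter piK eqxx mem_enum.
have u : uniq (s1 ++ s2).
  rewrite cat_uniq undup_uniq /=; apply/andP; split.
    by apply/hasP => -[i /mapP[b _ ->]]; rewrite mem_undup => /mapP[].
  rewrite map_inj_in_uniq; first by apply: filter_uniq; exact: enum_uniq.
  move=> b b'.
  rewrite !mem_filter => /andP[/eqP eb _] /andP[/eqP eb' _] [e1 e2].
  by apply/eqP; rewrite -eb -eb' -kp e1 e2.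
have := mutually_independent_cat (A := A) ind u.
have e1 : \bigcap_(i in [set` s1]) A i = [set w | forall r, (c r <= a (k r) w)%N].
  apply/seteqP; split => w h.
    by move=> r; exact: (h (inl (k r)) (mem1 r) r).
  move=> i /=; rewrite mem_undup => /mapP[r _ ->] r' e /=; rewrite -e; exact: h.
have e2 : \bigcap_(i in [set` s2]) A i = [set w | forall r, B r (T (k r) (p r) w)].
  apply/seteqP; split => w h.
    by move=> r; exact: (h (inr (k r, p r)) (mem2 r) r).
  move=> i /= /mapP[b _ ->] r' [<- <-]; exact: h.
rewrite e1 e2 => ->.
  congr (_ * _)%E; rewrite big_map big_filter big_enum_cond /=.
  apply: eq_bigr => b /eqP pb; congr (Q _); apply/seteqP; split => w h r.
    by move=> e; apply: h; rewrite -base e.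
  move=> e; apply: h; rewrite -[RHS]pb; apply/eqP; rewrite -kp; exact/eqP.
move=> i; rewrite mem_cat => /orP[|].
  rewrite mem_undup => /mapP[r _ ->]; split; first exact: k0.
  exists [set n | forall r', k r' = k r -> (c r' <= n)%N]; first by [].
  by rewrite setTI.
move=> /mapP[b _ ->]; split; first by apply/andP; split; [exact: k0|exact: p0].
exists [set x | forall r', (k r', p r') = (k b, p b) -> B r' x].
  rewrite (_ : [set x | _] = [set x | forall r', (if (k r', p r') == (k b, p b) then B r' else setT) x]).
    by apply: measurable_forall => r; case: ifP.
  apply/seteqP; split => x h r.
    by case: eqP => // e; exact: h.
  by move=> e; have := h r; rewrite e eqxx.
by rewrite setTI.
Qed.

(** The points of the limit process read along the pattern [y], the distinct
    products being numbered by the representatives of their classes. *)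
Definition limit_row q (y : pattern q) (w : Om) : 'rV[R[i]]_q :=
  \row_r croot (pat_len y r) (T (pat_len y r) (pat_ker y r).+1 w) (pat_pos y r).

Lemma limit_row_measurable q (y : pattern q) : valid_pattern y ->
  measurable_fun setT (limit_row y : Om -> borel 'rV[R[i]]_q).
Proof.
move=> vy; apply: row_measurable => r.
apply: (measurableT_comp (@croot_measurable R _ _)).
exact: limit_T_measurable (pat_len_gt0 vy r) _.
Qed.

(** Any family of products with the coincidences of [y] gives a tuple with the
    same law; it is compared on boxes before the roots are taken. The event [E]
    will fix the permutation, or the counts [a k]. *)
Lemma limit_row_law q (y : pattern q) d' (Om' : measurableType d') (P : probability Om' R)
    (E : set Om') (X : 'I_q -> Om' -> borel R[i]) (c : R) :
  valid_pattern y -> measurable E -> (forall r, measurable_fun setT (X r)) -> 0 <= c ->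
  (forall B : 'I_q -> set (borel R[i]), (forall r, measurable (B r)) ->
    (P (E `&` [set w | forall r, B r (X r w)]) =
     c%:E * \prod_(b | pat_ker y b == b)
       Q [set w | forall r, pat_ker y r = b -> B r (T (pat_len y b) b.+1 w)])%E) ->
  forall A : set (borel 'rV[R[i]]_q), measurable A ->
  (P (E `&` [set w | A (\row_r croot (pat_len y r) (X r w) (pat_pos y r))]) =
   c%:E * Q ((limit_row y : Om -> borel 'rV[R[i]]_q) @^-1` A))%E.
Proof.
move=> vy mE mX c0 box A mA.
pose f (v : borel 'rV[R[i]]_q) : borel 'rV[R[i]]_q :=
  \row_r croot (pat_len y r) (v 0 r) (pat_pos y r).
have mf : measurable_fun setT f.
  apply: row_measurable => r.
  exact: (measurableT_comp (@croot_measurable R _ _) (coord_measurable 0 r)).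
have mfA : measurable (f @^-1` A) by exact: (preimageT_measurable mf mA).
have mT r : measurable_fun setT (T (pat_len y r) (pat_ker y r).+1).
  exact: limit_T_measurable (pat_len_gt0 vy r) _.
have := @law_on_boxes _ _ _ _ P E X _ _ Q (fun r => T (pat_len y r) (pat_ker y r).+1) c
  mE mX mT c0.
have fE (Z : 'I_q -> R[i]) : f (\row_r Z r) = \row_r croot (pat_len y r) (Z r) (pat_pos y r).
  by apply/rowP => r; rewrite !mxE.
have main B : (forall r, measurable (B r)) ->
   (P (E `&` [set w | forall r, B r (X r w)]) =
     c%:E * Q [set w | forall r, B r (T (pat_len y r) (pat_ker y r).+1 w)])%E.
  move=> mB; rewrite box//; congr (_ * _)%E.
  have kp r r' : ((pat_len y r, (pat_ker y r).+1) == (pat_len y r', (pat_ker y r').+1)) =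
      (pat_ker y r == pat_ker y r').
    rewrite xpair_eqE eqSS -val_eqE andb_idl// => /eqP/val_inj e.
    by rewrite -(pat_len_ker vy r) e (pat_len_ker vy).
  have := limit_boxes (p := fun r => (pat_ker y r).+1) (fun=> 0%N) (pat_len_gt0 vy) (fun r => ltn0Sn _) (pat_ker_idem vy) kp mB.
  rewrite (_ : [set w | _] = setT) ?setTI; last by apply/seteqP; split.
  rewrite probability_setT mul1e => ->; apply: eq_bigr => b /eqP pb.
  by rewrite pb.
move=> /(_ main _ mfA).
rewrite (_ : E `&` _ = E `&` [set w | A (\row_r croot (pat_len y r) (X r w) (pat_pos y r))]).
  move=> ->; congr (_ * Q _)%E; apply/seteqP; split => w /=.
    by rewrite [X in A X -> _]fE.
  by rewrite [X in _ -> A X]fE.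
apply/seteqP; split => w /=.
  by move=> [h]; rewrite [X in A X -> _]fE.
by move=> [h]; rewrite -[X in A X -> _]fE.
Qed.

End limit_process.

(** * Expected measures as mixtures over patterns *)

Section limit_mixture.
Context (R : realType) (theta : R) (L : probability (borel R[i]) R).
Hypothesis theta0 : 0 < theta.
Hypothesis L0 : L [set (0 : R[i])] = 0%E.
Context d (Om : measurableType d) (Q : probability Om R)
  (a : nat -> Om -> nat) (T : nat -> nat -> Om -> borel R[i]).
Hypothesis lim : limit_variables theta L Q a T.
Local Open Scope ereal_scope.

Let zero_set : set Om := \bigcup_k \bigcup_p (T k.+1 p.+1 @^-1` [set (0 : R[i])]%R).

Let zero_preimage k p : measurable (T k.+1 p.+1 @^-1` [set (0 : R[i])]%R) /\
  Q (T k.+1 p.+1 @^-1` [set (0 : R[i])]%R) = 0.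
Proof.
have m0 : measurable ([set 0%R] : set (borel R[i])) by exact: measurable_set1C.
split; first exact: (preimageT_measurable (limit_T_measurable lim (ltn0Sn k) (ltn0Sn p)) m0).
case: lim => _ /(_ k.+1 p.+1 isT isT) [d1 [Om1 [P1 [Y [Yiid [_ TY]]]]]] _.
rewrite TY//.
pose G : set Om1 := [set w | forall i, (~` [set 0%R] : set (borel R[i])) (Y i w)].
have mG : measurable G.
  apply: measurable_forall => i; apply: (preimageT_measurable (Yiid.1 i).1).
  exact: measurableC.
have PG : P1 G = 1.
  rewrite (iid_box (A := fun=> ~` ([set 0%R] : set (borel R[i]))) Yiid); last first.
    by move=> j; exact: measurableC.
  by rewrite big1// => j _; rewrite probability_setC// L0 sube0.
have -> : [set w | [set (0 : R[i])]%R (\prod_(i < k.+1) (Y i w : R[i]))%R] = ~` G.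
  apply/seteqP; split => w /=.
    move=> /eqP/prodf_eq0[i _ /eqP Yi0] /(_ i); exact.
  move=> nG; apply/eqP; apply: contrapT => /negP; rewrite prodf_seq_neq0 => /allP h; apply: nG => i /=.
  by apply/eqP; apply: (h i); rewrite mem_index_enum.
by rewrite probability_setC// PG subee.
Qed.

Let zero_set_measurable : measurable zero_set.
Proof.
by apply: bigcup_measurable => k _; apply: bigcup_measurable => p _; have [] := zero_preimage k p.
Qed.

Let zero_set_null : Q zero_set = 0.
Proof.
apply: (measure_negligible zero_set_measurable).
apply: negligible_bigcup => k; apply: negligible_bigcup => p.
by have [m0 P0] := zero_preimage k p; exists (T k.+1 p.+1 @^-1` [set (0 : R[i])]%R); split.
Qed.

Variable q : nat.
Local Notation label := {ffun 'I_q -> nat}.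

Definition labelled_row (y : pattern q) (p : label) (w : Om) : 'rV[R[i]]_q :=
  \row_r croot (pat_len y r) (T (pat_len y r) (p r) w) (pat_pos y r).

Definition labels (y : pattern q) : set label :=
  [set p | (forall r, (0 < p r)%N) /\ compatible y p].

(** The labels are actually present in the limit process. *)
Definition labels_event (y : pattern q) (p : label) : set Om :=
  [set w | forall r, (p r <= a (pat_len y r) w)%N].

(** When all products are nonzero, a point of the limit is a length, a label and
    the number of a root, so that a tuple of distinct points is a pattern
    together with compatible labels. *)
Lemma distinct_tuples_limit (w : Om) (A : set (borel 'rV[R[i]]_q)) : ~ zero_set w ->
  distinct_tuples_measure
    [set i : nat * nat * R[i] |
      [/\ (0 < i.1.1)%N, (0 < i.1.2 <= a i.1.1 w)%N & (i.2 ^+ i.1.1)%R = T i.1.1 i.1.2 w]]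
    (fun i => i.2) A =
  \esum_(yp in [set y | valid_pattern y] `*`` labels)
    (\1_(labels_event yp.1 yp.2 `&` (labelled_row yp.1 yp.2 : Om -> borel 'rV[R[i]]_q) @^-1` A) w)%:E.
Proof.
move=> nz.
have T0 k p : (0 < k)%N -> (0 < p)%N -> (T k p w : R[i]) != 0%R.
  case: k p => [//|k] [//|p] _ _; apply/eqP => h; apply: nz.
  by exists k => //; exists p.
pose PP := [set yp : pattern q * label | ([set y | valid_pattern y] `*`` labels) yp /\ labels_event yp.1 yp.2 w].
pose e (yp : pattern q * label) : {ffun 'I_q -> nat * nat * R[i]} :=
  [ffun r => (pat_len yp.1 r, yp.2 r, croot (pat_len yp.1 r) (T (pat_len yp.1 r) (yp.2 r) w) (pat_pos yp.1 r))].
have be : set_bij PP [set j : {ffun 'I_q -> nat * nat * R[i]} | injective j /\ forall r,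
    [set i : nat * nat * R[i] |
      [/\ (0 < i.1.1)%N, (0 < i.1.2 <= a i.1.1 w)%N & (i.2 ^+ i.1.1)%R = T i.1.1 i.1.2 w]] (j r)] e.
  split.
  - move=> [y p] [/= [vy [p0 /forallP cp]] pa]; split.
      move=> r r'; rewrite !ffunE /= => ee.
      have e1 : pat_len y r = pat_len y r' := congr1 (fun x => x.1.1) ee.
      have e2 : p r = p r' := congr1 (fun x => x.1.2) ee.
      have e3 : croot _ _ _ = croot _ _ _ := congr1 snd ee.
      have pk : pat_ker y r = pat_ker y r'.
        by apply/eqP; have /forallP/(_ r')/eqP <- := cp r; rewrite e1 e2.
      apply: (pat_inj vy pk); rewrite -e1 -e2 in e3.
      apply: (croot_inj _ _ e3); first exact: pat_pos_lt.
      by rewrite e1; exact: pat_pos_lt.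
    move=> r; rewrite ffunE /=; split; first exact: pat_len_gt0.
      by rewrite p0 pa.
    by rewrite crootK ?pat_len_gt0// T0// pat_len_gt0.
  - have yE (y : pattern q) (p : label) : valid_pattern y -> compatible y p ->
        y = pattern_of (fun kp : nat * nat => kp.1) (fun r => (pat_len y r, p r)) (pat_pos y).
      move=> vy /forallP cp; apply/esym/(pattern_ofP _ _ _ vy); split => // r r'.
      by have /forallP/(_ r')/eqP := cp r.
    move=> [y p] [y' p'] /set_mem[/= [vy [p0 cp]] _] /set_mem[/= [vy' [p0' cp']] _] eE.
    have er r := congr1 (fun f : {ffun 'I_q -> nat * nat * R[i]} => f r) eE.
    have pE r : p r = p' r by have := er r; rewrite !ffunE /= => /(congr1 (fun x => x.1.2)).
    have kE r : pat_len y r = pat_len y' r by have := er r; rewrite !ffunE /= => /(congr1 (fun x => x.1.1)).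
    have lE r : pat_pos y r = pat_pos y' r.
      have := er r; rewrite !ffunE /= => /(congr1 snd) /=; rewrite -kE -pE => h.
      by apply: (croot_inj _ _ h); [exact: pat_pos_lt|rewrite kE; exact: pat_pos_lt].
    congr pair; last exact/ffunP.
    rewrite (yE y p vy cp) (yE y' p' vy' cp').
    have -> : (fun r => (pat_len y' r, p' r)) = (fun r => (pat_len y r, p r)).
      by apply/funext => r; rewrite kE pE.
    by rewrite /pattern_of; congr (_, _, _); apply/ffunP => r; rewrite !ffunE.
  - move=> j [ji jJ].
    pose c r : nat * nat := (j r).1.
    have /choice[l hl] : forall r, exists l, (l < (c r).1)%N /\ (j r).2 = croot (c r).1 (T (c r).1 (c r).2 w) l.
      move=> r; have [h1 /andP[h2 _] h3] := jJ r.
      by have [l l1 l2] := crootP h1 (T0 _ _ h1 h2) h3; exists l.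
    pose y := pattern_of (fun kp : nat * nat => kp.1) c l.
    have len_y r : pat_len y r = (c r).1 by exact: pattern_of_len.
    have pos_y r : pat_pos y r = l r by rewrite /pat_pos /= ffunE.
    have vy : valid_pattern y.
      rewrite valid_pattern_of.
      - apply/forallP => r; apply/forallP => r'; apply/implyP => /andP[/eqP e1 /eqP e2].
        apply/eqP/ji; rewrite [j r]surjective_pairing [j r']surjective_pairing.
        congr pair; first exact: e1.
        by rewrite (hl r).2 (hl r').2 e1 e2.
      - by move=> r; have [] := jJ r.
      - by move=> r; have [] := hl r.
    have pc r : (pat_len y r, (c r).2) = c r by rewrite len_y -surjective_pairing.
    exists (y, [ffun r => (c r).2]).
      split; last by move=> r /=; rewrite ffunE len_y; have [_ /andP[]] := jJ r.
      split => //=; split; first by move=> r; rewrite ffunE; have [_ /andP[]] := jJ r.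
      have pc' s : (pat_len y s, [ffun r => (c r).2] s) = c s by rewrite ffunE.
      apply/forallP => r; apply/forallP => r'; rewrite !pc'.
      by rewrite -(kernel_eq c).
    apply/ffunP => r; rewrite ffunE /= ffunE pc.
    by rewrite len_y pos_y -(hl r).2 -!surjective_pairing.
rewrite /distinct_tuples_measure (reindex_esum _ _ _ _ be).
rewrite (_ : PP = ([set y | valid_pattern y] `*`` labels) `&` [set yp | labels_event yp.1 yp.2 w]); last first.
  by apply/seteqP; split.
rewrite esum_mkcondr; apply: eq_esum => -[y p] _ /=.
have -> : \row_r (e (y, p) r).2 = labelled_row y p w.
  by apply/rowP => r; rewrite !mxE ffunE.
rewrite diracE indicE in_setI.
have -> : (w \in labels_event y p) = ((y, p) \in [set yp : pattern q * label | labels_event yp.1 yp.2 w]).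
  by apply/idP/idP => /set_mem h; apply/mem_set.
have -> : (w \in (labelled_row y p : Om -> borel 'rV[R[i]]_q) @^-1` A) = (labelled_row y p w \in A).
  by apply/idP/idP => /set_mem h; apply/mem_set.
by case: (_ \in _).
Qed.

Lemma labels_event_measurable y p : valid_pattern y -> measurable (labels_event y p).
Proof.
move=> vy; apply: measurable_forall => r.
exact: (limit_a_preimage lim (fun n => (p r <= n)%N) (pat_len_gt0 vy r)).
Qed.

Lemma labelled_row_measurable y p : valid_pattern y -> labels y p ->
  measurable_fun setT (labelled_row y p : Om -> borel 'rV[R[i]]_q).
Proof.
move=> vy [p0 _]; apply: row_measurable => r.
apply: (measurableT_comp (@croot_measurable R _ _)).
exact: (limit_T_measurable lim (pat_len_gt0 vy r) (p0 r)).
Qed.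

(** Replaces the labels by those of [limit_row], which depend on the pattern
    only. *)
Lemma labelled_row_law y p (A : set (borel 'rV[R[i]]_q)) :
  valid_pattern y -> labels y p -> measurable A ->
  Q (labels_event y p `&` (labelled_row y p : Om -> borel 'rV[R[i]]_q) @^-1` A) =
  Q (labels_event y p) * Q ((limit_row T y : Om -> borel 'rV[R[i]]_q) @^-1` A).
Proof.
move=> vy [p0 /forallP cp] mA.
have mE := labels_event_measurable p vy.
have [c c0 cE] : exists2 c : R, (0 <= c)%R & Q (labels_event y p) = c%:E.
  exists (fine (Q (labels_event y p))); first exact: fine_ge0.
  by rewrite fineK// fin_num_measure.
rewrite cE -(@limit_row_law _ _ _ _ _ _ _ _ lim _ _ _ _ Q (labels_event y p)
  (fun r => T (pat_len y r) (p r)) c vy mE _ c0 _ _ mA)//.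
  by move=> r; exact: (limit_T_measurable lim (pat_len_gt0 vy r) (p0 r)).
move=> B mB; rewrite -cE.
have kp r r' : ((pat_len y r, p r) == (pat_len y r', p r')) = (pat_ker y r == pat_ker y r').
  by have /forallP/(_ r')/eqP := cp r.
rewrite (limit_boxes lim p (pat_len_gt0 vy) p0 (pat_ker_idem vy) kp mB); congr (_ * _).
apply: eq_bigr => b _.
pose Bb : set (borel R[i]) := [set x | forall r, pat_ker y r = b -> B r x].
have mBb : measurable Bb.
  rewrite /Bb (_ : [set x | _] = [set x | forall r, (if pat_ker y r == b then B r else setT) x]).
    by apply: measurable_forall => r; case: ifP.
  apply/seteqP; split => x h r; first by case: eqP => // e; exact: h.
  by move=> e; have := h r; rewrite e eqxx.
case: lim => _ TL _.
exact: (product_law_unique (TL _ _ (pat_len_gt0 vy b) (p0 b))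
  (TL _ b.+1 (pat_len_gt0 vy b) (ltn0Sn _)) mBb).
Qed.

Lemma Poisson_moment_count (ks : seq nat) (m : nat) : all (fun k => 0 < k <= m)%N ks ->
  Poisson_moment theta ks = (\prod_(k < m) (theta / k.+1%:R) ^+ count_mem k.+1 ks)%R.
Proof.
elim: ks => [|k ks IH] /=.
  by rewrite /Poisson_moment big_nil big1// => i _; rewrite expr0.
move=> /andP[/andP[k0 km] h]; rewrite /Poisson_moment big_cons -/(Poisson_moment theta ks) IH//.
under [RHS]eq_bigr do rewrite exprD; rewrite big_split /=; congr (_ * _)%R.
have km' : (k.-1 < m)%N by rewrite prednK.
rewrite (bigD1 (Ordinal km')) //= prednK// eqxx expr1 big1 ?mulr1// => i ik.
rewrite (_ : (k == i.+1) = false) ?expr0//; apply: contra_neqF ik => /eqP e.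
by apply: val_inj; rewrite /= e.
Qed.

(** The expected number of compatible labels: the numbers [a k] are
    independent, and a Poisson variable has falling factorial moments equal to
    the powers of its mean. *)
Lemma labels_mean y : valid_pattern y ->
  \esum_(p in labels y) Q (labels_event y p) = (Poisson_moment theta (pat_lengths y))%:E.
Proof.
move=> vy; have [a_law _ ind] := lim.
pose m := \max_r pat_len y r.
have len_m r : (pat_len y r <= m)%N by exact: leq_bigmax.
pose cnt (k : 'I_m) := count_mem k.+1 (pat_lengths y).
pose g (k : 'I_m) (n : nat) (w : Om) : \bar R := ((n ^_ cnt k)%:R * \1_(a k.+1 @^-1` [set n]) w)%:E.
have ma (k : 'I_m) n : measurable (a k.+1 @^-1` [set n]) by exact: (limit_a_preimage lim).
transitivity (\int[Q]_w \prod_(k < m) ((a k.+1 w) ^_ (cnt k))%:R%:E).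
  transitivity (\int[Q]_w \esum_(p in labels y) (\1_(labels_event y p) w)%:E).
    rewrite integral_esum; first last.
    - by move=> p w; rewrite lee_fin.
    - move=> p _; apply/measurable_EFinP; apply: measurable_indic; exact: labels_event_measurable.
    apply: eq_esum => p _; rewrite integral_indic ?setIT//; exact: labels_event_measurable.
  congr (integral _ _ _); apply/funext => w.
  pose n k := a k w; pose M := \max_r n (pat_len y r).
  have n_M r : (n (pat_len y r) <= M)%N by exact: (leq_bigmax (F := fun r => n (pat_len y r))).
  (* The number of compatible labels that are present is a product of falling
     factorials of the counts. *)
  have := labels_count vy len_m n_M; set C := [set p | _]%SET => cardC.
  rewrite prodEFin -natr_prod -cardC.
  pose e (p : {ffun 'I_q -> 'I_M.+1}) : label := [ffun r => p r : nat].
  have be : set_bij [set p | p \in C] (labels y `&` [set p | labels_event y p w]) e.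
    have ce p : compatible y (e p) = compatible y p.
      apply: eq_forallb => r; apply: eq_forallb => r'; rewrite !xpair_eqE !ffunE.
      by rewrite -val_eqE.
    split.
    - move=> p /=; rewrite inE => /andP[/forallP h1 h2]; split.
        split; last by rewrite ce.
        by move=> r; rewrite ffunE; case/andP: (h1 r).
      by move=> r; rewrite ffunE; case/andP: (h1 r).
    - move=> p p' _ _ ee; apply/ffunP => r; apply: val_inj.
      by have := congr1 (fun f : label => f r) ee; rewrite !ffunE.
    - move=> p [[p0 cp] pa].
      have pM r : (p r < M.+1)%N by rewrite ltnS (leq_trans (pa r))// n_M.
      have pe : e [ffun r => Ordinal (pM r)] = p by apply/ffunP => r; rewrite !ffunE.
      exists [ffun r => Ordinal (pM r)] => //=; rewrite inE -ce pe cp andbT.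
      by apply/forallP => r; rewrite ffunE /= p0 pa.
  rewrite (_ : \esum_(p in _) _ = \esum_(p in labels y `&` [set p | labels_event y p w]) (1 : \bar R)).
    rewrite (esum_finType_image _ be)// -sum1_card natr_sum -sumEFin.
    exact: eq_bigr.
  rewrite [RHS]esum_mkcondr; apply: eq_esum => p _; rewrite indicE.
  have -> : (w \in labels_event y p) = (p \in [set p : label | labels_event y p w]).
    by apply/idP/idP => /set_mem h; apply/mem_set.
  by case: (_ \in _).
(* Each factor is expanded over the values of its count, so that independence
   applies to events. *)
have gE w (k : 'I_m) : ((a k.+1 w) ^_ (cnt k))%:R%:E = \esum_(n in [set: nat]) g k n w.
  rewrite (_ : \esum_(n in _) _ = \esum_(n in [set a k.+1 w]) ((a k.+1 w) ^_ (cnt k))%:R%:E).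
    by rewrite esum_set1// lee_fin.
  rewrite [RHS]esum_mkcond; apply: eq_esum => n _; rewrite /g indicE.
  case: ifPn => [/set_mem -> |].
    by rewrite mem_set// mulr1.
  move=> h; rewrite memNset ?mulr0// => h'; move: h; rewrite -h' => /negP; apply.
  exact: mem_set.
have g0 k n w : 0 <= g k n w by rewrite lee_fin mulr_ge0.
under eq_integral do under eq_bigr do rewrite gE.
under eq_integral do rewrite -esum_ffun_prod//.
rewrite integral_esum; first last.
- by move=> n w; apply: prode_ge0.
- move=> n _; rewrite /g; under eq_fun do rewrite prodEFin.
  apply/measurable_EFinP; apply: measurable_prod => k.
  by move=> _; apply: measurable_funM; [exact: measurable_cst|exact: measurable_indic].
rewrite (Poisson_moment_count (m := m)); last first.
  apply/allP => _ /mapP[r _ ->]; rewrite pat_len_gt0//=.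
pose h (k : 'I_m) (n : nat) : \bar R := (n ^_ cnt k)%:R%:E * poisson_prob (theta / k.+1%:R) 0 [set n].
have h0 k n : 0 <= h k n by rewrite mule_ge0// lee_fin.
rewrite -prodEFin; under [RHS]eq_bigr => k _.
  rewrite -poisson_ffact_moment; last by rewrite divr_gt0.
  over.
rewrite -(esum_ffun_prod (g := h))//; apply: eq_esum => n _.
have aQ (k : 'I_m) : Q (a k.+1 @^-1` [set n k]) = poisson_prob (theta / k.+1%:R) 0 [set n k].
  by have [_ ->] := a_law k.+1 (ltn0Sn k).
under [RHS]eq_bigr => k _ do rewrite /h -aQ.
rewrite big_split /= prodEFin.
have -> : \prod_(k < m) Q (a k.+1 @^-1` [set n k]) = Q [set w | forall k : 'I_m, (a k.+1 @^-1` [set n k]) w].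
  apply/esym; apply: (mutually_independent_fin (f := fun k : 'I_m => inl k.+1 : (nat + nat * nat)%type) ind).
    by move=> i j [] /val_inj.
  by move=> k; split => //; exists [set n k] => //; rewrite setTI.
have mall : measurable [set w | forall k : 'I_m, (a k.+1 @^-1` [set n k]) w].
  exact: measurable_forall.
rewrite -[in RHS](setIT [set w | _]) -integral_indic// -ge0_integralZl//; first last.
- by rewrite lee_fin; apply: prodr_ge0.
- exact/measurable_EFinP/measurable_indic.
apply: eq_integral => w _; rewrite /g prodEFin big_split /= -EFinM; congr (_ * _)%:E.
rewrite indicE; case: (boolP (w \in _)) => [/set_mem hw|hw].
  by rewrite big1// => k _; rewrite indicE mem_set//; exact: hw.
have /existsNP[k hk] : ~ forall k : 'I_m, (a k.+1 @^-1` [set n k]) w.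
  by move=> hh; move/negP: hw; apply; exact: mem_set.
by rewrite (bigD1 k)//= indicE memNset// mul0r.
Qed.

(** The labels that are present are independent of the products that they
    number: given the pattern, only their expected number matters. *)
Lemma mu_tilde_infty_mixture (A : set (borel 'rV[R[i]]_q)) : measurable A ->
  mu_tilde_infty Q a T A =
  \esum_(y in [set y : pattern q | valid_pattern y])
    (Poisson_moment theta (pat_lengths y))%:E * Q ((limit_row T y : Om -> borel 'rV[R[i]]_q) @^-1` A).
Proof.
move=> mA; rewrite /mu_tilde_infty.
have mD yp : ([set y | valid_pattern y] `*`` labels) yp ->
    measurable (labels_event yp.1 yp.2 `&` (labelled_row yp.1 yp.2 : Om -> borel 'rV[R[i]]_q) @^-1` A).
  move=> [vy py]; apply: measurableI; first exact: labels_event_measurable.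
  exact: (preimageT_measurable (labelled_row_measurable vy py) mA).
rewrite (@integral_eq_off_null _ _ _ Q zero_set _
  (fun w => \esum_(yp in [set y | valid_pattern y] `*`` labels)
    (\1_(labels_event yp.1 yp.2 `&` (labelled_row yp.1 yp.2 : Om -> borel 'rV[R[i]]_q) @^-1` A) w)%:E)
  zero_set_measurable zero_set_null); first last.
- by move=> w nz; exact: distinct_tuples_limit.
- by move=> w; apply: esum_ge0 => yp _; rewrite lee_fin.
- by move=> w; apply: esum_ge0 => j _; rewrite lee_fin.
rewrite integral_esum; first last.
- by move=> yp w; rewrite lee_fin.
- by move=> yp yp1; apply/measurable_EFinP; apply: measurable_indic; exact: mD.
transitivity (\esum_(y in [set y : pattern q | valid_pattern y]) \esum_(p in labels y)
    (Q (labels_event y p) * Q ((limit_row T y : Om -> borel 'rV[R[i]]_q) @^-1` A))).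
  rewrite esum_esum; last by move=> y p _ _; rewrite mule_ge0.
  apply: eq_esum => -[y p] yp1; rewrite integral_indic ?setIT//; last exact: mD.
  by case: yp1 => vy py; exact: labelled_row_law.
apply: eq_esum => y vy; rewrite esumZr//.
by rewrite labels_mean.
Qed.

End limit_mixture.

Section model_mixture.
Context (R : realType) (theta : R) (L : probability (borel R[i]) R).
Hypothesis theta0 : 0 < theta.
Hypothesis L0 : L [set (0 : R[i])] = 0%E.
Context (N q : nat).
Local Open Scope ereal_scope.

Lemma sum_over_patterns (t : 'S_N) (F : pattern q -> \bar R) : (forall y, 0 <= F y) ->
  \sum_(j : {ffun 'I_q -> 'I_N} | injectiveb j) F (perm_pattern t j) =
  \esum_(y in [set y : pattern q | valid_pattern y])
    (tuples_count (fun C : {set 'I_N} => #|C|) (porbits t) (pat_lengths y))%:R%:E * F y.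
Proof.
move=> F0; pose G j y : \bar R := if perm_pattern t j == y then F y else 0.
have G0 j y : 0 <= G j y by rewrite /G; case: ifP.
transitivity (\sum_(j : {ffun 'I_q -> 'I_N} | injectiveb j)
    \esum_(y in [set y : pattern q | valid_pattern y]) G j y).
  apply: eq_bigr => j ij; transitivity (\esum_(y in [set perm_pattern t j]) F y).
    by rewrite esum_set1.
  rewrite esum_mkcond [RHS]esum_mkcond; apply: eq_esum => y _; rewrite /G.
  have [<-|ne] := eqVneq (perm_pattern t j) y.
    by rewrite !mem_set //= perm_pattern_valid.
  rewrite if_same memNset// => /= e; by rewrite e eqxx in ne.
rewrite -esum_sum; last by move=> y j _ _; exact: G0.
apply: eq_esum => y vy; rewrite -(perm_pattern_count t vy) -sum1dep_card natr_sum -sumEFin.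
rewrite ge0_sume_distrl; last by move=> j _; rewrite lee_fin.
rewrite big_mkcond [RHS]big_mkcond; apply: eq_bigr => j _; rewrite /G mul1e.
case: eqP => [e|_]; last by rewrite if_same.
by rewrite -(perm_pattern_valid t) e vy.
Qed.

Context d (Om : measurableType d) (P : probability Om R)
  (M : Om -> borel 'M[R[i]]_N).
Hypothesis M_law : follows_ewens_matrix theta L P M.
Context d2 (Om2 : measurableType d2) (Q : probability Om2 R)
  (a : nat -> Om2 -> nat) (T : nat -> nat -> Om2 -> borel R[i]).
Hypothesis lim : limit_variables theta L Q a T.

(** Given the permutation, the tuple indexed by [j] is read along the pattern of
    [j], with products over disjoint cycles; by [limit_row_law] it has the law
    found in the limit. The number of tuples with a given pattern then has the
    expectation computed in [ewens_tuples]. *)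
Lemma mu_tilde_mixture (A : set (borel 'rV[R[i]]_q)) : measurable A ->
  mu_tilde P M A =
  \esum_(y in [set y : pattern q | valid_pattern y])
    (Poisson_moment theta (pat_lengths y) * mass_ratio theta N (sumn (pat_lengths y)))%:E *
    Q ((limit_row T y : Om2 -> borel 'rV[R[i]]_q) @^-1` A).
Proof.
move=> mA; case: M_law => d' [Om' [P' [s [z [s_law z_law sz_ind ML]]]]].
rewrite (mu_tilde_model L0 s_law z_law sz_ind ML mA).
pose F (y : pattern q) := Q ((limit_row T y : Om2 -> borel 'rV[R[i]]_q) @^-1` A).
have F0 y : 0 <= F y by [].
have ew0 (t : 'S_N) : (0 <= ewens theta t)%R.
  by rewrite divr_ge0 ?sumr_ge0// => *; rewrite exprn_ge0// ltW.
have part (j : {ffun 'I_q -> 'I_N}) (t : 'S_N) : injective j ->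
    P' (s @^-1` [set t] `&` (fun w => perm_eigen_row (s w) (fun k => z k w) j) @^-1` A) =
    (ewens theta t)%:E * F (perm_pattern t j).
  move=> ij.
  pose y := perm_pattern t j; have vy : valid_pattern y by rewrite perm_pattern_valid; exact/injectiveP.
  have len_y r : pat_len y r = #|porbit t (j r)| by exact: pattern_of_len.
  have pos_y r : pat_pos y r = cycle_pos t (j r) by exact: ffunE.
  have ker_y r r' : (porbit t (j r) == porbit t (j r')) = (pat_ker y r == pat_ker y r').
    by rewrite -(kernel_eq (fun r => porbit t (j r))).
  have mz k : measurable_fun setT (z k) by case: (z_law k).
  have mX r : measurable_fun setT (block_product z (porbit t (j r)) : Om' -> borel R[i]).
    exact: (measurable_prodC _ _ mz).
  rewrite -(@limit_row_law _ _ _ _ _ _ _ _ lim _ _ _ _ P' (s @^-1` [set t])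
    (fun r => block_product z (porbit t (j r))) (ewens theta t) vy (s_law t).1 mX (ew0 t) _ _ mA).
    congr (P' _); apply/seteqP; split => w /= [st h]; split => //.
      rewrite st in h; move: h; congr (A _); apply/rowP => r.
      by rewrite !mxE len_y pos_y.
    rewrite st; move: h; congr (A _); apply/rowP => r.
    by rewrite !mxE len_y pos_y.
  move=> B mB.
  (* Distinct cycles are disjoint and independent of the permutation. *)
  rewrite (blocks_pattern (k := pat_ker y) (model_iid z_law sz_ind) (s_law t).1 (model_s_z_indep z_law sz_ind t) ker_y (pat_ker_idem vy) _ mB); last first.
    move=> r r' i; rewrite -!eq_porbit_mem => /eqP <- /eqP <- //.
  rewrite (s_law t).2; congr (_ * _); apply: eq_bigr => b _.
  pose Bb : set (borel R[i]) := [set x | forall r, pat_ker y r = b -> B r x].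
  have mBb : measurable Bb.
    rewrite /Bb (_ : [set x | _] = [set x | forall r, (if pat_ker y r == b then B r else setT) x]).
      by apply: measurable_forall => r; case: ifP.
    apply/seteqP; split => x h r; first by case: eqP => // e; exact: h.
    by move=> e; have := h r; rewrite e eqxx.
  case: lim => _ TL _.
  exact: (product_law_block (model_iid z_law sz_ind) (esym (len_y b))
    (TL _ b.+1 (pat_len_gt0 vy b) (ltn0Sn _)) mBb).
transitivity (\sum_(j : {ffun 'I_q -> 'I_N} | injectiveb j) \sum_(t : 'S_N)
    (ewens theta t)%:E * F (perm_pattern t j)).
  apply: eq_bigr => j /injectiveP ij.
  rewrite [LHS](measure_finite_partition P' (fun t => (s_law t).1)
    (preimageT_measurable (model_row_measurable s_law z_law j) mA)).
  by apply: eq_bigr => t _; exact: part.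
rewrite exchange_big /=.
pose cnt (t : 'S_N) y := tuples_count (fun C : {set 'I_N} => #|C|) (porbits t) (pat_lengths (y : pattern q)).
transitivity (\sum_(t : 'S_N) \esum_(y in [set y : pattern q | valid_pattern y])
    ((ewens theta t * (cnt t y)%:R)%:E * F y)).
  apply: eq_bigr => t _; rewrite -ge0_sume_distrr// sum_over_patterns//.
  rewrite -esumZl; first last.
  - by move=> y; rewrite mule_ge0// lee_fin.
  - by rewrite lee_fin.
  by apply: eq_esum => y _; rewrite muleA -EFinM.
rewrite -esum_sum; last by move=> y t _ _; rewrite mule_ge0// lee_fin mulr_ge0.
apply: eq_esum => y vy; rewrite -ge0_sume_distrl; last first.
  by move=> t _; rewrite lee_fin mulr_ge0.
by rewrite sumEFin -ewens_tuples// pat_lengths_gt0.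
Qed.

End model_mixture.

(** * Large deviations of the moduli *)

Section large_deviations.
Context (R : realType) (theta : R) (L : probability (borel R[i]) R).
Hypothesis L0 : L [set (0 : R[i])] = 0%E.
Context d (Om : measurableType d) (Q : probability Om R)
  (a : nat -> Om -> nat) (T : nat -> nat -> Om -> borel R[i]).
Hypothesis lim : limit_variables theta L Q a T.

Lemma has_product_law1 d1 (Om1 : measurableType d1) (P : probability Om1 R)
  (X : Om1 -> borel R[i]) : has_product_law L 1 P X -> has_law P X L.
Proof.
move=> [d2 [Om2 [P2 [Y [Yiid [mX XY]]]]]]; split=> // A mA; rewrite XY//.
rewrite -((Yiid.1 ord0).2 A mA); congr (P2 _).
by apply/seteqP; split => w /=; rewrite big_ord1.
Qed.

Lemma iid_comp d1 (Om1 : measurableType d1) (P : probability Om1 R) (I : choiceType)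
    d2 (U : measurableType d2) d3 (V : measurableType d3) (X : I -> Om1 -> U) (mu : set U -> \bar R)
    (f : U -> V) : measurable_fun setT f -> iid P X mu ->
  iid P (fun i => f \o X i) (fun A => mu (f @^-1` A)).
Proof.
move=> mf [lawX ind]; split=> [i|s A us hA].
  split; first exact: measurableT_comp (lawX i).1.
  by move=> A mA; rewrite -(lawX i).2//; exact: preimageT_measurable.
apply: ind => // i si; have [_ [B mB <-]] := hA i si; split => //.
by exists (f @^-1` B); [exact: preimageT_measurable|].
Qed.

(** The class U^s speaks of i.i.d. sequences: this is the one that the limit
    variables provide. *)
Lemma single_factors_iid : iid Q (fun n => T 1 n.+1) L.
Proof.
case: lim => _ TL ind; split=> [n|s A us hA].
  by apply: has_product_law1; exact: TL.
pose B (i : nat + nat * nat) : set Om := if i is inr (_, n.+1) then A n else setT.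
pose f n : nat + nat * nat := inr (1%N, n.+1).
have fi : injective f by move=> n n' [].
have := ind (map f s) B; rewrite map_inj_uniq// big_map => /(_ us) h.
have -> : \bigcap_(i in [set` s]) A i = \bigcap_(i in [set` map f s]) B i.
  apply/seteqP; split => w h1 i.
    by move=> /= /mapP[n ns ->]; exact: h1.
  by move=> si; apply: (h1 (f i)); rewrite /= map_f.
rewrite h// => i /mapP[n ns ->]; split => //; exact: (hA n ns).2.
Qed.

(** The law of [T k p] is that of the product of [T 1 1, ..., T 1 k]. *)
Lemma product_deviation (s eps : R) : in_U L (@log_modulus R) s -> 0 < eps ->
  exists2 C : R, 0 < C & forall k p, (0 < k)%N -> (0 < p)%N ->
    (Q [set w | (eps <= `| k%:R^-1 * log_modulus (T k p w) - fine 'E_L[@log_modulus R] |)%R] <=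
     (C / (k%:R `^ s))%:E)%E.
Proof.
move=> [_ U] eps0.
have Tiid := single_factors_iid.
have [C C0 hC] := U _ _ _ _ (iid_comp (@log_modulus_measurable R) Tiid) eps eps0.
exists C => // k p k0 p0; apply: le_trans (hC k k0).
pose B : set (borel R[i]) :=
  [set x | (eps <= `| k%:R^-1 * log_modulus x - fine 'E_L[@log_modulus R] |)%R].
have mdev d1 (Om1 : measurableType d1) (g : Om1 -> R) : measurable_fun setT g ->
    measurable [set w | (eps <= `| k%:R^-1 * g w - fine 'E_L[@log_modulus R] |)%R].
  move=> mg; apply: ge_set_measurable; apply: measurableT_comp => //.
  by apply: measurable_funB => //; exact: measurable_funM.
have mB : measurable B by apply: mdev; exact: log_modulus_measurable.
have Xiid : iid Q (fun i : 'I_k => T 1 i.+1) L.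
  exact: (iid_sub (f := fun i : 'I_k => i : nat) Tiid (@ord_inj k)).
case: lim => _ TL _.
pose S : {set 'I_k} := finset.finset (fun=> true).
have Ck : #|S| = k.
  by rewrite -[RHS]card_ord; apply: eq_card => i; rewrite inE.
rewrite -[leLHS](product_law_block Xiid Ck (TL k p k0 p0) mB).
have mX (i : 'I_k) : measurable_fun setT (T 1 i.+1) by exact: (Xiid.1 i).1.
have m0 : measurable ([set 0] : set (borel R[i])) by exact: measurable_set1C.
pose nz : set Om := [set w | forall i : 'I_k, (~` [set 0] : set (borel R[i])) (T 1 i.+1 w)].
have mnz : measurable nz.
  by apply: measurable_forall => i; apply: (preimageT_measurable (mX i)); exact: measurableC.
have Pnz : Q nz = 1%E.
  rewrite (iid_box (A := fun=> ~` ([set 0] : set (borel R[i]))) Xiid); last by move=> ?; exact: measurableC.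
  by rewrite big1// => j _; rewrite probability_setC// L0 sube0.
have eB w : \prod_(j in S) (T 1 j.+1 w : R[i]) =
    \prod_(j < k) (T 1 j.+1 w : R[i]).
  by apply: eq_bigl => i; rewrite inE.
rewrite le_eqVlt; apply/orP; left; apply/eqP; apply: (@measure_eq_off_null _ _ _ Q (~` nz)).
- exact: measurableC.
- by rewrite probability_setC// Pnz subee.
- exact: (preimageT_measurable (measurable_prodC _ _ mX) mB).
- apply: mdev; apply: measurable_sum => i.
  exact: (measurableT_comp (@log_modulus_measurable R) (Xiid.1 _).1).
move=> w /contrapT nzw /=; rewrite eB /B /= log_modulus_prod//.
by move=> i _; apply/eqP; exact: nzw.
Qed.

(** The log-modulus of a root of order [k] is the mean of [k] log-moduli; the
    annulus contains an interval of radius [eps] around its expectation. *)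
Lemma root_outside_annulus (s R1 R2 : R) : in_U L (@log_modulus R) s -> 0 < R1 ->
  R1 < expR (fine 'E_L[@log_modulus R]) -> expR (fine 'E_L[@log_modulus R]) < R2 ->
  exists2 C : R, 0 < C & forall k p l, (0 < k)%N -> (0 < p)%N ->
    (Q [set w | ~ (R1 < Normc.normc (croot k (T k p w) l) < R2)%R] <=
     (C / (k%:R `^ s))%:E)%E.
Proof.
set m := fine _ => U R10 R1m mR2.
have R20 : 0 < R2 by exact: lt_trans (expR_gt0 m) mR2.
pose eps := Num.min (m - ln R1) (ln R2 - m).
have eps0 : 0 < eps.
  rewrite lt_min !subr_gt0 -ltr_expR lnK ?posrE// R1m /=.
  by rewrite -ltr_expR lnK ?posrE.
have [C C0 hC] := product_deviation U eps0; exists C => // k p l k0 p0.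
have mT := limit_T_measurable lim k0 p0.
have mk : measurable_fun setT (fun w => k%:R^-1 * log_modulus (T k p w)).
  by apply: measurable_funM => //; exact: (measurableT_comp (@log_modulus_measurable R)).
have mN : measurable_fun setT (fun w => Normc.normc (croot k (T k p w) l)).
  apply: (measurableT_comp (@normc_measurable R)).
  exact: (measurableT_comp (@croot_measurable R _ _)).
apply: le_trans (hC k p k0 p0); apply: le_measure; rewrite ?inE.
- rewrite (_ : [set w | _] = ~` ((fun w => Normc.normc (croot k (T k p w) l)) @^-1` `]R1, R2[)).
    by apply: measurableC; apply: (preimageT_measurable mN); exact: measurable_itv.
  by apply/seteqP; split => w /=; rewrite in_itv.
- apply: ge_set_measurable; apply: measurableT_comp => //.
  by apply: measurable_funB.
move=> w h; rewrite /mkset leNgt; apply/negP => dev; apply: h.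
rewrite normc_croot mulrC; set x := _ * _.
have : `|x - m| < eps by [].
rewrite /eps lt_min !ltr_norml => /andP[/andP[h1 _] /andP[_ h2]].
rewrite -ltr_ln ?posrE ?expR_gt0// -[X in _ && X]ltr_ln ?posrE ?expR_gt0// expRK; lra.
Qed.

End large_deviations.

Lemma lee_prod_nneg (R : realType) (I : Type) (s : seq I) (p : pred I) (F G : I -> \bar R) :
  (forall i, p i -> 0 <= F i <= G i)%E ->
  (\prod_(i <- s | p i) F i <= \prod_(i <- s | p i) G i)%E.
Proof.
move=> h; suff /andP[] : (0 <= \prod_(i <- s | p i) F i <= \prod_(i <- s | p i) G i)%E by [].
elim/big_ind2 : _ => [|x1 y1 x2 y2 /andP[h1 h2] /andP[h3 h4]|//].
  by rewrite lexx lee01.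
by rewrite mule_ge0//= lee_pmul.
Qed.

Section patterns_off_annulus.
Context (R : realType) (theta : R) (L : probability (borel R[i]) R).
Hypothesis L0 : L [set (0 : R[i])] = 0%E.
Context d (Om : measurableType d) (Q : probability Om R)
  (a : nat -> Om -> nat) (T : nat -> nat -> Om -> borel R[i]).
Hypothesis lim : limit_variables theta L Q a T.

Lemma outside_annulus_measurable q (R1 R2 : R) :
  measurable (outside_annulus R1 R2 : set (borel 'rV[R[i]]_q)).
Proof.
apply: measurable_forall => r.
rewrite [X in measurable X](_ : _ = ~` ((fun v : borel 'rV[R[i]]_q => Normc.normc ((v : 'rV[R[i]]_q) 0 r)) @^-1` `]R1, R2[)).
  apply: measurableC.
  exact: (preimageT_measurable (measurableT_comp (@normc_measurable R) (coord_measurable 0 r)) (measurable_itv _)).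
by apply/seteqP; split => w /=; rewrite in_itv.
Qed.

(** The distinct products of a pattern are independent, and each of them is
    observed through one of its roots at least. *)
Lemma pattern_outside_annulus q (y : pattern q) (R1 R2 : R) (beta : nat -> R) : valid_pattern y ->
  (forall k p l, (0 < k)%N -> (0 < p)%N ->
    (Q [set w | ~ (R1 < Normc.normc (croot k (T k p w) l) < R2)%R] <= (beta k)%:E)%E) ->
  (Q ((limit_row T y : Om -> borel 'rV[R[i]]_q) @^-1` outside_annulus R1 R2) <=
   (\prod_(b | pat_ker y b == b) beta (pat_len y b))%:E)%E.
Proof.
move=> vy hb.
pose B r : set (borel R[i]) :=
  [set x | ~ (R1 < Normc.normc (croot (pat_len y r) x (pat_pos y r)) < R2)].
have mB r : measurable (B r).
  rewrite (_ : B r = ~` ((fun x => Normc.normc (croot (pat_len y r) x (pat_pos y r))) @^-1` `]R1, R2[)).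
    apply: measurableC.
    exact: (preimageT_measurable (measurableT_comp (@normc_measurable R) (@croot_measurable R _ _)) (measurable_itv _)).
  by apply/seteqP; split => w /=; rewrite in_itv.
have kp r r' : ((pat_len y r, (pat_ker y r).+1) == (pat_len y r', (pat_ker y r').+1)) =
    (pat_ker y r == pat_ker y r').
  rewrite xpair_eqE eqSS -val_eqE andb_idl// => /eqP/val_inj e.
  by rewrite -(pat_len_ker vy r) e (pat_len_ker vy).
have := limit_boxes lim (p := fun r => (pat_ker y r).+1) (fun=> 0%N) (pat_len_gt0 vy)
  (fun r => ltn0Sn _) (pat_ker_idem vy) kp mB.
rewrite (_ : [set w | _] = setT) ?setTI; last by apply/seteqP; split.
rewrite probability_setT mul1e => e.
rewrite (_ : _ @^-1` _ = [set w | forall r, B r (T (pat_len y r) (pat_ker y r).+1 w)]); last first.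
  by apply/seteqP; split => w /= h r; have := h r; rewrite mxE.
rewrite [leLHS]e -prodEFin; apply: lee_prod_nneg => b pb; apply/andP; split => //.
apply: le_trans (hb (pat_len y b) (pat_ker y b).+1 (pat_pos y b) (pat_len_gt0 vy b) (ltn0Sn _)).
apply: le_measure; rewrite ?inE.
- apply: measurable_forall => r; case: (pat_ker y r =P b) => [e1|n1]; last first.
    by rewrite [X in measurable X](_ : _ = setT)//; apply/seteqP; split.
  rewrite [X in measurable X](_ : _ = T (pat_len y b) (pat_ker y b).+1 @^-1` B r).
    exact: (preimageT_measurable (limit_T_measurable lim (pat_len_gt0 vy b) (ltn0Sn _)) (mB r)).
  by apply/seteqP; split => w /= h; [exact: h|move=> _].
- exact: (preimageT_measurable (limit_T_measurable lim (pat_len_gt0 vy b) (ltn0Sn _)) (mB b)).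
by move=> w /= /(_ b (eqP pb)).
Qed.

End patterns_off_annulus.

(** * Summability over patterns *)

Section inverse_squares.
Context (R : realType).

(** Compare [1 / n ^ 2] with the telescoping term [2 / n - 2 / (n + 1)]. *)
Lemma inverse_square_tail (D c : R) : 0 <= D -> 0 < c ->
  (\esum_(n in [set: nat]) (if (0 < n)%N && (c <= n%:R)%R then D / n%:R ^+ 2 else 0)%:E <=
   (2 * D / c)%:E)%E.
Proof.
move=> D0 c0; pose t (n : nat) : R := if (0 < n)%N && (c <= n%:R)%R then D / n%:R ^+ 2 else 0.
have t0 n : 0 <= t n by rewrite /t; case: ifP => // _; rewrite divr_ge0// exprn_ge0.
have bound n : \sum_(0 <= i < n) t i = 0 \/
    (0 < n)%N /\ \sum_(0 <= i < n) t i <= D * (2 / c - 2 / n%:R).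
  elim: n => [|n IH]; first by left; rewrite big_nil.
  rewrite big_nat_recr //=; have [|tn] := boolP ((0 < n)%N && (c <= n%:R)%R); last first.
    have -> : t n = 0 by rewrite /t (negbTE tn).
    rewrite addr0; case: IH => [->|[n0 h]]; [by left|right; split => //].
    apply: le_trans h _; rewrite ler_wpM2l// lerD2l lerN2 ler_pM2l// lef_pV2 ?posrE ?ltr0n//.
    by rewrite ler_nat.
  move=> /andP[n0 cn]; right; split => //.
  have n0' : (0 : R) < n%:R by rewrite ltr0n.
  have n1' : (0 : R) < n.+1%:R by rewrite ltr0n.
  have -> : t n = D / n%:R ^+ 2 by rewrite /t n0 cn.
  have step : 1 / n%:R ^+ 2 <= 2 / n%:R - 2 / n.+1%:R :> R.
    rewrite -subr_ge0.
    have -> : 2 / n%:R - 2 / n.+1%:R - 1 / n%:R ^+ 2 = (n%:R - 1) / (n%:R ^+ 2 * n.+1%:R) :> R.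
      have e1 : n.+1%:R = n%:R + 1 :> R by rewrite -addn1 natrD.
      rewrite e1 in n1' *; field.
      by rewrite (gt_eqF n0') (gt_eqF n1').
    by rewrite divr_ge0 ?mulr_ge0 ?exprn_ge0// subr_ge0 ler1n.
  have c_n : 2 / n%:R <= 2 / c by rewrite ler_pM2l// lef_pV2 ?posrE.
  have -> : D / n%:R ^+ 2 = D * (1 / n%:R ^+ 2) by rewrite mul1r.
  case: IH => [->|[_ h]].
    by rewrite add0r ler_wpM2l//; exact: le_trans step (lerB c_n (lexx _)).
  apply: le_trans (lerD h (ler_wpM2l D0 step)) _.
  by rewrite -mulrDr ler_wpM2l// -addrA lerD2l addrC lerBlDr addrC.
rewrite -nneseries_esumT; last by move=> n; rewrite lee_fin; exact: t0.
apply: lime_le; first by apply: is_cvg_nneseries => n _ _; rewrite lee_fin; exact: t0.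
apply: nearW => n; rewrite sumEFin lee_fin.
have b0 : 0 <= 2 * D / c by rewrite divr_ge0 ?mulr_ge0// ltW.
case: (bound n) => [->//|[n0 h]]; apply: le_trans h _.
rewrite mulrBr [X in X - _](_ : _ = 2 * D / c); last by rewrite mulrCA mulrA.
by rewrite lerBlDr lerDl mulr_ge0// divr_ge0.
Qed.

End inverse_squares.

Section pattern_sums.
Context (R : realType) (q : nat).

(** The normalized sum over the root numbers is at most 1; the sum over the
    lengths is then a product of series. *)
Lemma sum_patterns_le (G : {ffun 'I_q -> 'I_q} -> 'I_q -> nat -> R) : (forall pi r n, 0 <= G pi r n) ->
  (\esum_(y in [set: pattern q])
    ((\prod_r G (pat_ker y) r (y.1.2 r)) *
     \prod_r (if (pat_pos y r < pat_len y r)%N then (pat_len y r)%:R^-1 else 0))%:E <=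
   \sum_pi \prod_r \esum_(n in [set: nat]) (G pi r n)%:E)%E.
Proof.
move=> G0.
pose g (pi : {ffun 'I_q -> 'I_q}) (k : {ffun 'I_q -> nat}) : R := \prod_r G pi r (k r).
pose h (pi : {ffun 'I_q -> 'I_q}) (k l : {ffun 'I_q -> nat}) : R :=
  \prod_r (if (l r < k (pi r))%N then (k (pi r))%:R^-1 else 0).
have g0 pi k : 0 <= g pi k by apply: prodr_ge0 => r _; exact: G0.
have u0 (n : nat) x : 0 <= (if (x < n)%N then n%:R^-1 else 0 : R).
  by case: ifP => // _; rewrite invr_ge0.
have h0 pi k l : 0 <= h pi k l by apply: prodr_ge0.
have -> : \esum_(y in [set: pattern q]) (g y.1.1 y.1.2 * h y.1.1 y.1.2 y.2)%:E =
   \esum_(pk in [set: {ffun 'I_q -> 'I_q} * {ffun 'I_q -> nat}])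
     \esum_(l in [set: {ffun 'I_q -> nat}]) (g pk.1 pk.2 * h pk.1 pk.2 l)%:E.
  rewrite esum_esum; last by move=> *; rewrite lee_fin mulr_ge0.
  by congr esum; apply/seteqP; split.
have -> : (\sum_pi \prod_r (\esum_(n in [set: nat]) (G pi r n)%:E))%E =
   \esum_(pk in [set: {ffun 'I_q -> 'I_q} * {ffun 'I_q -> nat}]) (g pk.1 pk.2)%:E.
  transitivity (\esum_(pi in [set: {ffun 'I_q -> 'I_q}])
     \esum_(k in [set: {ffun 'I_q -> nat}]) (g pi k)%:E).
    transitivity (\esum_(pi in [set pi : {ffun 'I_q -> 'I_q} | predT pi])
        (\prod_r (\esum_(n in [set: nat]) (G pi r n)%:E))%E).
      rewrite esum_finType// => pi; apply: prode_ge0 => r _.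
      by apply: esum_ge0 => n _; rewrite lee_fin.
    rewrite (_ : [set pi : {ffun 'I_q -> 'I_q} | predT pi] = setT); last by apply/seteqP; split.
    apply: eq_esum => pi _; rewrite -esum_ffun_prod; last by move=> r n; rewrite lee_fin.
    by apply: eq_esum => k _; rewrite prodEFin.
  rewrite esum_esum; last by move=> *; rewrite lee_fin.
  by congr esum; apply/seteqP; split.
apply: le_esum => -[pi k] _ /=.
under eq_esum do rewrite EFinM.
rewrite esumZl; last 2 first.
- by rewrite lee_fin.
- by move=> l; rewrite lee_fin.
rewrite -[leRHS]mule1; apply: lee_wpmul2l; first by rewrite lee_fin.
under eq_esum do rewrite -prodEFin.
rewrite (esum_ffun_prod (g := fun r x => (if (x < k (pi r))%N then (k (pi r))%:R^-1 else 0 : R)%:E)) => [|r n]; last by rewrite lee_fin.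
have one : (\prod_(i < q) (1 : \bar R) = 1)%E by rewrite big1.
rewrite -[leRHS]one; apply: lee_prod_nneg => r _; apply/andP; split; first by apply: esum_ge0 => n _; rewrite lee_fin.
case: (k (pi r)) => [|n].
  by rewrite esum1// lee01.
rewrite (_ : \esum_(x in _) _ = \esum_(x in [set: nat]) (n.+1%:R^-1)%:E * (if (x < n.+1)%N then 1 else 0))%E; last first.
  by apply: eq_esum => x _; case: ifP; rewrite ?mule1 ?mule0.
rewrite esumZl; last 2 first.
- by rewrite lee_fin invr_ge0.
- by move=> x; case: ifP.
by rewrite esum_ord_lt -EFinM mulVf// pnatr_eq0.
Qed.

Variables (D : R) (D0 : 0 <= D).

Let u (n : nat) : R := if (0 < n)%N then D / n%:R ^+ 2 else 0.

Let u0 n : 0 <= u n. Proof. by rewrite /u; case: ifP => // _; rewrite divr_ge0// exprn_ge0. Qed.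

Let len_weight (pi : {ffun 'I_q -> 'I_q}) (r : 'I_q) (n : nat) : R :=
  if pi r == r then u n else (n == 0)%N%:R.

Let long_weight (N : nat) (b : 'I_q) (pi : {ffun 'I_q -> 'I_q}) (r : 'I_q) (n : nat) : R :=
  if r == b then (if (pi r == r) && (N < 2 * q * n)%N then u n else 0) else len_weight pi r n.

Let weight (G : {ffun 'I_q -> 'I_q} -> 'I_q -> nat -> R) (y : pattern q) : R :=
  (\prod_r G (pat_ker y) r (y.1.2 r)) *
     \prod_r (if (pat_pos y r < pat_len y r)%N then (pat_len y r)%:R^-1 else 0).

(** The bound for the mass of a pattern off the annulus: each cycle contributes
    [theta / k] from its count and [C / k ^ (q + 1)] from the large deviation. *)
Definition base_product (y : pattern q) : R :=
  \prod_(b | pat_ker y b == b) (D / (pat_len y b)%:R ^+ q.+2).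

Lemma base_product_ge0 y : 0 <= base_product y.
Proof. by apply: prodr_ge0 => b _; rewrite divr_ge0// exprn_ge0. Qed.

(** At most [q] root numbers are attached to each representative, each of them
    using one power of its length. *)
Lemma base_product_le y : valid_pattern y -> base_product y <= weight len_weight y.
Proof.
move=> vy; have /and4P[_ /forallP kv _ _] := vy.
rewrite /weight (bigID (fun r => pat_ker y r == r)) /= [X in _ * X * _]big1 ?mulr1; last first.
  move=> r nr; rewrite /len_weight (negbTE nr).
  by have := kv r; rewrite (negbTE nr); case: (y.1.2 r).
rewrite [X in _ * X](partition_big (pat_ker y) (fun b => pat_ker y b == b)) /=; last first.
  by move=> r _; rewrite pat_ker_idem.
rewrite -big_split /=; apply: ler_prod => b /eqP pb.
rewrite divr_ge0 ?exprn_ge0//=.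
have len_b : pat_len y b = y.1.2 b by rewrite /pat_len -/(pat_ker y b) pb.
have k0 : (0 < y.1.2 b)%N by rewrite -len_b pat_len_gt0.
have k0' : (0 : R) < (y.1.2 b)%:R by rewrite ltr0n.
rewrite /len_weight pb eqxx /u k0 len_b.
rewrite (eq_bigr (fun=> (y.1.2 b)%:R^-1)); last first.
  by move=> r /eqP pr; rewrite pat_pos_lt// -(pat_len_ker vy) pr len_b.
(* The power [q] pays for the root numbers, and the power 2 is left for the
   lengths. *)
rewrite prodr_const -(addn2 q) addnC exprD invfM mulrA ler_wpM2l//.
  by rewrite divr_ge0// exprn_ge0.
rewrite -exprVn; apply: ler_wiXn2l; [by rewrite invr_ge0|by rewrite invf_le1// ler1n|].
by rewrite -[leqRHS]card_ord; exact: max_card.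
Qed.

Lemma sumn_pat_lengths (y : pattern q) :
  sumn (pat_lengths y) = (\sum_(b | pat_ker y b == b) pat_len y b)%N.
Proof. by rewrite sumnE big_map big_filter big_enum_cond. Qed.

(** One of the at most [q] cycles has length more than [N / (2 * q)]. *)
Lemma long_base_product_le N y : valid_pattern y -> (N < (sumn (pat_lengths y)).*2)%N ->
  base_product y <= \sum_b weight (long_weight N b) y.
Proof.
move=> vy; rewrite sumn_pat_lengths => long.
have [b pb kb] : exists2 b, pat_ker y b == b & (N < 2 * q * pat_len y b)%N.
  apply: contrapT => no; move: long; rewrite ltnNge => /negP; apply.
  have le b : pat_ker y b == b -> (2 * q * pat_len y b <= N)%N.
    by move=> pb; rewrite leqNgt; apply/negP => h; apply: no; exists b.
  case: (posnP q) => [q0|q0].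
    rewrite big1// => b; by have := ltn_ord b; rewrite {2}q0.
  rewrite -(leq_pmul2l q0) -mul2n mulnA [(q * 2)%N]mulnC big_distrr /=.
  apply: (@leq_trans (\sum_(i < q | pat_ker y i == i) N)%N); first exact: leq_sum.
  rewrite sum_nat_cond_const leq_mul2r; apply/orP; right.
  by rewrite -[leqRHS]card_ord; exact: max_card.
apply: (le_trans (base_product_le vy)).
have w0 c : 0 <= weight (long_weight N c) y.
  rewrite mulr_ge0// prodr_ge0// => r _; last by case: ifP => // _; rewrite invr_ge0.
  by rewrite /long_weight /len_weight; do 2?case: ifP.
rewrite (bigD1 b) //= -[leLHS]addr0 lerD ?sumr_ge0//.
rewrite le_eqVlt; apply/orP; left; apply/eqP; congr (_ * _); apply: eq_bigr => r _.
rewrite /long_weight; case: eqP => // ->.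
have len_b : pat_len y b = y.1.2 b by rewrite /pat_len -/(pat_ker y b) (eqP pb).
by rewrite /len_weight pb -len_b kb.
Qed.

Let E : R := Num.max 1 (2 * D).

Let E1 : 1 <= E. Proof. by rewrite le_max lexx. Qed.

Let sum_u : (\esum_(n in [set: nat]) (u n)%:E <= (2 * D)%:E)%E.
Proof.
have := inverse_square_tail D0 ltr01; rewrite divr1; apply: le_trans.
by apply: le_esum => n _; rewrite lee_fin /u; case: n => //= n; rewrite ler1n.
Qed.

Let sum_len_weight pi r : (\esum_(n in [set: nat]) (len_weight pi r n)%:E <= E%:E)%E.
Proof.
rewrite /len_weight; case: (pi r == r).
  by apply: le_trans sum_u _; rewrite lee_fin le_max lexx orbT.
rewrite (_ : \esum_(n in _) _ = 1%E) ?lee_fin//.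
rewrite -[RHS](@esum_set1 R nat 0%N (fun=> 1%E) lee01) [RHS]esum_mkcond; apply: eq_esum => n _.
by case: eqP => [->|n0]; [rewrite mem_set|rewrite memNset].
Qed.

Let len_weight0 pi r n : 0 <= len_weight pi r n.
Proof. by rewrite /len_weight; case: ifP. Qed.

Let weight0 G y : (forall pi r n, 0 <= G pi r n) -> 0 <= weight G y.
Proof.
by move=> G0; rewrite mulr_ge0// prodr_ge0// => r _; case: ifP => // _; rewrite invr_ge0.
Qed.

Lemma base_product_summable :
  (\esum_(y in [set y | valid_pattern y]) (base_product y)%:E < +oo)%E.
Proof.
apply: (@le_lt_trans _ _ (\sum_(pi : {ffun 'I_q -> 'I_q}) \prod_(r : 'I_q) E%:E)%E); last first.
  by rewrite (eq_bigr (fun=> (\prod_(r : 'I_q) E)%:E)) ?sumEFin ?ltry// => pi _; rewrite prodEFin.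
apply: (@le_trans _ _ (\esum_(y in [set: pattern q]) (weight len_weight y)%:E)%E).
  rewrite esum_mkcond; apply: le_esum => y _; case: ifPn => [/set_mem vy|_]; rewrite lee_fin.
    exact: base_product_le.
  exact: weight0.
apply: le_trans (sum_patterns_le len_weight0) _; apply: lee_sum => pi _.
apply: lee_prod_nneg => r _; rewrite sum_len_weight andbT.
by apply: esum_ge0 => n _; rewrite lee_fin.
Qed.

(** A series of inverse squares starting at [N / (2 * q)] is of order [q / N]. *)
Lemma long_base_product_sum : exists2 c : R, 0 <= c & forall N, (0 < N)%N ->
  (\esum_(y in [set y | valid_pattern y /\ (N < (sumn (pat_lengths y)).*2)%N]) (base_product y)%:E <=
   (c / N%:R)%:E)%E.
Proof.
exists (\sum_(b < q) \sum_(pi : {ffun 'I_q -> 'I_q}) (2 * D * (2 * q)%:R * E ^+ q)).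
  apply: sumr_ge0 => b _; apply: sumr_ge0 => pi _.
  by rewrite !mulr_ge0// exprn_ge0// (le_trans _ E1).
move=> N N0; have N0' : (0 : R) < N%:R by rewrite ltr0n.
have long0 b pi r n : 0 <= long_weight N b pi r n.
  by rewrite /long_weight; do 2?case: ifP.
apply: (@le_trans _ _ (\esum_(y in [set: pattern q]) \sum_b (weight (long_weight N b) y)%:E)%E).
  rewrite esum_mkcond; apply: le_esum => y _; rewrite sumEFin; case: ifPn => [/set_mem[vy ly]|_]; rewrite lee_fin.
    exact: long_base_product_le.
  by apply: sumr_ge0 => b _; exact: weight0.
rewrite esum_sum; last by move=> y b _ _; rewrite lee_fin; exact: weight0.
rewrite mulr_suml -sumEFin; apply: lee_sum => b _.
apply: le_trans (sum_patterns_le (long0 b)) _.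
rewrite mulr_suml -sumEFin; apply: lee_sum => pi _.
have q0 : (0 < q)%N by exact: leq_ltn_trans (ltn_ord b).
have cpos : 0 < N%:R / (2 * q)%:R :> R by rewrite divr_gt0// ltr0n muln_gt0.
have bE : (\esum_(n in [set: nat]) (long_weight N b pi b n)%:E <= (2 * D * (2 * q)%:R / N%:R)%:E)%E.
  have := inverse_square_tail D0 cpos; rewrite invf_div mulrA; apply: le_trans.
  apply: le_esum => n _; rewrite lee_fin /long_weight eqxx /u.
  case: ifP => [/andP[_ h]|_]; last by case: ifP => // _; rewrite divr_ge0// exprn_ge0.
  case: n h => [|n] h; first by rewrite muln0 in h.
  rewrite /= ifT// ler_pdivrMr ?ltr0n ?muln_gt0// -natrM ler_nat mulnC; exact: ltnW.
rewrite (bigD1 b) //=.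
apply: (@le_trans _ _ ((2 * D * (2 * q)%:R / N%:R)%:E * \prod_(r < q | r != b) E%:E)%E).
  apply: lee_pmul => //.
  - by apply: esum_ge0 => n _; rewrite lee_fin.
  - by apply: prode_ge0 => r _; apply: esum_ge0 => n _; rewrite lee_fin.
  apply: lee_prod_nneg => r rb; apply/andP; split; first by apply: esum_ge0 => n _; rewrite lee_fin.
  by rewrite /long_weight (negbTE rb).
rewrite prodEFin -EFinM lee_fin mulrAC ler_wpM2r ?invr_ge0//.
rewrite ler_wpM2l ?mulr_ge0// prodr_const; apply: ler_weXn2l => //.
by rewrite -[leqRHS]card_ord; exact: max_card.
Qed.

End pattern_sums.

(** * Convergence off the annulus *)

Section ratio_limits.
Context (R : realType) (theta : R).
Hypothesis theta0 : 0 < theta.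

Lemma ewens_mass_ratio_cvg : (fun n => ewens_mass theta n / ewens_mass theta n.+1) @ \oo --> (1 : R).
Proof.
have e n : ewens_mass theta n / ewens_mass theta n.+1 = 1 + (1 - theta) / (theta + n%:R).
  have := ewens_massS theta n; have m0 := ewens_mass_gt0 theta0 n; have m1 := ewens_mass_gt0 theta0 n.+1.
  have tn : 0 < theta + n%:R by rewrite ltr_pwDl.
  rewrite -[n.+1]addn1 natrD addn1 => h.
  apply: (mulIf (lt0r_neq0 m1)); rewrite divfK ?gt_eqF//.
  apply: (mulfI (lt0r_neq0 tn)); rewrite -h.
  by field; rewrite gt_eqF.
under eq_cvg do rewrite e.
have h1 : (fun=> 1) @ \oo --> (1 : R) by exact: cvg_cst.
suff h : (fun n : nat => (theta + n%:R)^-1) @ \oo --> (0 : R).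
  have h2 : (fun n : nat => 1 + (1 - theta) / (theta + n%:R)) @ \oo --> 1 + (1 - theta) * 0.
    by apply: cvgD => //; exact: cvgMr.
  by rewrite mulr0 addr0 in h2.
apply/gtr0_cvgV0; first by apply: nearW => n; rewrite ltr_pwDl.
apply/cvgryPge => A; near=> n; apply: (@le_trans _ _ n%:R); last by rewrite lerDr ltW.
near: n; exact: nbhs_infty_ger.
Unshelve. all: by end_near. Qed.

(** Consecutive masses are equivalent, and the ratio is a product of [K] of their
    quotients. *)
Lemma mass_ratio_cvg K : (fun N => mass_ratio theta N K) @ \oo --> (1 : R).
Proof.
have h : (fun n => ewens_mass theta n / ewens_mass theta (n + K)) @ \oo --> (1 : R).
  elim: K => [|K IH].
    under eq_cvg do rewrite addn0 divff ?gt_eqF ?ewens_mass_gt0//.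
    exact: cvg_cst.
  have h1 : (fun n => ewens_mass theta (n + K) / ewens_mass theta (n + K).+1) @ \oo --> (1 : R).
    by have := ewens_mass_ratio_cvg; rewrite -(cvg_shiftn K).
  have h2 : (fun n => ewens_mass theta n / ewens_mass theta (n + K) *
      (ewens_mass theta (n + K) / ewens_mass theta (n + K).+1)) @ \oo --> (1 * 1 : R).
    exact: cvgM.
  rewrite mulr1 in h2; move: h2; apply: cvg_trans; apply: near_eq_cvg; apply: nearW => n /=.
  rewrite addnS; field.
  by rewrite !gt_eqF ?ewens_mass_gt0.
rewrite -(cvg_shiftn K); move: h; apply: cvg_trans; apply: near_eq_cvg; apply: nearW => n /=.
by rewrite /mass_ratio leq_addl addnK.
Qed.

Lemma mass_bound_cvg : (fun N => (1 + (ewens_mass theta N)^-1) / N%:R) @ \oo --> (0 : R).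
Proof.
rewrite -(cvg_shiftn 1).
have hy : (fun n => theta ^+ 2 * series (@harmonic R) n) @ \oo --> +oo.
  have sy : series (@harmonic R) @ \oo --> +oo.
    apply: nondecreasing_dvgn_lt; last exact: dvg_harmonic.
    by apply: nondecreasing_series => n _ _; exact: harmonic_ge0.
  by apply: gt0_cvgMrNy || (apply/cvgryPge => A; near=> n; rewrite -ler_pdivrMl ?exprn_gt0//; near: n; move/cvgryPge : sy; exact).
have h0 : (fun n => (theta ^+ 2 * series (@harmonic R) n)^-1) @ \oo --> (0 : R).
  apply/gtr0_cvgV0 => //; near=> n.
  rewrite mulr_gt0 ?exprn_gt0//.
  have n0 : (0 < n)%N by near: n; exact: nbhs_infty_gt.
  by rewrite /series /= -(prednK n0) big_nat_recl//= ltr_pwDl ?sumr_ge0// => *; rewrite invr_ge0.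
apply: (@squeeze_cvgr _ _ _ _ (fun=> 0) (fun n => n.+1%:R^-1 + (theta ^+ 2 * series (@harmonic R) n)^-1)).
- near=> n; rewrite /= addn1.
  have m0 := ewens_mass_gt0 theta0 n.+1.
  rewrite divr_ge0 ?addr_ge0 ?invr_ge0 ?(ltW m0)//= mulrDl mul1r lerD2l -invfM.
  have n0 : (0 < n)%N by near: n; exact: nbhs_infty_gt.
  have s0 : 0 < series (@harmonic R) n.
    by rewrite /series /= -(prednK n0) big_nat_recl//= ltr_pwDl ?sumr_ge0// => *; rewrite invr_ge0.
  rewrite lef_pV2 ?posrE ?mulr_gt0 ?exprn_gt0// [leRHS]mulrC.
  have := ewens_mass_harmonic theta0 n; rewrite /series /= big_mkord; exact.
- exact: cvg_cst.
- have h1 : (fun n => n.+1%:R^-1 + (theta ^+ 2 * series (@harmonic R) n)^-1) @ \oo --> (0 + 0 : R).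
    by apply: cvgD h0; exact: cvg_harmonic.
  by rewrite addr0 in h1.
Unshelve. all: by end_near. Qed.

End ratio_limits.

Section dominated_sums.
Context (R : realType) (K : countType) (D : set K).

(** Dominated convergence for the counting measure on an enumeration of [K]. *)
Lemma esum_dominated_cvg (b : K -> R) (r : nat -> K -> R) (B : R) :
  (forall y, 0 <= b y) -> (\esum_(y in D) (b y)%:E < +oo)%E ->
  (forall N y, 0 <= r N y <= B) -> (forall y, D y -> r ^~ y @ \oo --> (1 : R)) ->
  (fun N => \esum_(y in D) (r N y * b y)%:E)%E @ \oo --> (\esum_(y in D) (b y)%:E)%E.
Proof.
move=> b0 sb rB r1.
have rb0 N y : (0 <= (r N y * b y)%:E)%E by rewrite lee_fin mulr_ge0//; case/andP: (rB N y).
have b0' y : (0 <= (b y)%:E)%E by rewrite lee_fin.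
pose ub := unpickled D (fun y => (b y)%:E).
have ub0 n : (0 <= ub n)%E by exact: unpickled_ge0.
rewrite esum_countType// -ge0_integral_count//.
rewrite (_ : (fun N => _) = (fun N => \int[counting]_n unpickled D (fun y => (r N y * b y)%:E) n)%E); last first.
  apply/funext => N; rewrite ge0_integral_count ?esum_countType// => n; exact: unpickled_ge0.
have ub_fin n : ub n = (fine (ub n))%:E.
  rewrite /ub /unpickled; case: (@pickle_inv K n) => [y|//]; by case: ifP.
have B0 : 0 <= B \/ (forall y : K, False).
  have [y|no] := pselect (exists y : K, True); last by right => y; apply: no; exists y.
  by left; case: y => y _; case/andP: (rB 0%N y) => h1 h2; exact: le_trans h1 h2.
have sumB : (\int[counting]_n ub n < +oo)%E.
  by rewrite ge0_integral_count// -esum_countType.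
apply: (@dominated_cvg _ _ _ counting setT measurableT _ _ (fun n => B%:E * ub n)%E).
- by [].
- move=> n _; rewrite /unpickled; case e: (@pickle_inv K n) => [y|]; last exact: cvg_cst.
  case: ifPn => [/set_mem Dy|_]; last exact: cvg_cst.
  apply: cvg_EFin; first exact: nearW.
  have h1 : (fun N => r N y * b y) @ \oo --> (1 * b y : R).
    by apply: cvgM; [exact: r1|exact: cvg_cst].
  by rewrite mul1r in h1.
- by move=> n _; rewrite ub_fin.
- apply/integrableP; split=> //.
  case: B0 => [B0|no].
    under eq_integral do rewrite gee0_abs ?mule_ge0//.
    rewrite ge0_integralZl//.
    by apply: lte_mul_pinfty.
  rewrite (eq_integral (fun=> 0%E)) ?integral0// => n _.
  by rewrite /ub /unpickled; case: (@pickle_inv K n) => [y|]; [case: (no y)|rewrite mule0 abse0].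
- move=> N n _; rewrite gee0_abs; last exact: unpickled_ge0.
  rewrite /ub /unpickled; case: (@pickle_inv K n) => [y|]; last by rewrite mule0.
  case: ifP => _; last by rewrite mule0.
  by rewrite -EFinM lee_fin ler_wpM2r//; case/andP: (rB N y).
Qed.

End dominated_sums.

Section weighted_patterns.
Context (R : realType) (theta : R) (q : nat) (D B : R).
Hypothesis theta0 : 0 < theta.
Hypotheses (D0 : 0 <= D) (B0 : 0 <= B).
Let V : set (pattern q) := [set y | valid_pattern y].
Let K (y : pattern q) := sumn (pat_lengths y).

(** Patterns of total length at most [N / 2] are dominated, as the ratio is at
    most 2 there. On the others it is at most [1 + (ewens_mass N)^-1], which is
    [o(N)], and the remaining sum is of order [1 / N]. *)
Lemma mass_ratio_sum_cvg (b : pattern q -> R) : (forall y, 0 <= b y) ->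
  (forall y, V y -> b y <= B * base_product D y) ->
  (fun N => \esum_(y in V) (mass_ratio theta N (K y) * b y)%:E)%E @ \oo --> (\esum_(y in V) (b y)%:E)%E.
Proof.
move=> b0 bB; have bp0 (y : pattern q) : 0 <= base_product D y by exact: base_product_ge0.
have ratio0 N k : 0 <= mass_ratio theta N k by exact: mass_ratio_ge0.
have fin_b : (\esum_(y in V) (b y)%:E < +oo)%E.
  apply: (@le_lt_trans _ _ (B%:E * \esum_(y in V) (base_product D y)%:E)%E).
    rewrite -esumZl; last 2 first.
    - by rewrite lee_fin.
    - by move=> y; rewrite lee_fin.
    by apply: le_esum => y vy; rewrite -EFinM lee_fin bB.
  apply: lte_mul_pinfty => //; exact: base_product_summable.
pose r N y : R := if ((K y).*2 <= N)%N then mass_ratio theta N (K y) else 0.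
have rB N y : 0 <= r N y <= 2.
  by rewrite /r; case: ifP => h; rewrite ?lexx ?ler0n// ratio0 mass_ratio_half.
have r1 y : r ^~ y @ \oo --> (1 : R).
  have := mass_ratio_cvg theta0 (K y); apply: cvg_trans; apply: near_eq_cvg; near=> N.
  by rewrite /r ifT//; near: N; exact: nbhs_infty_ge.
have main := esum_dominated_cvg b0 fin_b rB (fun y _ => r1 y).
have [c c0 tail] := long_base_product_sum q D0.
pose e N : R := (1 + (ewens_mass theta N)^-1) / N%:R * (B * c).
have e_cvg : (fun N => (e N)%:E) @ \oo --> 0%E.
  apply: cvg_EFin; first exact: nearW.
  have h1 : e @ \oo --> (0 * (B * c) : R).
    by apply: cvgM; [exact: mass_bound_cvg|exact: cvg_cst].
  by rewrite mul0r in h1.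
apply: (@squeeze_cvge _ _ _ _ (fun N => \esum_(y in V) (r N y * b y)%:E)%E _
  (fun N => \esum_(y in V) (r N y * b y)%:E + (e N)%:E)%E _ _ main); last first.
  have h1 : (fun N => \esum_(y in V) (r N y * b y)%:E + (e N)%:E)%E @ \oo -->
      (\esum_(y in V) (b y)%:E + 0)%E.
    by apply: cvgeD => //; rewrite fin_num_adde_defl.
  by rewrite adde0 in h1.
near=> N; apply/andP; split.
  apply: le_esum => y _; rewrite lee_fin ler_wpM2r// /r; case: ifP => // _; exact: ratio0.
have N0 : (0 < N)%N by near: N; exact: nbhs_infty_gt.
pose tl y : R := if ((K y).*2 <= N)%N then 0 else mass_ratio theta N (K y).
have tl0 y : 0 <= tl y by rewrite /tl; case: ifP.
rewrite (_ : \esum_(y in V) (mass_ratio theta N (K y) * b y)%:E =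
   \esum_(y in V) ((r N y * b y)%:E + (tl y * b y)%:E))%E; last first.
  apply: eq_esum => y _; rewrite -EFinD -mulrDl /r /tl.
  by case: ifP => _; rewrite ?addr0 ?add0r.
rewrite esumD; last 2 first.
- by move=> y _; rewrite lee_fin mulr_ge0//; case/andP: (rB N y).
- by move=> y _; rewrite lee_fin mulr_ge0.
apply: leeD => //.
pose rho := 1 + (ewens_mass theta N)^-1.
have rho0 : 0 <= rho by rewrite addr_ge0// invr_ge0 ltW// ewens_mass_gt0.
apply: (@le_trans _ _ ((rho * B)%:E * (\esum_(y in [set y | valid_pattern y /\ (N < (K y).*2)%N])
   (base_product D y)%:E))%E).
  rewrite -esumZl; last 2 first.
  - by rewrite lee_fin mulr_ge0.
  - by move=> y; rewrite lee_fin.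
  rewrite esum_mkcond [leRHS]esum_mkcond; apply: le_esum => y _.
  case: ifPn => [/set_mem vy|_]; last by case: ifP => // _; rewrite -EFinM lee_fin !mulr_ge0.
  rewrite /tl; case: leqP => long.
    by rewrite mul0r; case: ifP => // _; rewrite -EFinM lee_fin !mulr_ge0.
  rewrite mem_set// -EFinM lee_fin -mulrA; apply: ler_pM => //; last exact: bB.
  exact: mass_ratio_le_mass.
apply: le_trans (lee_wpmul2l _ (tail N N0)) _; first by rewrite lee_fin mulr_ge0.
by rewrite -EFinM lee_fin /e -/rho le_eqVlt; apply/orP; left; apply/eqP; ring.
Unshelve. all: by end_near. Qed.

End weighted_patterns.

Section restricted_convergence.
Context (R : realType) (theta : R) (q : nat) (L : probability (borel R[i]) R).
Hypothesis theta0 : 0 < theta.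
Hypothesis L0 : L [set (0 : R[i])] = 0%E.
Context d (Om : measurableType d) (Q : probability Om R)
  (a : nat -> Om -> nat) (T : nat -> nat -> Om -> borel R[i]).
Hypothesis lim : limit_variables theta L Q a T.
Variables (R1 R2 : R).
Let F : set 'rV[R[i]]_q := outside_annulus R1 R2.
Let V : set (pattern q) := [set y | valid_pattern y].

(** The default row keeps the family measurable at the patterns that are not
    valid, where the unconstrained [T 0 p] may be read. *)
Let row_ (y : pattern q) : Om -> borel 'rV[R[i]]_q :=
  if valid_pattern y then limit_row T y else cst 0.

Let event (y : pattern q) : set Om := row_ y @^-1` F.

Let mrow y : measurable_fun setT (row_ y).
Proof.
by rewrite /row_; case: ifPn => [vy|_]; [exact: (limit_row_measurable lim vy)|exact: measurable_cst].
Qed.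

Let mevent y : measurable (event y).
Proof. exact: (preimageT_measurable (mrow y) (outside_annulus_measurable R1 R2)). Qed.

Let moment0 (y : pattern q) : 0 <= Poisson_moment theta (pat_lengths y).
Proof. by apply: prodr_ge0 => k _; rewrite divr_ge0// ltW. Qed.

Section mixtures.
Variables (mu : set (borel 'rV[R[i]]_q) -> \bar R) (c : pattern q -> R).
Hypothesis c0 : forall y, 0 <= c y.
Hypothesis muE : forall A, measurable A ->
  mu A = (\esum_(y in V) (c y)%:E * Q ((limit_row T y : Om -> borel 'rV[R[i]]_q) @^-1` A))%E.

Lemma restricted_mixture (A : set (borel 'rV[R[i]]_q)) : measurable A ->
  restriction mu F A = (\esum_(y in V) (c y)%:E * Q (event y `&` row_ y @^-1` A))%E.
Proof.
move=> mA; rewrite /restriction muE; last first.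
  apply: measurableI => //; exact: outside_annulus_measurable.
apply: eq_esum => y vy; congr (_ * Q _)%E.
by rewrite /event /row_ vy setIC.
Qed.

Lemma restricted_mixture_integral (f : borel 'rV[R[i]]_q -> R) :
  measurable_fun setT f -> (forall v, 0 <= f v) ->
  (\int[restriction mu F]_v (f v)%:E =
   \esum_(y in V) (c y)%:E * \int[Q]_(w in event y) (f (row_ y w))%:E)%E.
Proof.
move=> mf f0.
apply: (integral_mixture c0 mevent mrow restricted_mixture); last by move=> v; rewrite lee_fin.
exact/measurable_EFinP.
Qed.

Lemma restricted_mixture_finite : (forall A, 0 <= mu A)%E ->
  (\esum_(y in V) (c y)%:E * Q (event y) < +oo)%E -> is_finite_measure (restriction mu F).
Proof.
move=> mu0 fin.
apply: (mixture_is_finite_measure c0 mevent mrow restricted_mixture) => // A.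
exact: mu0.
Qed.

End mixtures.

Hypothesis log_U : in_U L (@log_modulus R) q.+1%:R.
Hypothesis R1_gt0 : 0 < R1.
Hypothesis R1_lt : R1 < expR (fine 'E_L[@log_modulus R]).
Hypothesis R2_gt : expR (fine 'E_L[@log_modulus R]) < R2.

Let pattern_bound : exists2 D : R, 0 <= D & forall y, V y ->
  ((Poisson_moment theta (pat_lengths y))%:E * Q (event y) <= (base_product D y)%:E)%E.
Proof.
have [C C0 hC] := root_outside_annulus L0 lim log_U R1_gt0 R1_lt R2_gt.
exists (theta * C); first by rewrite mulr_ge0// ltW.
move=> y vy; have H := pattern_outside_annulus lim vy hC.
rewrite /event /row_ vy; apply: le_trans (lee_wpmul2l _ H) _; first by rewrite lee_fin.
rewrite -EFinM lee_fin /Poisson_moment big_map big_filter big_enum_cond -big_split /=.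
rewrite le_eqVlt; apply/orP; left; apply/eqP; apply: eq_bigr => b _.
have k0 : (pat_len y b)%:R != 0 :> R by rewrite pnatr_eq0 -lt0n pat_len_gt0.
rewrite powR_mulrn// [in RHS]exprS; field.
by rewrite k0 expf_neq0.
Qed.

(** Both integrals are sums over the patterns of the same terms, with the ratio of
    masses as the only difference; the integral of a bounded function on the
    event of a pattern is at most a multiple of [base_product]. *)
Lemma restricted_convergence
    d' (Om' : measurableType d') (P : probability Om' R) (M : forall N, Om' -> 'M[R[i]]_N) :
  (forall N, (1 <= N)%N -> follows_ewens_matrix theta L P (M N)) ->
  weakly_converges (fun N => restriction (mu_tilde P (M N)) F)
    (restriction (@mu_tilde_infty R q _ _ Q a T) F).
Proof.
move=> M_law; have [D D0 VD] := pattern_bound.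
pose Pm (y : pattern q) := Poisson_moment theta (pat_lengths y).
pose K (y : pattern q) := sumn (pat_lengths y).
have ratio0 N k : 0 <= mass_ratio theta N k by exact: mass_ratio_ge0.
have muE N : (1 <= N)%N -> forall A : set (borel 'rV[R[i]]_q), measurable A -> mu_tilde P (M N) A =
    (\esum_(y in V) (Pm y * mass_ratio theta N (K y))%:E *
       Q ((limit_row T y : Om -> borel 'rV[R[i]]_q) @^-1` A))%E.
  by move=> N1 A mA; exact: (mu_tilde_mixture theta0 L0 (M_law N N1) lim mA).
have infE := mu_tilde_infty_mixture theta0 L0 lim (q := q).
have Pm0 y : 0 <= Pm y by exact: moment0.
have c0 N y : 0 <= Pm y * mass_ratio theta N (K y) by rewrite mulr_ge0.
have tuples_ge0 (I : choiceType) (J : set I) (om : I -> R[i]) (A : set (borel 'rV[R[i]]_q)) :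
    (0 <= distinct_tuples_measure J om A)%E.
  by apply: esum_ge0 => j _; rewrite lee_fin.
have Pm_Q0 y : (0 <= (Pm y)%:E * Q (event y))%E by rewrite mule_ge0// lee_fin.
have sum_fin : (\esum_(y in V) (Pm y)%:E * Q (event y) < +oo)%E.
  by apply: le_lt_trans (le_esum VD) (base_product_summable q D0).
apply: weakly_converges_nonneg.
- near=> N; have N1 : (1 <= N)%N by near: N; exact: nbhs_infty_gt.
  apply: (restricted_mixture_finite (c0 N) (muE N N1)).
    by move=> A; apply: integral_ge0 => w _.
  pose rho := 1 + (ewens_mass theta N)^-1.
  have rho0 : 0 <= rho by rewrite addr_ge0// invr_ge0 ltW// ewens_mass_gt0.
  apply: (@le_lt_trans _ _ (rho%:E * \esum_(y in V) ((Pm y)%:E * Q (event y)))%E); last first.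
    exact: lte_mul_pinfty.
  rewrite -esumZl//; apply: le_esum => y _; rewrite muleA -EFinM.
  by apply: lee_wpmul2r => //; rewrite lee_fin mulrC; apply: ler_wpM2r => //; exact: mass_ratio_le_mass.
- apply: (restricted_mixture_finite moment0 infE) => //.
  by move=> A; apply: integral_ge0 => w _.
move=> g cg [B gB].
have g0 v : 0 <= g v by case/andP: (gB v).
have B0 : 0 <= B by apply: le_trans (g0 0) _; case/andP: (gB 0).
have mg : measurable_fun setT (g : borel 'rV[R[i]]_q -> R) by exact: continuous_borel_measurable.
pose I y := (\int[Q]_(w in event y) (g (row_ y w))%:E)%E.
have I0 y : (0 <= I y)%E by apply: integral_ge0 => w _; rewrite lee_fin.
have mgr y : measurable_fun (event y) (fun w => (g (row_ y w))%:E).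
  apply/measurable_EFinP; apply: (measurable_funS measurableT) => //.
  exact: (measurableT_comp mg (mrow y)).
have I_le y : (I y <= B%:E * Q (event y))%E.
  rewrite -[leRHS](integral_cst Q (mevent y) B%:E); apply: ge0_le_integral => //.
  - by move=> w _; rewrite lee_fin.
  - by move=> w _; rewrite lee_fin; case/andP: (gB (row_ y w)).
have I_fin y : I y = (fine (I y))%:E.
  rewrite fineK// ge0_fin_numE//; apply: le_lt_trans (I_le y) _.
  apply: lte_mul_pinfty => //; apply: le_lt_trans (probability_le1 Q (mevent y)) _; exact: ltry.
pose b y := Pm y * fine (I y).
have b0 y : 0 <= b y by rewrite mulr_ge0// fine_ge0.
have bB y : V y -> b y <= B * base_product D y.
  move=> vy; rewrite -lee_fin /b EFinM -I_fin.
  apply: le_trans (lee_wpmul2l _ (I_le y)) _; first by rewrite lee_fin.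
  by rewrite muleCA EFinM lee_wpmul2l// VD.
have := mass_ratio_sum_cvg theta0 D0 B0 b0 bB.
rewrite (restricted_mixture_integral moment0 infE mg g0).
rewrite (_ : \esum_(y in V) _ = \esum_(y in V) (b y)%:E)%E; last first.
  by apply: eq_esum => y _; rewrite -/(I y) I_fin.
apply: cvg_trans; apply: near_eq_cvg; near=> N.
have N1 : (1 <= N)%N by near: N; exact: nbhs_infty_gt.
rewrite (restricted_mixture_integral (c0 N) (muE N N1) mg g0).
by apply: eq_esum => y _; rewrite -/(I y) I_fin -EFinM /b mulrCA mulrA.
Unshelve. all: by end_near. Qed.

End restricted_convergence.

Theorem proposition3p20 (R : realType) (theta : R) (q : nat)
    (L : probability (borel R[i]) R)
    (d : measure_display) (Om : measurableType d) (P : probability Om R)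
    (M : forall N : nat, Om -> 'M[R[i]]_N)
    (theta_gt0 : 0 < theta) (q_ge1 : (1 <= q)%N)
    (L_C_star : L [set (0 : R[i])] = 0%E)
    (M_law : forall N, (1 <= N)%N -> follows_ewens_matrix theta L P (M N))
    (log_integrable : L.-integrable setT (EFin \o @log_modulus R)) :
  let rho : R := expR (fine 'E_L[@log_modulus R]) in
  weakly_converges
    (fun N A => (((N ^_ q)%:R^-1)%:E * mu_tilde P (M N) A)%E)
    (@product_power R (uniform_circle rho) q) /\
  (in_U L (@log_modulus R) (q.+1)%:R ->
   forall (d' : measure_display) (Om' : measurableType d')
     (P' : probability Om' R)
     (a : nat -> Om' -> nat) (T : nat -> nat -> Om' -> R[i]),
     limit_variables theta L P' a T ->
   forall R1 R2 : R, 0 < R1 -> R1 < rho -> rho < R2 ->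
     weakly_converges
       (fun N => restriction (mu_tilde P (M N)) (outside_annulus R1 R2))
       (restriction (@mu_tilde_infty R q _ _ P' a T) (outside_annulus R1 R2))).
Proof.
move=> rho; split; first exact: (normalized_convergence theta_gt0 q_ge1 L_C_star M_law log_integrable).
move=> log_U d' Om' P' a T lim R1 R2 R1_gt0 R1_lt R2_gt.
exact: (restricted_convergence theta_gt0 L_C_star lim log_U R1_gt0 R1_lt R2_gt M_law).
Qed.
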